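(* Let $H$ be a finite dimensional coquasi Hopf algebra over a field $\Bbbk$. Then there exists a one dimensional object $W\in\mathcal M^H$, unique up to isomorphism, such that there is an isomorphism ${}_0W\otimes H\cong{}^*H$ in the category ${}^H\!\mathcal M^H_H$ of Hopf modules. Moreover, $W$ can be taken to be the space of left cointegrals of $H$, and the isomorphism (called the Frobenius isomorphism) to be the map $\mathcal F:{}_0W\otimes H\to{}^*H$ given by $$\mathcal F(\varphi\otimes x)=\varphi\cdot x ,$$ where $\cdot$ denotes the right $H$-action on ${}^*H$ dual to the left regular action of $H$ on itself.
   Context: $\otimes=\otimes_\Bbbk$; $\Delta(c)=\sum c_1\otimes c_2$, counit $\varepsilon$. A coquasi bialgebra is a coalgebra $C$ with coalgebra morphisms $p:C\otimes C\to C$, $p(c\otimes d)=cd$, $u:\Bbbk\to C$, $1=u(1)$, and a convolution-invertible $\phi:C^{\otimes3}\to\Bbbk$ with $1c=c=c1$; $\sum (c_1d_1)e_1\phi(c_2\otimes d_2\otimes e_2)=\sum\phi(c_1\otimes d_1\otimes e_1)c_2(d_2e_2)$; $\sum\phi(c_1d_1\otimes e_1\otimes f_1)\phi(c_2\otimes d_2\otimes e_2f_2)=\sum\phi(c_1\otimes d_1\otimes e_1)\phi(c_2\otimes d_2e_2\otimes f_1)\phi(d_3\otimes e_3\otimes f_2)$; $\phi(c\otimes1\otimes d)=\varepsilon(c)\varepsilon(d)$. A coquasi Hopf algebra is a coquasi bialgebra $H$ with an antipode $(S,\alpha,\beta)$: $S:H^{\mathrm{cop}}\to H$ a coalgebra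 morphism, $\alpha,\beta:H\to\Bbbk$, with $\sum S(h_1)\alpha(h_2)h_3=\alpha(h)1$, $\sum h_1\beta(h_2)S(h_3)=\beta(h)1$, $\sum\phi^{-1}(h_1\otimes Sh_3\otimes h_5)\beta(h_2)\alpha(h_4)=\varepsilon(h)$, $\sum\phi(Sh_1\otimes h_3\otimes Sh_5)\alpha(h_2)\beta(h_4)=\varepsilon(h)$. For $H$ finite dimensional $S$ is bijective, with inverse $\overline S$. $\mathcal M^H$ is the category of right $H$-comodules and ${}^H\!\mathcal M^H$ that of $H$-bicomodules. The latter is monoidal under $\otimes_\Bbbk$ with coaction $m\otimes n\mapsto\sum m_{-1}n_{-1}\otimes m_0\otimes n_0\otimes m_1n_1$, unit $\Bbbk$, and associativity $\Phi((l\otimes m)\otimes n)=\sum\phi(l_{-1}\otimes m_{-1}\otimes n_{-1})\,l_0\otimes(m_0\otimes n_0)\,\phi^{-1}(l_1\otimes m_1\otimes n_1)$. $H$, with coaction $\Delta^2$, is an associative algebra in ${}^H\!\mathcal M^H$ via $p$ and $u$; ${}^H\!\mathcal M^H_H$ denotes the category of right $H$-modules in ${}^H\!\mathcal M^H$ (Hopf modules). For a bicomodule $X$, $X\otimes H$ is a Hopf module with action $(\mathrm{id}\otimes p)\Phi_{X,H,H}$. For $M\in\mathcal M^H$, ${}_0M$ is the bicomodule $M$ with trivial left coaction $m\mapsto1\otimes m$ and the given right coaction. Left dual: for a finite dimensional bicomodule $M$ with basis $(m_i)$ and dual basis $(m^i)$, ${}^*M$ is the dual space $M^\vee$ with coaction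 determined by $\sum f_0(m)f_{-1}\otimes f_1=\sum f(m_0)\overline S(m_{-1})\otimes S(m_1)$, with $\mathrm{ev}^\ell:{}^*M\otimes M\to\Bbbk$, $f\otimes m\mapsto\sum\beta(\overline S(m_{-1}))f(m_0)\alpha(m_1)$, and $\mathrm{coev}^\ell:\Bbbk\to M\otimes{}^*M$, $1\mapsto\sum_i\alpha(\overline S((m_i)_{-1}))(m_i)_0\beta((m_i)_1)\otimes m^i$. $H$ is a left $H$-module in ${}^H\!\mathcal M^H$ via $p$. The induced right action ${}^*H\otimes H\to{}^*H$, $f\otimes x\mapsto f\cdot x$, is the composition $${}^*H\otimes H\xrightarrow{\mathrm{id}\otimes\mathrm{coev}^\ell}({}^*H\otimes H)\otimes(H\otimes{}^*H)\xrightarrow{\cong}({}^*H\otimes(H\otimes H))\otimes{}^*H\xrightarrow{(\mathrm{id}\otimes p)\otimes\mathrm{id}}({}^*H\otimes H)\otimes{}^*H\xrightarrow{\mathrm{ev}^\ell\otimes\mathrm{id}}{}^*H$$ where $\cong$ is given by the associativity constraints; it makes ${}^*H$ a Hopf module. A left cointegral is $\varphi\in{}^*H$ with $\sum x_1\varphi(x_2)=\varphi(x)1$ for all $x\in H$. The space $W$ of left cointegrals is the space of left coinvariants of ${}^*H$ and is a right comodule by restricting the right coaction of ${}^*H$. *)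

(* Defs.v *)
From HB Require Import structures.
From mathcomp Require Import all_boot all_order all_algebra.

Set Implicit Arguments.
Unset Strict Implicit.
Unset Printing Implicit Defensive.

Import GRing.Theory.
Local Open Scope ring_scope.

(** * Tensor products of finite dimensional vector spaces

    [V *t W] is modelled by the matrices of coordinates in the bases
    [vbasis {:V}] and [vbasis {:W}].  [tsum t B] is the value at [t] of the
    linear map [V *t W -> U] induced by a bilinear [B : V -> W -> U]
    ([tsum_tmk], [tsum_id]); it is only ever used with bilinear [B], and it is
    what interprets Sweedler's notation: [\tsum_(x, y <- t) E] is the sum of
    the [E] over "t = sum x (x) y". *)

Section Tensor.
Variable k : fieldType.
Implicit Types V W U : vectType k.

Definition tens V W : vectType k := 'M[k]_(\dim {:V}, \dim {:W}).

Definition tmk V W (v : V) (w : W) : tens V W :=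
  \matrix_(i, j) (coord (vbasis {:V}) i v * coord (vbasis {:W}) j w).

Definition tsum V W U (t : tens V W) (B : V -> W -> U) : U :=
  \sum_i \sum_j
    (t : 'M[k]_(\dim {:V}, \dim {:W})) i j *:
      B (vbasis {:V})`_i (vbasis {:W})`_j.

Definition tlift V W U (B : V -> W -> U) : 'Hom(tens V W, U) :=
  linfun (fun t => tsum t B).

Definition tmap V W V' W' (f : 'Hom(V, V')) (g : 'Hom(W, W')) :
    'Hom(tens V W, tens V' W') :=
  tlift (fun v w => tmk (f v) (g w)).

End Tensor.

Notation "V *t W" := (tens V W) (at level 40, left associativity).
Notation "v \ox w" := (tmk v w) (at level 40, left associativity).
Notation "\tsum_ ( x , y <- t ) E" := (tsum t (fun x y => E))
  (at level 41, x name, y name, t at level 60, E at level 41,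
   right associativity, format "\tsum_ ( x ,  y  <-  t )  E").

Section TensorTheory.
Variable k : fieldType.
Implicit Types V W U : vectType k.

Lemma tsum_linear V W U (B : V -> W -> U) : linear (fun t => tsum t B).
Proof.
move=> a s t; rewrite /tsum scaler_sumr -big_split /=; apply: eq_bigr => i _.
rewrite scaler_sumr -big_split /=; apply: eq_bigr => j _.
by rewrite !mxE scalerDl scalerA.
Qed.

Lemma tliftE V W U (B : V -> W -> U) t : tlift B t = tsum t B.
Proof.
pose m := GRing.isLinear.Build k (V *t W) U *:%R (fun t => tsum t B)
  (tsum_linear B).
pose L : {linear V *t W -> U} := HB.pack (fun t => tsum t B) m.
exact: (lfunE L).
Qed.

Lemma tsum_tmk V W U (B : V -> W -> U) v w :
  (forall w, linear (B^~ w)) -> (forall v, linear (B v)) ->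
  tsum (v \ox w) B = B v w.
Proof.
move=> Bl Br.
pose Blm w := GRing.isLinear.Build k V U *:%R (B^~ w) (Bl w).
pose BL w : {linear V -> U} := HB.pack (B^~ w) (Blm w).
pose Brm v := GRing.isLinear.Build k W U *:%R (B v) (Br v).
pose BR v : {linear W -> U} := HB.pack (B v) (Brm v).
transitivity (BL w (\sum_i coord (vbasis {:V}) i v *: (vbasis {:V})`_i)).
  rewrite linear_sum; apply: eq_bigr => i _; rewrite linearZ /=.
  set b := _`_i.
  transitivity (coord (vbasis {:V}) i v *:
      BR b (\sum_j coord (vbasis {:W}) j w *: (vbasis {:W})`_j)).
    rewrite linear_sum scaler_sumr; apply: eq_bigr => j _.
    by rewrite linearZ /= mxE scalerA.
  by rewrite -coord_vbasis ?memvf.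
by rewrite -coord_vbasis ?memvf.
Qed.

Lemma tmk_linearl V W (w : W) : linear (fun v : V => v \ox w).
Proof.
by move=> a x y; apply/matrixP=> i j; rewrite !mxE linearP mulrDl mulrA.
Qed.

Lemma tmk_linearr V W (v : V) : linear (fun w : W => v \ox w).
Proof.
by move=> a x y; apply/matrixP=> i j; rewrite !mxE linearP mulrDr mulrCA.
Qed.

Lemma tsum_id V W (t : V *t W) : \tsum_(v, w <- t) v \ox w = t.
Proof.
apply/matrixP=> a b; rewrite /tsum summxE (bigD1 a) //= summxE (bigD1 b) //=.
have fV : free (vbasis {:V}) := basis_free (vbasisP _).
have fW : free (vbasis {:W}) := basis_free (vbasisP _).
rewrite !mxE !coord_free // !eqxx !mulr1 big1 => [|j nj]; last first.
  by rewrite !mxE !coord_free // (negPf nj) !mulr0.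
rewrite addr0 big1 ?addr0 // => i ni; rewrite summxE big1 // => j _.
by rewrite !mxE !coord_free // (negPf ni) mul0r mulr0.
Qed.

End TensorTheory.


(** * Coalgebras *)

Record coalgData (k : fieldType) := CoalgData {
  coalg_sort :> vectType k;
  comul : 'Hom(coalg_sort, coalg_sort *t coalg_sort);
  counit : 'Hom(coalg_sort, k^o)
}.

Section Coalgebra.
Variable k : fieldType.
Implicit Types C D : coalgData k.

Definition is_coalgebra C : Prop :=
  [/\ forall c : C,
        \tsum_(c', c3 <- comul C c) \tsum_(c1, c2 <- comul C c')
          c1 \ox (c2 \ox c3)
        = \tsum_(c1, c' <- comul C c) \tsum_(c2, c3 <- comul C c')
          c1 \ox (c2 \ox c3),
      forall c : C, \tsum_(c1, c2 <- comul C c) counit C c1 *: c2 = c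
    & forall c : C, \tsum_(c1, c2 <- comul C c) counit C c2 *: c1 = c].

Definition is_coalg_morph C D (f : 'Hom(C, D)) : Prop :=
  (forall c, comul D (f c) = \tsum_(c1, c2 <- comul C c) f c1 \ox f c2) /\
  (forall c, counit D (f c) = counit C c).

Definition coalg_unit : coalgData k :=
  @CoalgData k k^o
    (linfun (fun a : k^o => a *: ((1 : k^o) \ox (1 : k^o)))) \1%VF.

Definition coalg_tens C D : coalgData k :=
  @CoalgData k (C *t D)
    (tlift (fun c d => \tsum_(c1, c2 <- comul C c) \tsum_(d1, d2 <- comul D d)
       (c1 \ox d1) \ox (c2 \ox d2)))
    (tlift (fun c d => counit C c * counit D d)).

Definition coalg_cop C : coalgData k :=
  @CoalgData k C
    (linfun (fun c => \tsum_(c1, c2 <- comul C c) c2 \ox c1)) (counit C).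

Definition convol C (f g : 'Hom(C, k^o)) : 'Hom(C, k^o) :=
  linfun (fun c => \tsum_(c1, c2 <- comul C c) f c1 * g c2).

Definition convol_inverse C (f g : 'Hom(C, k^o)) : Prop :=
  convol f g = counit C /\ convol g f = counit C.

End Coalgebra.

(** * Coquasi bialgebras and coquasi Hopf algebras *)

Section CoquasiAxioms.
Variables (k : fieldType) (C : coalgData k).
Variables (p : 'Hom(C *t C, C)) (u : 'Hom(k^o, C)).
Variables (phi phiV : 'Hom(C *t C *t C, k^o)).
Local Notation Delta := (comul C).
Local Notation eps := (counit C).
Local Notation "c ** d" := (p (c \ox d)) (at level 40, left associativity).

Definition coquasi_unital : Prop :=
  forall c : C, u 1 ** c = c /\ c ** u 1 = c.

Definition coquasi_assoc : Prop := forall c d e : C,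
  \tsum_(c1, c2 <- Delta c) \tsum_(d1, d2 <- Delta d)
  \tsum_(e1, e2 <- Delta e)
    phi (c2 \ox d2 \ox e2) *: ((c1 ** d1) ** e1)
  = \tsum_(c1, c2 <- Delta c) \tsum_(d1, d2 <- Delta d)
    \tsum_(e1, e2 <- Delta e)
    phi (c1 \ox d1 \ox e1) *: (c2 ** (d2 ** e2)).

Definition coquasi_cocycle : Prop := forall c d e f : C,
  \tsum_(c1, c2 <- Delta c) \tsum_(d1, d2 <- Delta d)
  \tsum_(e1, e2 <- Delta e) \tsum_(f1, f2 <- Delta f)
    phi ((c1 ** d1) \ox e1 \ox f1) * phi (c2 \ox d2 \ox (e2 ** f2))
  = \tsum_(c1, c2 <- Delta c)
    \tsum_(d1, d' <- Delta d) \tsum_(d2, d3 <- Delta d')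
    \tsum_(e1, e' <- Delta e) \tsum_(e2, e3 <- Delta e')
    \tsum_(f1, f2 <- Delta f)
    phi (c1 \ox d1 \ox e1) * phi (c2 \ox (d2 ** e2) \ox f1)
      * phi (d3 \ox e3 \ox f2).

Definition coquasi_normal : Prop := forall c d : C,
  phi (c \ox u 1 \ox d) = eps c * eps d.

Variables (S : 'Hom(C, C)) (alpha beta : 'Hom(C, k^o)).

Definition antipode_alpha : Prop := forall h : C,
  \tsum_(h1, t <- Delta h) \tsum_(h2, h3 <- Delta t)
    alpha h2 *: (S h1 ** h3) = alpha h *: u 1.

Definition antipode_beta : Prop := forall h : C,
  \tsum_(h1, t <- Delta h) \tsum_(h2, h3 <- Delta t)
    beta h2 *: (h1 ** S h3) = beta h *: u 1.

Definition antipode_phiV : Prop := forall h : C,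
  \tsum_(h1, t <- Delta h) \tsum_(h2, t' <- Delta t)
  \tsum_(h3, t'' <- Delta t') \tsum_(h4, h5 <- Delta t'')
    phiV (h1 \ox S h3 \ox h5) * beta h2 * alpha h4 = eps h.

Definition antipode_phi : Prop := forall h : C,
  \tsum_(h1, t <- Delta h) \tsum_(h2, t' <- Delta t)
  \tsum_(h3, t'' <- Delta t') \tsum_(h4, h5 <- Delta t'')
    phi (S h1 \ox h3 \ox S h5) * alpha h2 * beta h4 = eps h.

End CoquasiAxioms.

(** [mulC] and [unitC] are p and u; [reass] is phi, with convolution inverse
    [reassV]. *)
Record coquasiBialg (k : fieldType) := CoquasiBialg {
  cqb_coalg :> coalgData k;
  mulC : 'Hom(cqb_coalg *t cqb_coalg, cqb_coalg);
  unitC : 'Hom(k^o, cqb_coalg);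
  reass : 'Hom(cqb_coalg *t cqb_coalg *t cqb_coalg, k^o);
  reassV : 'Hom(cqb_coalg *t cqb_coalg *t cqb_coalg, k^o);
  cqb_coalgP : is_coalgebra cqb_coalg;
  mulC_morph : is_coalg_morph (C := coalg_tens cqb_coalg cqb_coalg) mulC;
  unitC_morph : is_coalg_morph (C := coalg_unit k) unitC;
  reassP : convol_inverse
    (C := coalg_tens (coalg_tens cqb_coalg cqb_coalg) cqb_coalg) reass reassV;
  mulC_unital : coquasi_unital mulC unitC;
  mulC_assoc : coquasi_assoc mulC reass;
  reass_cocycle : coquasi_cocycle mulC reass;
  reass_normal : coquasi_normal unitC reass
}.

Record coquasiHopf (k : fieldType) := CoquasiHopf {
  cqh_bialg :> coquasiBialg k;
  antip : 'Hom(cqh_bialg, cqh_bialg);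
  antip_alpha : 'Hom(cqh_bialg, k^o);
  antip_beta : 'Hom(cqh_bialg, k^o);
  antip_morph : is_coalg_morph (C := coalg_cop cqh_bialg) antip;
  antip_alphaP : antipode_alpha (mulC cqh_bialg) (unitC cqh_bialg) antip
    antip_alpha;
  antip_betaP : antipode_beta (mulC cqh_bialg) (unitC cqh_bialg) antip
    antip_beta;
  antip_phiVP : antipode_phiV (reassV cqh_bialg) antip antip_alpha antip_beta;
  antip_phiP : antipode_phi (reass cqh_bialg) antip antip_alpha antip_beta
}.

(** * Comodules, bicomodules and Hopf modules

    Each kind of object is given by its underlying data together with a
    predicate collecting the axioms. *)

Record comodData (k : fieldType) (H : coquasiHopf k) := ComodData {
  comod_sort :> vectType k;
  comod_co : 'Hom(comod_sort, comod_sort *t H)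
}.

Record bicomodData (k : fieldType) (H : coquasiHopf k) := BicomodData {
  bicomod_sort :> vectType k;
  lco : 'Hom(bicomod_sort, H *t bicomod_sort);
  rco : 'Hom(bicomod_sort, bicomod_sort *t H)
}.

(** [\bco_(a, x, b <- m) E] is the sum of [E] with [a], [x], [b] standing for
    the Sweedler components [m_{-1}], [m_0], [m_1] of [m]. *)
Notation "\bco_ ( a , x , b <- m ) E" :=
  (tsum (lco _ m) (fun a m' => tsum (rco _ m') (fun x b => E)))
  (at level 41, a name, x name, b name, m at level 60, E at level 41,
   right associativity, format "\bco_ ( a ,  x ,  b  <-  m )  E").

Section Bicomodules.
Variables (k : fieldType) (H : coquasiHopf k).
Implicit Types L M N : bicomodData H.
Implicit Types V W : comodData H.
Local Notation Delta := (comul H).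
Local Notation eps := (counit H).
Local Notation phi := (reass H).
Local Notation phiV := (reassV H).
Local Notation "c ** d" := (mulC H (c \ox d))
  (at level 40, left associativity).

Definition right_coaction (X : vectType k) (rho : 'Hom(X, X *t H)) : Prop :=
  (forall x, \tsum_(x', h2 <- rho x) \tsum_(x0, h1 <- rho x')
      x0 \ox (h1 \ox h2)
    = \tsum_(x0, h <- rho x) \tsum_(h1, h2 <- Delta h) x0 \ox (h1 \ox h2)) /\
  (forall x, \tsum_(x0, h <- rho x) eps h *: x0 = x).

Definition left_coaction (X : vectType k) (lam : 'Hom(X, H *t X)) : Prop :=
  (forall x, \tsum_(h1, x' <- lam x) \tsum_(h2, x0 <- lam x')
      h1 \ox (h2 \ox x0)
    = \tsum_(h, x0 <- lam x) \tsum_(h1, h2 <- Delta h) h1 \ox (h2 \ox x0)) /\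
  (forall x, \tsum_(h, x0 <- lam x) eps h *: x0 = x).

Definition is_comod W : Prop := right_coaction (comod_co W).

Definition is_bicomod M : Prop :=
  [/\ left_coaction (lco M), right_coaction (rco M)
    & forall m, \tsum_(h, m' <- lco M m) \tsum_(m0, g <- rco M m')
          h \ox (m0 \ox g)
        = \tsum_(m', g <- rco M m) \tsum_(h, m0 <- lco M m')
          h \ox (m0 \ox g)].

Definition comod_hom V W (f : 'Hom(V, W)) : Prop :=
  forall v, comod_co W (f v) = \tsum_(v0, h <- comod_co V v) f v0 \ox h.

Definition comod_isom V W : Prop :=
  exists f : 'Hom(V, W), exists g : 'Hom(W, V),
    [/\ comod_hom f, comod_hom g, cancel f g & cancel g f].

Definition bicomod_hom M N (f : 'Hom(M, N)) : Prop :=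
  (forall m, lco N (f m) = \tsum_(h, m0 <- lco M m) h \ox f m0) /\
  (forall m, rco N (f m) = \tsum_(m0, h <- rco M m) f m0 \ox h).

Definition btens M N : bicomodData H :=
  @BicomodData k H (M *t N)
    (tlift (fun m n => \tsum_(h, m0 <- lco M m) \tsum_(g, n0 <- lco N n)
       (h ** g) \ox (m0 \ox n0)))
    (tlift (fun m n => \tsum_(m0, h <- rco M m) \tsum_(n0, g <- rco N n)
       (m0 \ox n0) \ox (h ** g))).

Definition Phi L M N : 'Hom(L *t M *t N, L *t (M *t N)) :=
  tlift (fun t (n : N) => \tsum_(l, m <- t)
    \bco_(a, l0, a' <- l) \bco_(b, m0, b' <- m) \bco_(c, n0, c' <- n)
      (phi (a \ox b \ox c) * phiV (a' \ox b' \ox c'))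
        *: (l0 \ox (m0 \ox n0))).

Definition PhiV L M N : 'Hom(L *t (M *t N), L *t M *t N) :=
  tlift (fun (l : L) t => \tsum_(m, n <- t)
    \bco_(a, l0, a' <- l) \bco_(b, m0, b' <- m) \bco_(c, n0, c' <- n)
      (phiV (a \ox b \ox c) * phi (a' \ox b' \ox c'))
        *: ((l0 \ox m0) \ox n0)).

Definition regular_bicomod : bicomodData H := BicomodData Delta Delta.

Definition trivial_left W : bicomodData H :=
  @BicomodData k H W (linfun (fun w => unitC H 1 \ox w)) (comod_co W).

End Bicomodules.

Record hopfModData (k : fieldType) (H : coquasiHopf k) := HopfModData {
  hopfmod_bicomod :> bicomodData H;
  hact : 'Hom(hopfmod_bicomod *t H, hopfmod_bicomod)
}.

Section HopfModules.
Variables (k : fieldType) (H : coquasiHopf k).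
Implicit Types X : bicomodData H.
Implicit Types M N : hopfModData H.
Local Notation Delta := (comul H).
Local Notation one := (unitC H 1).
Local Notation p := (mulC H).
Local Notation S := (antip H).
Local Notation alpha := (antip_alpha H).
Local Notation beta := (antip_beta H).
Local Notation HH := (regular_bicomod H).

Definition is_hopfmod M : Prop :=
  [/\ is_bicomod M,
      bicomod_hom (M := btens M HH) (N := M) (hact M),
      forall (m : M) (x y : H),
        hact M (hact M (m \ox x) \ox y)
        = (hact M \o tmap \1 p)%VF (Phi M HH HH (m \ox x \ox y))
    & forall m : M, hact M (m \ox one) = m].

Definition hopfmod_hom M N (f : 'Hom(M, N)) : Prop :=
  bicomod_hom f /\
  forall (m : M) (x : H), f (hact M (m \ox x)) = hact N (f m \ox x).

Definition hopfmod_iso M N (f : 'Hom(M, N)) : Prop :=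
  [/\ is_hopfmod M, is_hopfmod N, hopfmod_hom f
    & exists g : 'Hom(N, M), [/\ hopfmod_hom g, cancel f g & cancel g f]].

Definition free_hopfmod X : hopfModData H :=
  @HopfModData k H (btens X HH) (tmap \1 p \o Phi X HH HH)%VF.

(** The antipode of a finite dimensional coquasi Hopf algebra is bijective, so
    that [S^-1] is its two-sided inverse. *)
Local Notation Sbar := (S^-1)%VF.

Definition dualv (V : vectType k) (i : 'I_(\dim {:V})) : 'Hom(V, k^o) :=
  linfun (coord (vbasis {:V}) i : V -> k^o).

(** The coactions of the dual, written out in dual bases, are those with
    sum f_0(m) f_{-1} (x) f_1 = sum f(m_0) S^-1(m_{-1}) (x) S(m_1). *)
Definition ldual X : bicomodData H :=
  @BicomodData k H 'Hom(X, k^o)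
    (linfun (fun f : 'Hom(X, k^o) => \sum_(i < \dim {:X})
       \tsum_(h, m0 <- lco X (vbasis {:X})`_i) f m0 *: (Sbar h \ox dualv i)))
    (linfun (fun f : 'Hom(X, k^o) => \sum_(i < \dim {:X})
       \tsum_(m0, h <- rco X (vbasis {:X})`_i) f m0 *: (dualv i \ox S h))).

Definition evl X : 'Hom(ldual X *t X, k^o) :=
  tlift (fun (f : ldual X) m =>
    \bco_(a, m0, b <- m)
      beta (Sbar a) * (f : 'Hom(X, k^o)) m0 * alpha b).

Definition coevl X : X *t ldual X :=
  \sum_(i < \dim {:X}) \bco_(a, m0, b <- (vbasis {:X})`_i)
    (alpha (Sbar a) * beta b) *: (m0 \ox (dualv i : ldual X)).

Definition dualH : bicomodData H := ldual HH.

(** The right action on the dual induced by left multiplication: reading the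
    composition from the bottom, insert [coevl], reassociate
    (D H)(H D) -> ((D H) H) D -> (D (H H)) D by [PhiV] then [Phi], multiply in
    H, and evaluate, where D is the dual of H. *)
Definition dual_act : 'Hom(dualH *t H, dualH) :=
  (tlift (fun t (g : dualH) => evl HH t *: g)
     \o tmap (tmap \1 p) \1
     \o tmap (Phi dualH HH HH) \1
     \o PhiV (btens dualH HH) HH dualH
     \o linfun (fun t : dualH *t HH => t \ox coevl HH))%VF.

Definition dual_hopfmod : hopfModData H := @HopfModData k H dualH dual_act.

Definition left_cointegral (f : 'Hom(H, k^o)) : Prop :=
  forall x : H, \tsum_(x1, x2 <- Delta x) f x2 *: x1 = f x *: one.

End HopfModules.

(** In [cointegral_comod], [vsproj] only serves to land in the subspace: that
    the coaction of the dual preserves it is [restricts_coaction]. *)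

Section Cointegrals.
Variables (k : fieldType) (H : coquasiHopf k).
Local Notation Delta := (comul H).
Local Notation one := (unitC H 1).

Definition cointegral_defect (f : 'Hom(H, k^o)) (x : H) : H :=
  \tsum_(x1, x2 <- Delta x) f x2 *: x1 - f x *: one.

Definition left_cointegrals : {vspace dualH H} :=
  lker (linfun (fun f : 'Hom(H, k^o) => linfun (cointegral_defect f))).

Fact cointegral_defect_linear f : linear (cointegral_defect f).
Proof.
move=> a x y; rewrite /cointegral_defect !linearP tsum_linear.
by rewrite scalerDl -scalerA opprD addrACA scalerBr.
Qed.

HB.instance Definition _ f :=
  GRing.isLinear.Build k H H *:%R (cointegral_defect f)
    (cointegral_defect_linear f).

Fact cointegral_defect_linearl :
  linear (fun f : 'Hom(H, k^o) => linfun (cointegral_defect f)).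
Proof.
move=> a f g; apply/lfunP=> x; rewrite add_lfunE scale_lfunE !lfunE /=.
rewrite /cointegral_defect scalerBr addrACA -opprD; congr (_ - _).
  rewrite /tsum scaler_sumr -big_split; apply: eq_bigr => i _ /=.
  rewrite scaler_sumr -big_split; apply: eq_bigr => j _ /=.
  by rewrite add_lfunE scale_lfunE !scalerDl scalerDr !scalerA mulrCA mulrA.
by rewrite add_lfunE scale_lfunE scalerDl scalerA.
Qed.

Lemma left_cointegralsP (f : 'Hom(H, k^o)) :
  f \in left_cointegrals <-> left_cointegral f.
Proof.
pose m := GRing.isLinear.Build k 'Hom(H, k^o) 'Hom(H, H) *:%R
  (fun f => linfun (cointegral_defect f)) cointegral_defect_linearl.
pose L : {linear 'Hom(H, k^o) -> 'Hom(H, H)} :=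
  HB.pack (fun f => linfun (cointegral_defect f)) m.
have LE : linfun (fun f => linfun (cointegral_defect f)) f
    = linfun (cointegral_defect f) by exact: (lfunE L).
rewrite memv_ker LE; split=> [/eqP f0 x | fP].
  apply/eqP; rewrite -subr_eq0 -/(cointegral_defect f x).
  by rewrite -(lfunE (cointegral_defect f)) f0 lfunE.
by apply/eqP/lfunP=> x; rewrite !lfunE /= /cointegral_defect fP subrr.
Qed.

Definition cointegral_comod : comodData H :=
  @ComodData k H (subvs_of left_cointegrals)
    (linfun (fun w => \tsum_(f, h <- rco (dualH H) (vsval w))
       vsproj left_cointegrals f \ox h)).

Definition restricts_coaction : Prop :=
  forall w : subvs_of left_cointegrals,
    \tsum_(v, h <- comod_co cointegral_comod w) vsval v \ox h
    = rco (dualH H) (vsval w).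

Definition frobenius :
    'Hom(free_hopfmod (trivial_left cointegral_comod), dual_hopfmod H) :=
  tlift (fun (w : subvs_of left_cointegrals) (x : H) =>
    dual_act H (vsval w \ox x)).

Lemma frobeniusE (w : subvs_of left_cointegrals) (x : H) :
  frobenius (w \ox x) = dual_act H (vsval w \ox x).
Proof.
rewrite /frobenius tliftE tsum_tmk // => [y | v] a u v'.
  by rewrite linearP tmk_linearl linearP.
by rewrite tmk_linearr linearP.
Qed.

End Cointegrals.

(* Main.v *)
Require Import Defs.
From HB Require Import structures.
From mathcomp Require Import all_boot all_order all_algebra.
From mathcomp Require Import ring.
From Stdlib Require Import Setoid Morphisms.

Set Implicit Arguments.
Unset Strict Implicit.
Unset Printing Implicit Defensive.

Import GRing.Theory.
Local Open Scope ring_scope.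

(** Let [A] be the dual space of [H] with the convolution product.  As [H] is
    finite dimensional, [A] is a quasi-Hopf algebra: the multiplication of [H]
    turns into a coproduct of [A] ([cop]), [phi] into an invertible element of
    the third tensor power of [A] satisfying the pentagon ([ctr], [pentagon]),
    and the transpose of the antipode into an antihomomorphism of [A].  A right
    [H]-coaction is a left action of [A] and a left coaction is a right action
    ([right_coactionP], [left_coactionP]), so that all statements on bicomodules
    become identities between elements of tensor powers of [A].  Three facts
    carry the proof.

    The antipode is bijective ([antip_inj]), so that the dual of [H] is indeed a
    left dual.  The transposed antipode [s] is an epimorphism of algebras
    ([antipode_epi]).  By finite dimension some even power [s^N] is invertible
    on its own image, which yields an idempotent algebra endomorphism [e] of [A]
    with [e s^N = s^N]; cancelling [s] on the right, [N] times, gives [e = 1].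

    The dual of [H] is a Hopf module ([dual_is_hopfmod]).  A bicomodule map into
    the dual is determined by the form that it induces through the evaluation
    ([dual_hom_ext]), and the form induced by the action is
    [(f (x) x) (x) y |-> ev (f (x) x y)] up to the associator
    ([dual_act_flat]).  Associativity of the action thereby reduces to the
    pentagon and to the associativity of [H].

    In every Hopf module [M], the map
    [E m = sum alpha(S^-1(m_(-1))) m_0 . S^-1(m_(-2))] takes values in the left
    coinvariants, and every [m] is a sum of elements [E m' . x]
    ([coinv_projP], [coinv_proj_recover]); for a Hopf algebra the formula is
    [m = sum E(m_0) . m_(-1)].  Hence coinvariants generate [M], and a morphism
    of Hopf modules that is injective on coinvariants is injective
    ([hopfmod_hom_inj]).

    Now the left coinvariants of the dual of [H] are the cointegrals
    ([coinv_cointegral]), and those of the free module on [W] are [W (x) 1]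
    ([free_coinv]).  The Frobenius map is a morphism of Hopf modules that is the
    inclusion on [W (x) 1], hence it is injective, and it is surjective because
    cointegrals generate; comparing dimensions, [W] is a line.  For any [W'] with
    an isomorphism as in the theorem, restricting it to coinvariants identifies
    [W'] with the cointegrals ([coinv_comod_isom]). *)

(** * Multilinear maps on tensor products *)

Section Linear.
Variable k : fieldType.
Implicit Types U V W X Y : vectType k.

Definition lin U V (f : U -> V) : Prop :=
  forall a u v, f (a *: u + v) = a *: f u + f v.

Lemma lin_id V : lin (fun v : V => v). Proof. by []. Qed.

Lemma lin_hom U V W (g : 'Hom(V, W)) (f : U -> V) :
  lin f -> lin (fun u => g (f u)).
Proof. by move=> lf a u v; rewrite lf linearP. Qed.

Lemma lin_app U V W (v : V) (f : U -> 'Hom(V, W)) :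
  lin f -> lin (fun u => f u v).
Proof. by move=> lf a u u'; rewrite lf add_lfunE scale_lfunE. Qed.

Lemma lin_ext U V W (f : U -> 'Hom(V, W)) :
  (forall v, lin (fun u => f u v)) -> lin f.
Proof. by move=> lf a u u'; apply/lfunP=> v; rewrite lf add_lfunE scale_lfunE. Qed.

Lemma lin_comp U V W (g : V -> W) (f : U -> V) :
  lin g -> lin f -> lin (fun u => g (f u)).
Proof. by move=> lg lf a u v; rewrite lf lg. Qed.

Lemma lin_scalel U V (f : U -> k^o) (v : V) :
  lin f -> lin (fun u => (f u : k) *: v).
Proof. by move=> lf a u u'; rewrite lf scalerDl -scalerA. Qed.

Lemma lin_scaler U V (c : k) (f : U -> V) : lin f -> lin (fun u => c *: f u).
Proof. by move=> lf a u u'; rewrite lf scalerDr !scalerA mulrC. Qed.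

Lemma lin_mull U (f : U -> k^o) (c : k^o) : lin f -> lin (fun u => f u * c : k^o).
Proof. by move=> lf a u u'; rewrite lf mulrDl -[X in X + _]mulrA. Qed.

Lemma lin_mulr U (f : U -> k^o) (c : k^o) : lin f -> lin (fun u => c * f u : k^o).
Proof. by move=> lf a u u'; rewrite lf mulrDr [X in X + _]mulrCA. Qed.

Lemma lin_sum U V (I : finType) (f : I -> U -> V) :
  (forall i, lin (f i)) -> lin (fun u => \sum_i f i u).
Proof.
move=> lf a u v; rewrite scaler_sumr -big_split /=.
by apply: eq_bigr => i _; rewrite lf.
Qed.

Lemma lin_tmkl U V W (f : U -> V) (w : W) : lin f -> lin (fun u => f u \ox w).
Proof. by move=> lf a u v; rewrite lf (tmk_linearl w). Qed.

Lemma lin_tmkr U V W (v : V) (f : U -> W) : lin f -> lin (fun u => v \ox f u).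
Proof. by move=> lf a u u'; rewrite lf (tmk_linearr v). Qed.

Lemma lin_tsuml U V W X (f : U -> V *t W) (B : V -> W -> X) :
  lin f -> lin (fun u => tsum (f u) B).
Proof. by move=> lf a u v; rewrite lf tsum_linear. Qed.

Lemma lin_tsumr U V W X (t : V *t W) (B : U -> V -> W -> X) :
  (forall v w, lin (fun u => B u v w)) -> lin (fun u => tsum t (B u)).
Proof.
move=> lB; apply: lin_sum => i; apply: lin_sum => j; apply: lin_scaler.
exact: lB.
Qed.

Lemma lin_linfunE U V (f : U -> V) u : lin f -> linfun f u = f u.
Proof.
move=> lf.
pose m := GRing.isLinear.Build k U V *:%R f lf.
pose L : {linear U -> V} := HB.pack f m.
exact: (lfunE L).
Qed.

Lemma lin0 U V (f : U -> V) : lin f -> f 0 = 0.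
Proof. by move=> lf; have := lf (-1) 0 0; rewrite scaler0 addr0 scaleN1r addNr. Qed.

Lemma linZ U V (f : U -> V) a u : lin f -> f (a *: u) = a *: f u.
Proof. by move=> lf; have := lf a u 0; rewrite (lin0 lf) !addr0. Qed.

Lemma linD U V (f : U -> V) u v : lin f -> f (u + v) = f u + f v.
Proof. by move=> lf; have := lf 1 u v; rewrite !scale1r. Qed.

Lemma lin_bigsum U V (f : U -> V) (I : finType) (F : I -> U) :
  lin f -> f (\sum_i F i) = \sum_i f (F i).
Proof.
by move=> lf; apply: (big_morph f) => [u v|]; rewrite ?linD ?lin0.
Qed.

Lemma lin_tsum U V W X (f : U -> X) (t : V *t W) (B : V -> W -> U) :
  lin f -> f (tsum t B) = tsum t (fun v w => f (B v w)).
Proof.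
move=> lf; rewrite lin_bigsum //; apply: eq_bigr => i _.
by rewrite lin_bigsum //; apply: eq_bigr => j _; rewrite linZ.
Qed.

End Linear.

(** Linearity in a variable is closed under every construction used below, so
    the multilinearity side conditions are discharged by search directed by the
    head symbol; [lin_base] is the extension point for the operations and the
    multilinear hypotheses that come later. *)
Ltac lin_base := fail.
Ltac lin_eta :=
  lazymatch goal with
  | |- lin (fun _ => _) => idtac
  | |- @lin ?k ?U ?V ?f => change (@lin k U V (fun u => f u))
  | |- _ => idtac
  end.
Ltac lin_step :=
  lin_eta; lazy beta;
  lazymatch goal with
  | |- lin (fun u => u) => exact (@lin_id _ _)
  | |- lin (fun u => _ \ox _) => first [apply: lin_tmkl | apply: lin_tmkr]
  | |- lin (fun u => tsum _ _) =>
      first [apply: lin_tsuml | (apply: lin_tsumr => ? ?)]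
  | |- lin (fun u => _ *: _) => first [apply: lin_scaler | apply: lin_scalel]
  | |- lin (fun u => _ * _) => first [apply: lin_mull | apply: lin_mulr]
  | |- _ =>
    first
    [ assumption | lin_base
    | apply: lin_mull | apply: lin_mulr
    | apply: lin_hom | apply: lin_app
    | (apply: lin_sum => ?) ]
  end.
Ltac lin := intros; repeat lin_step.

Section Canonical.
Variable k : fieldType.
Implicit Types U V W X Y : vectType k.

Lemma tsumE V W U (v : V) (w : W) (B : V -> W -> U) :
  (forall w, lin (B^~ w)) -> (forall v, lin (B v)) -> tsum (v \ox w) B = B v w.
Proof. exact: tsum_tmk. Qed.

Lemma eq_tsum V W U (t : V *t W) (B B' : V -> W -> U) :
  (forall v w, B v w = B' v w) -> tsum t B = tsum t B'.
Proof. by move=> e; apply: eq_bigr => i _; apply: eq_bigr => j _; rewrite e. Qed.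

Lemma tens_ext V W U (F G : V *t W -> U) :
  lin F -> lin G -> (forall v w, F (v \ox w) = G (v \ox w)) -> F =1 G.
Proof.
move=> lF lG e t; rewrite -(tsum_id t) !lin_tsum //; exact: eq_tsum.
Qed.

Lemma tsum_mulr V W (c : k^o) (t : V *t W) (B : V -> W -> k^o) :
  c * tsum t B = \tsum_(v, w <- t) (c * B v w : k^o).
Proof. exact: (lin_tsum _ _ (lin_mulr c (@lin_id _ k^o))). Qed.

Lemma tsum_mull V W (c : k^o) (t : V *t W) (B : V -> W -> k^o) :
  tsum t B * c = \tsum_(v, w <- t) (B v w * c : k^o).
Proof. exact: (lin_tsum _ _ (lin_mull c (@lin_id _ k^o))). Qed.

Lemma tsum_scalel V W U (u : U) (t : V *t W) (B : V -> W -> k^o) :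
  (tsum t B : k) *: u = \tsum_(v, w <- t) (B v w : k) *: u.
Proof. exact: (lin_tsum _ _ (lin_scalel u (@lin_id _ k^o))). Qed.

Lemma tsum_scaler V W U (c : k) (t : V *t W) (B : V -> W -> U) :
  c *: tsum t B = \tsum_(v, w <- t) c *: B v w.
Proof. exact: (lin_tsum _ _ (lin_scaler c (@lin_id _ U))). Qed.

Lemma tsum_hom V W U X (f : 'Hom(U, X)) (t : V *t W) (B : V -> W -> U) :
  f (tsum t B) = \tsum_(v, w <- t) f (B v w).
Proof. exact: (lin_tsum _ _ (lin_hom f (@lin_id _ U))). Qed.

Lemma tsum_tsum V W X Y U (t : V *t W) (G : V -> W -> X *t Y)
    (B : X -> Y -> U) :
  tsum (tsum t G) B = \tsum_(v, w <- t) tsum (G v w) B.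
Proof. exact: (lin_tsum _ _ (lin_tsuml B (@lin_id _ (X *t Y)))). Qed.

Lemma eq_scale V (a b : k^o) (v : V) : a = b -> (a : k) *: v = (b : k) *: v.
Proof. by move->. Qed.

(** The canonical element [sum_i e_i (x) d_i] of [V (x) V^*], fed to a
    bilinear [F]. *)
Definition cs V U (F : V -> 'Hom(V, k^o) -> U) : U :=
  \sum_(i < \dim {:V}) F (vbasis {:V})`_i (dualv i).

Lemma eq_cs V U (F G : V -> 'Hom(V, k^o) -> U) :
  (forall e d, F e d = G e d) -> cs F = cs G.
Proof. by move=> e; apply: eq_bigr => i _. Qed.

Lemma dualvE V (i : 'I_(\dim {:V})) (v : V) : dualv i v = coord (vbasis {:V}) i v.
Proof. by rewrite lfunE. Qed.

Lemma cs_vec V U (F : V -> U) v : lin F -> cs (fun e d => (d v : k) *: F e) = F v.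
Proof.
move=> lF; rewrite [in RHS](coord_vbasis (memvf v)) lin_bigsum //.
by apply: eq_bigr => i _; rewrite linZ // dualvE.
Qed.

Lemma fun_dualv V (a : 'Hom(V, k^o)) : cs (fun e d => (a e : k) *: d) = a.
Proof.
apply/lfunP => v; rewrite sum_lfunE -[in RHS](cs_vec v (@lin_id _ V)).
rewrite linear_sum; apply: eq_bigr => i _.
by rewrite scale_lfunE linearZ /= /GRing.scale /= mulrC.
Qed.

Lemma cs_fun V U (F : 'Hom(V, k^o) -> U) (a : 'Hom(V, k^o)) :
  lin F -> cs (fun e d => (a e : k) *: F d) = F a.
Proof.
move=> lF; rewrite -[in RHS](fun_dualv a) lin_bigsum //.
by apply: eq_bigr => i _; rewrite linZ.
Qed.

Lemma lin_cs V U X (F : X -> V -> 'Hom(V, k^o) -> U) :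
  (forall e d, lin (fun x => F x e d)) -> lin (fun x => cs (F x)).
Proof. by move=> lF; apply: lin_sum => i; apply: lF. Qed.

Lemma cs_lin V U X (f : U -> X) (F : V -> 'Hom(V, k^o) -> U) :
  lin f -> f (cs F) = cs (fun e d => f (F e d)).
Proof. exact: lin_bigsum. Qed.

Lemma cs_scaler V U (c : k) (F : V -> 'Hom(V, k^o) -> U) :
  c *: cs F = cs (fun e d => c *: F e d).
Proof. exact: (cs_lin _ (lin_scaler c (@lin_id _ U))). Qed.

Lemma cs_hom V U X (f : 'Hom(U, X)) (F : V -> 'Hom(V, k^o) -> U) :
  f (cs F) = cs (fun e d => f (F e d)).
Proof. exact: (cs_lin _ (lin_hom f (@lin_id _ U))). Qed.

Lemma csC V W U (F : V -> 'Hom(V, k^o) -> W -> 'Hom(W, k^o) -> U) :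
  cs (fun e d => cs (F e d)) = cs (fun e' d' => cs (fun e d => F e d e' d')).
Proof. exact: exchange_big. Qed.

Lemma cs_tsumC V W X U (t : W *t X) (F : V -> 'Hom(V, k^o) -> W -> X -> U) :
  cs (fun e d => tsum t (F e d)) = tsum t (fun w x => cs (fun e d => F e d w x)).
Proof.
rewrite /cs /tsum exchange_big; apply: eq_bigr => i _.
rewrite exchange_big; apply: eq_bigr => j _.
by rewrite scaler_sumr.
Qed.

(** Naturality of the canonical element; this moves the antipode between elements
    and functionals. *)
Lemma cs_tr V W U (L : 'Hom(V, W)) (F : W -> 'Hom(V, k^o) -> U) :
  (forall d, lin (F^~ d)) -> (forall w, lin (F w)) ->
  cs (fun e d => F (L e) d) = cs (fun e d => F e (d \o L)%VF).
Proof.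
move=> l1 l2.
transitivity (cs (fun e d => cs (fun e' d' => (d' (L e) : k) *: F e' d))).
  by apply: eq_cs => e d; rewrite cs_vec.
rewrite csC; apply: eq_cs => e d; rewrite -[RHS]cs_fun //.
by apply: eq_cs => e' d'; rewrite comp_lfunE.
Qed.

Lemma tsumC V W X Y U (t : V *t W) (t' : X *t Y) (F : V -> W -> X -> Y -> U) :
  tsum t (fun v w => tsum t' (F v w)) =
  tsum t' (fun x y => tsum t (fun v w => F v w x y)).
Proof.
rewrite /tsum; under eq_bigr => i _.
  under eq_bigr => j _.
    rewrite scaler_sumr; under eq_bigr => i' _ do rewrite scaler_sumr.
    over.
  rewrite exchange_big /=; under eq_bigr => i' _ do rewrite exchange_big.
  over.
rewrite exchange_big; apply: eq_bigr => i' _; rewrite /= exchange_big.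
apply: eq_bigr => j' _; rewrite scaler_sumr; apply: eq_bigr => i _.
rewrite scaler_sumr; apply: eq_bigr => j _.
by rewrite !scalerA mulrC.
Qed.

(** A tensor is the sum of [t_i (x) e_i], where the slice [t_i] is its contraction
    with the [i]-th dual basis vector; this is how coactions are turned into
    actions of the dual. *)
Lemma tsum_slice V W U (t : V *t W) (B : V -> W -> U) :
  (forall w, lin (B^~ w)) -> (forall v, lin (B v)) ->
  tsum t B = cs (fun e d => B (\tsum_(v, w <- t) (d w : k) *: v) e).
Proof.
move=> l1 l2; transitivity (tsum t (fun v w => cs (fun e d => (d w : k) *: B v e))).
  by apply: eq_tsum => v w; rewrite cs_vec.
rewrite -cs_tsumC; apply: eq_cs => e d; rewrite (lin_tsum _ _ (l1 e)).
by apply: eq_tsum => v w; rewrite (linZ _ _ (l1 e)).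
Qed.

Lemma tsum_slicel V W U (t : V *t W) (B : V -> W -> U) :
  (forall w, lin (B^~ w)) -> (forall v, lin (B v)) ->
  tsum t B = cs (fun e d => B e (\tsum_(v, w <- t) (d v : k) *: w)).
Proof.
move=> l1 l2; transitivity (tsum t (fun v w => cs (fun e d => (d v : k) *: B e w))).
  by apply: eq_tsum => v w; rewrite (cs_vec _ (l1 w)).
rewrite -cs_tsumC; apply: eq_cs => e d; rewrite (lin_tsum _ _ (l2 e)).
by apply: eq_tsum => v w; rewrite (linZ _ _ (l2 e)).
Qed.

End Canonical.

#[export] Instance cs_Proper (k : fieldType) (V U : vectType k) :
  Proper (pointwise_relation _ (pointwise_relation _ eq) ==> eq) (@cs k V U).
Proof. by move=> F G e; apply: eq_cs. Qed.

#[export] Instance tsum_Proper (k : fieldType) (V W U : vectType k)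
    (t : V *t W) :
  Proper (pointwise_relation _ (pointwise_relation _ eq) ==> eq)
    (@tsum k V W U t).
Proof. by move=> F G e; apply: eq_tsum. Qed.

Ltac lin_canonical :=
  lazymatch goal with |- lin (fun u => cs _) => apply: lin_cs => ? ? end.
Ltac lin_base ::= lin_canonical.

(** * The convolution algebra of a coalgebra *)

Notation "a \cv b" := (convol a b) (at level 40, left associativity).

Section Convolution.
Variables (k : fieldType) (C : coalgData k).
Implicit Types U : vectType k.
Implicit Types a b c : 'Hom(C, k^o).
Local Notation Delta := (comul C).

Lemma convolE a b x : (a \cv b) x = \tsum_(y, z <- Delta x) (a y * b z : k^o).
Proof. by rewrite /convol lin_linfunE //; lin. Qed.

Lemma lin_convoll U (f : U -> 'Hom(C, k^o)) b :
  lin f -> lin (fun u => f u \cv b).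
Proof.
move=> lf; apply: lin_ext => x a u v; rewrite !convolE.
by move: a u v; change (lin (fun u => \tsum_(y, z <- Delta x) (f u y * b z : k^o))); lin.
Qed.

Lemma lin_convolr U (f : U -> 'Hom(C, k^o)) b :
  lin f -> lin (fun u => b \cv f u).
Proof.
move=> lf; apply: lin_ext => x a u v; rewrite !convolE.
by move: a u v; change (lin (fun u => \tsum_(y, z <- Delta x) (b y * f u z : k^o))); lin.
Qed.

Lemma lin_comp_lfunl (V W : vectType k) U (f : U -> 'Hom(W, k^o)) (g : 'Hom(V, W)) :
  lin f -> lin (fun u => (f u \o g)%VF).
Proof.
by move=> lf; apply: lin_ext => x a u v; rewrite lf !(comp_lfunE, add_lfunE, scale_lfunE).
Qed.

(** The coproduct in dual bases: the values of [Delta x] on pairs of functionals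
    are those of convolution products at [x]. *)
Lemma tsum_comul U (B : C -> C -> U) x :
  (forall y, lin (B^~ y)) -> (forall y, lin (B y)) ->
  tsum (Delta x) B =
  cs (fun e d => cs (fun e' d' => ((d \cv d') x : k) *: B e e')).
Proof.
move=> l1 l2; rewrite tsum_slice // csC; apply: eq_cs => e' d'.
rewrite -[LHS](cs_vec _ (l1 e')); apply: eq_cs => e d; apply: eq_scale.
rewrite convolE tsum_hom.
by apply: eq_tsum => v w; rewrite linearZ /= mulrC.
Qed.

Lemma cs_comul U (F : C -> C -> 'Hom(C, k^o) -> U) :
  (forall y a, lin (fun x => F x y a)) -> (forall x a, lin (fun y => F x y a)) ->
  (forall x y, lin (F x y)) ->
  cs (fun x a => \tsum_(x1, x2 <- Delta x) F x1 x2 a) =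
  cs (fun x a => cs (fun y b => F x y (a \cv b))).
Proof.
move=> l1 l2 l3.
under eq_cs => x a do rewrite tsum_comul //.
rewrite csC; apply: eq_cs => y b; rewrite csC; apply: eq_cs => z c.
by rewrite -[RHS]cs_fun.
Qed.

Hypothesis CP : is_coalgebra C.

Lemma comulA U (F : C -> C -> C -> U) x :
  (forall y z, lin (fun x => F x y z)) -> (forall x z, lin (fun y => F x y z)) ->
  (forall x y, lin (F x y)) ->
  \tsum_(y, z <- Delta x) \tsum_(y1, y2 <- Delta y) F y1 y2 z =
  \tsum_(y, z <- Delta x) \tsum_(z1, z2 <- Delta z) F y z1 z2.
Proof.
move=> l1 l2 l3; case: CP => + _ _ => /(_ x).
pose G (t : C *t (C *t C)) := \tsum_(y, s <- t) \tsum_(z, w <- s) F y z w.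
have lG : lin G by rewrite /G; lin.
have GE y z w : G (y \ox (z \ox w)) = F y z w.
  by rewrite /G !tsumE //; lin.
move=> /(congr1 G); rewrite !(lin_tsum _ _ lG).
under eq_tsum => y z do rewrite (lin_tsum _ _ lG).
under [RHS]eq_tsum => y z do rewrite (lin_tsum _ _ lG).
by setoid_rewrite GE.
Qed.

Lemma counitl U (F : C -> U) x :
  lin F -> \tsum_(y, z <- Delta x) (counit C y : k) *: F z = F x.
Proof.
case: CP => _ + _ => /(_ x) e lF; rewrite -[in RHS]e lin_tsum //.
by apply: eq_tsum => y z; rewrite linZ.
Qed.

Lemma counitr U (F : C -> U) x :
  lin F -> \tsum_(y, z <- Delta x) (counit C z : k) *: F y = F x.
Proof.
case: CP => _ _ /(_ x) e lF; rewrite -[in RHS]e lin_tsum //.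
by apply: eq_tsum => y z; rewrite linZ.
Qed.

Lemma convolA a b c : a \cv (b \cv c) = a \cv b \cv c.
Proof.
apply/lfunP=> x; rewrite !convolE.
transitivity (\tsum_(y, z <- Delta x) \tsum_(z1, z2 <- Delta z)
  (a y * b z1 * c z2 : k^o)).
  apply: eq_tsum => y z; rewrite convolE tsum_mulr.
  by apply: eq_tsum => z1 z2; rewrite mulrA.
rewrite -comulA; try by lin.
apply: eq_tsum => y z; rewrite convolE.
by rewrite tsum_mull.
Qed.

Lemma convol1 a : counit C \cv a = a.
Proof.
apply/lfunP=> x; rewrite convolE -[RHS]counitl //; exact: lin_hom.
Qed.

Lemma convolr1 a : a \cv counit C = a.
Proof.
apply/lfunP=> x; rewrite convolE -[RHS]counitr; last exact: lin_hom.
by apply: eq_tsum => y z; rewrite mulrC.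
Qed.

End Convolution.

Ltac lin_convol :=
  lazymatch goal with
  | |- lin (fun u => cs _) => apply: lin_cs => ? ?
  | |- lin (fun u => _ \cv _) => first [apply: lin_convoll | apply: lin_convolr]
  | |- lin (fun u => (_ \o _)%VF) => apply: lin_comp_lfunl
  end.
Ltac lin_base ::= lin_convol.

Section Multilinear.
Variable k : fieldType.
Implicit Types U V W X Y Z : vectType k.

Definition lin2 V W U (B : V -> W -> U) : Prop :=
  (forall y, lin (fun x => B x y)) /\ (forall x, lin (B x)).

Definition lin3 V W X U (B : V -> W -> X -> U) : Prop :=
  [/\ forall y z, lin (fun x => B x y z), forall x z, lin (fun y => B x y z)
    & forall x y, lin (B x y)].

Definition lin4 V W X Y U (B : V -> W -> X -> Y -> U) : Prop :=
  [/\ forall y z w, lin (fun x => B x y z w),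
      forall x z w, lin (fun y => B x y z w),
      forall x y w, lin (fun z => B x y z w)
    & forall x y z, lin (B x y z)].

Section Compose.
Variables (V W X Y U Z : vectType k).
Lemma lin2_1 (B : V -> W -> U) y (f : Z -> V) :
  lin2 B -> lin f -> lin (fun u => B (f u) y).
Proof. by case=> l _ lf; apply: (lin_comp (l y)). Qed.
Lemma lin2_2 (B : V -> W -> U) x (f : Z -> W) :
  lin2 B -> lin f -> lin (fun u => B x (f u)).
Proof. by case=> _ l lf; apply: (lin_comp (l x)). Qed.
Lemma lin3_1 (B : V -> W -> X -> U) y z (f : Z -> V) :
  lin3 B -> lin f -> lin (fun u => B (f u) y z).
Proof. by case=> l _ _ lf; apply: (lin_comp (l y z)). Qed.
Lemma lin3_2 (B : V -> W -> X -> U) x z (f : Z -> W) :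
  lin3 B -> lin f -> lin (fun u => B x (f u) z).
Proof. by case=> _ l _ lf; apply: (lin_comp (l x z)). Qed.
Lemma lin3_3 (B : V -> W -> X -> U) x y (f : Z -> X) :
  lin3 B -> lin f -> lin (fun u => B x y (f u)).
Proof. by case=> _ _ l lf; apply: (lin_comp (l x y)). Qed.
Lemma lin4_1 (B : V -> W -> X -> Y -> U) y z w (f : Z -> V) :
  lin4 B -> lin f -> lin (fun u => B (f u) y z w).
Proof. by case=> l _ _ _ lf; apply: (lin_comp (l y z w)). Qed.
Lemma lin4_2 (B : V -> W -> X -> Y -> U) x z w (f : Z -> W) :
  lin4 B -> lin f -> lin (fun u => B x (f u) z w).
Proof. by case=> _ l _ _ lf; apply: (lin_comp (l x z w)). Qed.
Lemma lin4_3 (B : V -> W -> X -> Y -> U) x y w (f : Z -> X) :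
  lin4 B -> lin f -> lin (fun u => B x y (f u) w).
Proof. by case=> _ _ l _ lf; apply: (lin_comp (l x y w)). Qed.
Lemma lin4_4 (B : V -> W -> X -> Y -> U) x y z (f : Z -> Y) :
  lin4 B -> lin f -> lin (fun u => B x y z (f u)).
Proof. by case=> _ _ _ l lf; apply: (lin_comp (l x y z)). Qed.
End Compose.

End Multilinear.

Ltac lin_hyp :=
  match goal with
  | L : lin4 ?B |- lin (fun u => ?B _ _ _ _) =>
      first [apply: (lin4_1 _ _ _ L) | apply: (lin4_2 _ _ _ L)
            | apply: (lin4_3 _ _ _ L) | apply: (lin4_4 _ _ _ L)]
  | L : lin4 ?B |- lin (?B _ _ _) => apply: (lin4_4 _ _ _ L)
  | L : lin3 ?B |- lin (fun u => ?B _ _ _) =>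
      first [apply: (lin3_1 _ _ L) | apply: (lin3_2 _ _ L)
            | apply: (lin3_3 _ _ L)]
  | L : lin3 ?B |- lin (?B _ _) => apply: (lin3_3 _ _ L)
  | L : lin2 ?B |- lin (fun u => ?B _ _) =>
      first [apply: (lin2_1 _ L) | apply: (lin2_2 _ L)]
  | L : lin2 ?B |- lin (?B _) => apply: (lin2_2 _ L)
  | L : lin ?B |- lin (fun u => ?B _) => apply: (lin_comp L)
  end.

Ltac lin_base ::= first [lin_convol | lin_hyp].

Ltac mlin := intros; repeat split; lin.

(** * The dual of a coquasi Hopf algebra *)

Section Contraction.
Variables (k : fieldType) (H : coquasiHopf k).
Local Notation A := ('Hom(H, k^o)).
Implicit Types U V W : vectType k.

(** [cop a] is the coproduct of [a] dual to the multiplication of [H], and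
    [ctr T] is [T] viewed in the third tensor power of the dual.  Both are
    encoded by the values that multilinear maps take on them, which keeps
    iterated tensor products out of the statements. *)
Definition cop U (a : A) (B : A -> A -> U) : U :=
  cs (fun (e : H) d => cs (fun (e' : H) d' => (a (Defs.mulC H (e \ox e')) : k) *: B d d')).

Definition ctr U (T : 'Hom(H *t H *t H, k^o)) (B : A -> A -> A -> U) : U :=
  cs (fun (x : H) a => cs (fun (y : H) b => cs (fun (z : H) c =>
    (T (x \ox y \ox z) : k) *: B a b c))).

Lemma eq_cop U a (B B' : A -> A -> U) :
  (forall x y, B x y = B' x y) -> cop a B = cop a B'.
Proof. by move=> e; apply: eq_cs => ? ?; apply: eq_cs => ? ?; rewrite e. Qed.

Lemma eq_ctr U T (B B' : A -> A -> A -> U) :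
  (forall x y z, B x y z = B' x y z) -> ctr T B = ctr T B'.
Proof.
by move=> e; apply: eq_cs => ? ?; apply: eq_cs => ? ?; apply: eq_cs => ? ?; rewrite e.
Qed.

Lemma lin_cop V U (a : A) (B : V -> A -> A -> U) :
  (forall x y, lin (fun v => B v x y)) -> lin (fun v => cop a (B v)).
Proof. by move=> l; lin; apply: l. Qed.

Lemma lin_copa V U (f : V -> A) (B : A -> A -> U) :
  lin f -> lin (fun v => cop (f v) B).
Proof. by move=> l; lin. Qed.

Lemma lin_ctr V U T (B : V -> A -> A -> A -> U) :
  (forall x y z, lin (fun v => B v x y z)) -> lin (fun v => ctr T (B v)).
Proof. by move=> l; lin; apply: l. Qed.

Lemma cop_lin U V (f : U -> V) a (B : A -> A -> U) :
  lin f -> f (cop a B) = cop a (fun x y => f (B x y)).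
Proof.
move=> lf; rewrite !cs_lin //; apply: eq_cs => e d; rewrite cs_lin //.
by apply: eq_cs => ? ?; rewrite linZ.
Qed.

Lemma ctr_lin U V (f : U -> V) T (B : A -> A -> A -> U) :
  lin f -> f (ctr T B) = ctr T (fun x y z => f (B x y z)).
Proof.
move=> lf; rewrite !cs_lin //; apply: eq_cs => e d; rewrite cs_lin //.
apply: eq_cs => ? ?; rewrite cs_lin //.
by apply: eq_cs => ? ?; rewrite linZ.
Qed.

End Contraction.

#[export] Instance cop_Proper (k : fieldType) (H : coquasiHopf k)
    (U : vectType k) a :
  Proper (pointwise_relation _ (pointwise_relation _ eq) ==> eq) (@cop k H U a).
Proof. by move=> F G e; apply: eq_cop. Qed.

#[export] Instance ctr_Proper (k : fieldType) (H : coquasiHopf k)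
    (U : vectType k) T :
  Proper (pointwise_relation _ (pointwise_relation _
    (pointwise_relation _ eq)) ==> eq) (@ctr k H U T).
Proof. by move=> F G e; apply: eq_ctr => x y z; apply: e. Qed.

Ltac lin_contract :=
  lazymatch goal with
  | |- lin (fun u => ctr _ _) => apply: lin_ctr => ? ? ?
  | |- lin (fun u => cop _ _) => first [(apply: lin_cop => ? ?) | apply: lin_copa]
  end.
Ltac lin_base ::= first [lin_convol | lin_contract | lin_hyp].

Section DualAxioms.
Variables (k : fieldType) (H : coquasiHopf k).
Local Notation A := ('Hom(H, k^o)).
Local Notation "x ** y" := (Defs.mulC H (x \ox y)) (at level 40, left associativity).
Local Notation one := (unitC H 1).
Local Notation phi := (reass H).
Local Notation phiV := (reassV H).
Local Notation alpha := (antip_alpha H).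
Local Notation beta := (antip_beta H).
Local Notation eps := (counit H).
Local Notation Delta := (comul H).
Local Notation s a := (a \o antip H)%VF.
Implicit Types U V W : vectType k.

Let HP : is_coalgebra H := cqb_coalgP H.

Lemma comul_mul U (F : H -> H -> U) (x y : H) : lin2 F ->
  tsum (Delta (x ** y)) F =
  \tsum_(x1, x2 <- Delta x) \tsum_(y1, y2 <- Delta y) F (x1 ** y1) (x2 ** y2).
Proof.
move=> L; have [-> _] := mulC_morph H.
rewrite tliftE tsumE; try by lin.
rewrite !tsum_tsum; apply: eq_tsum => x1 x2; rewrite !tsum_tsum.
by apply: eq_tsum => y1 y2; rewrite !tsumE //; lin.
Qed.

Lemma counit_mul (x y : H) : eps (x ** y) = eps x * eps y.
Proof. by have [_ ->] := mulC_morph H; rewrite tliftE tsumE //; lin. Qed.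

Lemma comul_one : Delta one = one \ox one.
Proof.
have [-> _] := unitC_morph H.
rewrite lin_linfunE; last by lin.
by rewrite scale1r tsumE //; lin.
Qed.

Lemma counit_one : eps one = 1.
Proof. by have [_ ->] := unitC_morph H; rewrite id_lfunE. Qed.

Lemma comul_antip U (F : H -> H -> U) (x : H) : lin2 F ->
  tsum (Delta (antip H x)) F =
  \tsum_(x1, x2 <- Delta x) F (antip H x2) (antip H x1).
Proof.
move=> L; have [-> _] := antip_morph H.
rewrite lin_linfunE; last by lin.
by rewrite !tsum_tsum; apply: eq_tsum => x1 x2; rewrite !tsumE //; lin.
Qed.

Lemma counit_antip (x : H) : eps (antip H x) = eps x.
Proof. by have [_ ->] := antip_morph H. Qed.

Lemma sM (a b : A) : s (a \cv b) = s b \cv s a.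
Proof.
apply/lfunP=> x; rewrite comp_lfunE !convolE comul_antip; last by mlin.
by apply: eq_tsum => y z; rewrite !comp_lfunE mulrC.
Qed.

Lemma s1 : s eps = eps.
Proof. by apply/lfunP=> x; rewrite comp_lfunE counit_antip. Qed.

Lemma convol_one (a b : A) : (a \cv b) one = a one * b one.
Proof. by rewrite convolE comul_one tsumE //; lin. Qed.

(** Multiplicativity of the coproduct of the dual expresses that the
    multiplication of [H] is a morphism of coalgebras. *)
Lemma copM U (a b : A) (B : A -> A -> U) : lin2 B ->
  cop (a \cv b) B = cop a (fun x y => cop b (fun x' y' => B (x \cv x') (y \cv y'))).
Proof.
move=> L.
transitivity (cs (fun (e : H) d => cs (fun (e' : H) d' =>
   \tsum_(x1, x2 <- Delta e) \tsum_(y1, y2 <- Delta e')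
      (a (x1 ** y1) * b (x2 ** y2) : k) *: B d d'))).
  apply: eq_cs => e d; apply: eq_cs => e' d'.
  rewrite convolE comul_mul; last by mlin.
  by rewrite tsum_scalel; apply: eq_tsum => *; rewrite tsum_scalel.
setoid_rewrite cs_tsumC.
under eq_cs => e d do under eq_tsum => x1 x2 do (rewrite cs_comul; try by lin).
rewrite cs_comul; try by lin.
rewrite /cop; apply: eq_cs => x x'.
under [RHS]eq_cs => e d do rewrite cs_scaler.
rewrite [RHS]csC; apply: eq_cs => y y'; apply: eq_cs => z z'.
rewrite cs_scaler; apply: eq_cs => w w'.
by rewrite scalerA.
Qed.

Lemma cop1 U (B : A -> A -> U) : lin2 B -> cop eps B = B eps eps.
Proof.
move=> L; rewrite /cop.
transitivity (cs (fun (e : H) d => (eps e : k) *: B d eps)); last first.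
  by rewrite (cs_fun (F := fun d => B d eps)) //; lin.
apply: eq_cs => e d; rewrite -[in RHS](cs_fun eps (F := B d)); last by lin.
by rewrite cs_scaler; apply: eq_cs => e' d'; rewrite scalerA counit_mul.
Qed.

Lemma cop_counitl U (a : A) (F : A -> U) :
  lin F -> cop a (fun x y => (x one : k) *: F y) = F a.
Proof.
move=> lF; rewrite /cop csC -[RHS]cs_fun //; apply: eq_cs => e d.
transitivity (cs (fun (e' : H) d' => (d' one : k) *: ((a (e' ** e) : k) *: F d))).
  by apply: eq_cs => e' d'; rewrite !scalerA mulrC.
rewrite (cs_vec _ (F := fun e' => (a (e' ** e) : k) *: F d)); last by lin.
by have [-> _] := @mulC_unital _ H e.
Qed.

Lemma cop_counitr U (a : A) (F : A -> U) :
  lin F -> cop a (fun x y => (y one : k) *: F x) = F a.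
Proof.
move=> lF; rewrite /cop -[RHS]cs_fun //; apply: eq_cs => e d.
transitivity (cs (fun (e' : H) d' => (d' one : k) *: ((a (e ** e') : k) *: F d))).
  by apply: eq_cs => e' d'; rewrite !scalerA mulrC.
rewrite (cs_vec _ (F := fun e' => (a (e ** e') : k) *: F d)); last by lin.
by have [_ ->] := @mulC_unital _ H e.
Qed.

Lemma conv3E (a b c : A) (h : H) : (a \cv b \cv c) h =
  \tsum_(h1, t <- Delta h) \tsum_(h2, h3 <- Delta t) (a h1 * b h2 * c h3 : k^o).
Proof.
rewrite -convolA // convolE; apply: eq_tsum => h1 t.
by rewrite convolE tsum_mulr; apply: eq_tsum => h2 h3; rewrite mulrA.
Qed.

Lemma conv5E (a b c d e : A) (h : H) : (a \cv b \cv c \cv d \cv e) h =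
  \tsum_(h1, t <- Delta h) \tsum_(h2, t' <- Delta t)
  \tsum_(h3, t'' <- Delta t') \tsum_(h4, h5 <- Delta t'')
    (a h1 * b h2 * c h3 * d h4 * e h5 : k^o).
Proof.
rewrite -!convolA // convolE; apply: eq_tsum => h1 t.
rewrite convolE tsum_mulr; apply: eq_tsum => h2 t'.
rewrite convolA // conv3E tsum_mulr tsum_mulr; apply: eq_tsum => h3 t''.
rewrite !tsum_mulr; apply: eq_tsum => h4 h5.
by rewrite !mulrA.
Qed.

Lemma cs_vec2 U (F : H -> H -> U) v w : lin2 F ->
  cs (fun e d => cs (fun e' d' => (d v * d' w : k) *: F e e')) = F v w.
Proof.
move=> L; rewrite -(cs_vec v (F := F^~ w)); last by lin.
apply: eq_cs => e d; rewrite -(cs_vec w (F := F e)); last by lin.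
by rewrite cs_scaler; apply: eq_cs => e' d'; rewrite scalerA.
Qed.

Lemma cs_vec3 U (F : H -> H -> H -> U) v w x : lin3 F ->
  cs (fun e d => cs (fun e' d' => cs (fun e'' d'' =>
    (d v * d' w * d'' x : k) *: F e e' e''))) = F v w x.
Proof.
move=> L; rewrite -(cs_vec2 v w (F := fun e e' => F e e' x)); last by mlin.
apply: eq_cs => e d; apply: eq_cs => e' d'.
rewrite -(cs_vec x (F := F e e')); last by lin.
by rewrite cs_scaler; apply: eq_cs => e'' d''; rewrite scalerA.
Qed.

(** The antipode axioms in the dual, here and in the next three lemmas: after
    evaluation at [h], [cs_tr] moves the antipode from the functionals back to
    the elements of [H]. *)
Lemma cop_alpha_fun (a : A) :
  cop a (fun x y => s x \cv alpha \cv y) = (a one : k) *: alpha.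
Proof.
apply/lfunP=> h; rewrite (cop_lin (f := fun u : A => u h)); last by lin.
rewrite /cop.
rewrite -(cs_tr (antip H) (F := fun e d => cs (fun (e' : H) d' =>
   (a (e ** e') : k) *: (d \cv alpha \cv d') h))); try by lin.
transitivity (\tsum_(h1, t <- Delta h) \tsum_(h2, h3 <- Delta t)
  (alpha h2 * a (antip H h1 ** h3) : k^o)); last first.
  have <- : a (alpha h *: one) = ((a one : k) *: alpha) h.
    by rewrite linearZ scale_lfunE; apply: mulrC.
  rewrite -(antip_alphaP h).
  rewrite tsum_hom; apply: eq_tsum => h1 t; rewrite tsum_hom.
  by apply: eq_tsum => h2 h3; rewrite linearZ.
setoid_rewrite conv3E; setoid_rewrite tsum_scaler; setoid_rewrite tsum_scaler.
repeat setoid_rewrite cs_tsumC.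
apply: eq_tsum => h1 t; apply: eq_tsum => h2 h3.
rewrite -(cs_vec2 h1 h3 (F := fun x y => (alpha h2 * a (antip H x ** y) : k^o))); last by mlin.
apply: eq_cs => e d; apply: eq_cs => e' d'; rewrite /GRing.scale /=; ring.
Qed.

Lemma cop_beta_fun (a : A) :
  cop a (fun x y => x \cv beta \cv s y) = (a one : k) *: beta.
Proof.
apply/lfunP=> h; rewrite (cop_lin (f := fun u : A => u h)); last by lin.
rewrite /cop csC.
rewrite -(cs_tr (antip H) (F := fun e' d' => cs (fun (e : H) d =>
   (a (e ** e') : k) *: (d \cv beta \cv d') h))); try by lin.
transitivity (\tsum_(h1, t <- Delta h) \tsum_(h2, h3 <- Delta t)
  (beta h2 * a (h1 ** antip H h3) : k^o)); last first.
  have <- : a (beta h *: one) = ((a one : k) *: beta) h.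
    by rewrite linearZ scale_lfunE; apply: mulrC.
  rewrite -(antip_betaP h).
  rewrite tsum_hom; apply: eq_tsum => h1 t; rewrite tsum_hom.
  by apply: eq_tsum => h2 h3; rewrite linearZ.
setoid_rewrite conv3E; setoid_rewrite tsum_scaler; setoid_rewrite tsum_scaler.
repeat setoid_rewrite cs_tsumC.
apply: eq_tsum => h1 t; apply: eq_tsum => h2 h3; rewrite csC.
rewrite -(cs_vec2 h1 h3 (F := fun x y => (beta h2 * a (x ** antip H y) : k^o))); last by mlin.
apply: eq_cs => e d; apply: eq_cs => e' d'; rewrite /GRing.scale /=; ring.
Qed.

Lemma ctr_phiV_fun :
  ctr phiV (fun x y z => x \cv beta \cv s y \cv alpha \cv z) = eps.
Proof.
apply/lfunP=> h; rewrite (ctr_lin (f := fun u : A => u h)); last by lin.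
rewrite /ctr.
under eq_cs => x a do (rewrite -(cs_tr (antip H) (F := fun y b => cs (fun (z : H) c =>
   (phiV (x \ox y \ox z) : k) *: (a \cv beta \cv b \cv alpha \cv c) h))); try by lin).
setoid_rewrite conv5E; do 4 setoid_rewrite tsum_scaler.
repeat setoid_rewrite cs_tsumC.
rewrite -(antip_phiVP h).
apply: eq_tsum => h1 t; apply: eq_tsum => h2 t'.
apply: eq_tsum => h3 t''; apply: eq_tsum => h4 h5.
rewrite -(cs_vec3 h1 h3 h5 (F := fun x y z => 
   (phiV (x \ox antip H y \ox z) * beta h2 * alpha h4 : k^o))); last by mlin.
do 3!(apply: eq_cs => ? ?); rewrite /GRing.scale /=; ring.
Qed.

Lemma ctr_phi_fun :
  ctr phi (fun x y z => s x \cv alpha \cv y \cv beta \cv s z) = eps.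
Proof.
apply/lfunP=> h; rewrite (ctr_lin (f := fun u : A => u h)); last by lin.
rewrite /ctr.
rewrite -(cs_tr (antip H) (F := fun x a => cs (fun y b => cs (fun (z : H) c =>
  (phi (x \ox y \ox z) : k) *: (a \cv alpha \cv b \cv beta \cv s c) h))));
  try by lin.
under eq_cs => x a do under eq_cs => y b do (rewrite -(cs_tr (antip H)
  (F := fun (z : H) c => (phi (antip H x \ox y \ox z) : k) *:
     (a \cv alpha \cv b \cv beta \cv c) h)); try by lin).
setoid_rewrite conv5E; do 4 setoid_rewrite tsum_scaler.
repeat setoid_rewrite cs_tsumC.
rewrite -(antip_phiP h).
apply: eq_tsum => h1 t; apply: eq_tsum => h2 t'.
apply: eq_tsum => h3 t''; apply: eq_tsum => h4 h5.
rewrite -(cs_vec3 h1 h3 h5 (F := fun x y z =>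
   (phi (antip H x \ox y \ox antip H z) * alpha h2 * beta h4 : k^o)));
  last by mlin.
do 3!(apply: eq_cs => ? ?); rewrite /GRing.scale /=; ring.
Qed.

End DualAxioms.

Section Kernels.
Variables (k : fieldType) (H : coquasiHopf k).
Local Notation A := ('Hom(H, k^o)).
Local Notation "x ** y" := (Defs.mulC H (x \ox y)) (at level 40, left associativity).
Local Notation phi := (reass H).
Local Notation phiV := (reassV H).
Local Notation eps := (counit H).
Local Notation Delta := (comul H).
Implicit Types U V W : vectType k.

Let HP : is_coalgebra H := cqb_coalgP H.

(** Contractions along multilinear functions that are not given as linear maps on
    a tensor power, such as [a ((x y) z)].  An axiom of [H], being an equality of
    such functions, becomes an equality of contractions, and convolution of
    functions becomes iterated contraction ([ctr3_conv], [ctr4_conv]). *)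
Definition knl3 := H -> H -> H -> k^o.
Definition knl4 := H -> H -> H -> H -> k^o.

Definition ctr3 U (t : knl3) (B : A -> A -> A -> U) : U :=
  cs (fun x a => cs (fun y b => cs (fun z c => (t x y z : k) *: B a b c))).

Definition ctr4 U (t : knl4) (B : A -> A -> A -> A -> U) : U :=
  cs (fun x a => cs (fun y b => cs (fun z c => cs (fun w d =>
    (t x y z w : k) *: B a b c d)))).

Definition conv3 (t t' : knl3) : knl3 := fun x y z =>
  \tsum_(x1, x2 <- Delta x) \tsum_(y1, y2 <- Delta y)
  \tsum_(z1, z2 <- Delta z) (t x1 y1 z1 * t' x2 y2 z2 : k^o).

Definition conv4 (t t' : knl4) : knl4 := fun x y z w =>
  \tsum_(x1, x2 <- Delta x) \tsum_(y1, y2 <- Delta y)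
  \tsum_(z1, z2 <- Delta z) \tsum_(w1, w2 <- Delta w)
    (t x1 y1 z1 w1 * t' x2 y2 z2 w2 : k^o).

Lemma cs_rot U (V W X : vectType k) F :
  cs (fun (x : V) a => cs (fun (y : W) b => cs (fun (z : X) c => F x a y b z c)))
  = cs (fun z c => cs (fun x a => cs (fun y b => F x a y b z c : U))).
Proof. by under eq_cs => x a do rewrite csC; rewrite csC. Qed.

Lemma cs_rot4 U (V W X Y : vectType k) F :
  cs (fun (x : V) a => cs (fun (y : W) b => cs (fun (z : X) c =>
  cs (fun (w : Y) d => F x a y b z c w d))))
  = cs (fun w d => cs (fun x a => cs (fun y b =>
      cs (fun z c => F x a y b z c w d : U)))).
Proof. by under eq_cs => x a do rewrite cs_rot; rewrite csC. Qed.

Lemma eq_ctr3 U t t' (B : A -> A -> A -> U) :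
  (forall x y z, t x y z = t' x y z) -> ctr3 t B = ctr3 t' B.
Proof. by move=> e; do 3!(apply: eq_cs => ? ?); rewrite e. Qed.

Lemma eq_ctr4 U t t' (B : A -> A -> A -> A -> U) :
  (forall x y z w, t x y z w = t' x y z w) -> ctr4 t B = ctr4 t' B.
Proof. by move=> e; do 4!(apply: eq_cs => ? ?); rewrite e. Qed.

Lemma ctr3_conv U t t' (B : A -> A -> A -> U) :
  lin3 t -> lin3 t' -> lin3 B ->
  ctr3 (conv3 t t') B =
  ctr3 t (fun x y z => ctr3 t' (fun x' y' z' =>
    B (x \cv x') (y \cv y') (z \cv z'))).
Proof.
move=> l1 l2 l3; rewrite /ctr3 /conv3.
do 3 setoid_rewrite tsum_scalel.
repeat setoid_rewrite cs_tsumC.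
rewrite cs_comul; try by lin.
do 3 setoid_rewrite cs_scaler.
apply: eq_cs => x a; rewrite [RHS]cs_rot; apply: eq_cs => x' a'.
rewrite cs_comul; try by lin.
apply: eq_cs => y b; rewrite [RHS]csC; apply: eq_cs => y' b'.
rewrite cs_comul; try by lin.
by apply: eq_cs => z c; apply: eq_cs => z' c'; rewrite scalerA.
Qed.

Lemma ctr4_conv U t t' (B : A -> A -> A -> A -> U) :
  lin4 t -> lin4 t' -> lin4 B ->
  ctr4 (conv4 t t') B =
  ctr4 t (fun x y z w => ctr4 t' (fun x' y' z' w' =>
    B (x \cv x') (y \cv y') (z \cv z') (w \cv w'))).
Proof.
move=> l1 l2 l3; rewrite /ctr4 /conv4.
do 4 setoid_rewrite tsum_scalel.
repeat setoid_rewrite cs_tsumC.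
rewrite cs_comul; try by lin.
do 4 setoid_rewrite cs_scaler.
apply: eq_cs => x a; rewrite [RHS]cs_rot4; apply: eq_cs => x' a'.
rewrite cs_comul; try by lin.
apply: eq_cs => y b; rewrite [RHS]cs_rot; apply: eq_cs => y' b'.
rewrite cs_comul; try by lin.
apply: eq_cs => z c; rewrite [RHS]csC; apply: eq_cs => z' c'.
rewrite cs_comul; try by lin.
by apply: eq_cs => w d; apply: eq_cs => w' d'; rewrite scalerA.
Qed.

Lemma comul_tens (C D : coalgData k) U (F : C *t D -> C *t D -> U) (c : C) (d : D) :
  lin2 F ->
  tsum (comul (coalg_tens C D) (c \ox d)) F =
  \tsum_(c1, c2 <- comul C c) \tsum_(d1, d2 <- comul D d)
     F (c1 \ox d1) (c2 \ox d2).
Proof.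
move=> L; rewrite tliftE tsumE; try by lin.
rewrite tsum_tsum; apply: eq_tsum => c1 c2; rewrite tsum_tsum.
by apply: eq_tsum => d1 d2; rewrite tsumE //; lin.
Qed.

Lemma convol_tens3 (T T' : 'Hom(H *t H *t H, k^o)) (x y z : H) :
  convol (C := coalg_tens (coalg_tens H H) H) T T' (x \ox y \ox z)
  = conv3 (fun x y z => T (x \ox y \ox z)) (fun x y z => T' (x \ox y \ox z)) x y z.
Proof.
rewrite convolE (comul_tens _ _ (D := H)); last by mlin.
by rewrite comul_tens //; mlin.
Qed.

Lemma counit_tens3 (x y z : H) :
  counit (coalg_tens (coalg_tens H H) H) (x \ox y \ox z) =
  (eps x * eps y * eps z : k^o).
Proof.
rewrite /= tliftE tsumE /=; try by lin.
by rewrite tliftE tsumE //; lin.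
Qed.

Lemma ctr3_eps U (B : A -> A -> A -> U) : lin3 B ->
  ctr3 (fun x y z => eps x * eps y * eps z : k^o) B = B eps eps eps.
Proof.
move=> L; rewrite -[RHS](cs_fun _ (F := fun a => B a eps eps)); last by lin.
apply: eq_cs => x a.
rewrite -[X in _ = _ *: X](cs_fun _ (F := fun b => B a b eps)); last by lin.
rewrite cs_scaler; apply: eq_cs => y b.
rewrite -[X in _ = _ *: (_ *: X)](cs_fun _ (F := fun c => B a b c)); last by lin.
by rewrite !cs_scaler; apply: eq_cs => z c; rewrite !scalerA.
Qed.

Lemma ctr_phiK U (B : A -> A -> A -> U) : lin3 B ->
  ctr phi (fun x y z => ctr phiV (fun x' y' z' =>
    B (x \cv x') (y \cv y') (z \cv z'))) = B eps eps eps.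
Proof.
move=> L; rewrite -[LHS](ctr3_conv (t := fun x y z => phi (x \ox y \ox z))
  (t' := fun x y z => phiV (x \ox y \ox z))) //; try by mlin.
rewrite -ctr3_eps //; apply: eq_ctr3 => x y z.
by have [e _] := reassP H; rewrite -convol_tens3 e counit_tens3.
Qed.

Lemma ctr_phiVK U (B : A -> A -> A -> U) : lin3 B ->
  ctr phiV (fun x y z => ctr phi (fun x' y' z' =>
    B (x \cv x') (y \cv y') (z \cv z'))) = B eps eps eps.
Proof.
move=> L; rewrite -[LHS](ctr3_conv (t := fun x y z => phiV (x \ox y \ox z))
  (t' := fun x y z => phi (x \ox y \ox z))) //; try by mlin.
rewrite -ctr3_eps //; apply: eq_ctr3 => x y z.
by have [_ e] := reassP H; rewrite -convol_tens3 e counit_tens3.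
Qed.

(** The two iterated coproducts of the dual; they differ by the associator. *)
Definition copL U (a : A) (B : A -> A -> A -> U) : U :=
  cop a (fun u z => cop u (fun x y => B x y z)).

Definition copR U (a : A) (B : A -> A -> A -> U) : U :=
  cop a (fun x u => cop u (fun y z => B x y z)).

Lemma eq_copL U a (B B' : A -> A -> A -> U) :
  (forall x y z, B x y z = B' x y z) -> copL a B = copL a B'.
Proof. by move=> e; do 2 apply: eq_cop => ? ?; apply: e. Qed.

Lemma eq_copR U a (B B' : A -> A -> A -> U) :
  (forall x y z, B x y z = B' x y z) -> copR a B = copR a B'.
Proof. by move=> e; do 2 apply: eq_cop => ? ?; apply: e. Qed.

Lemma lin_copL V U (a : A) (B : V -> A -> A -> A -> U) :
  (forall x y z, lin (fun v => B v x y z)) -> lin (fun v => copL a (B v)).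
Proof. by move=> l; rewrite /copL; lin; apply: l. Qed.

Lemma lin_copR V U (a : A) (B : V -> A -> A -> A -> U) :
  (forall x y z, lin (fun v => B v x y z)) -> lin (fun v => copR a (B v)).
Proof. by move=> l; rewrite /copR; lin; apply: l. Qed.

Lemma lin_copLa V U (f : V -> A) (B : A -> A -> A -> U) :
  lin f -> lin (fun v => copL (f v) B).
Proof. by move=> l; rewrite /copL; lin. Qed.

Lemma lin_copRa V U (f : V -> A) (B : A -> A -> A -> U) :
  lin f -> lin (fun v => copR (f v) B).
Proof. by move=> l; rewrite /copR; lin. Qed.

Lemma copLE U (a : A) (B : A -> A -> A -> U) : lin3 B ->
  ctr3 (fun x y z => a (x ** y ** z)) B = copL a B.
Proof.
move=> L; rewrite /ctr3 /copL /cop.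
rewrite [RHS]csC [LHS]cs_rot; apply: eq_cs => z c.
do 2 setoid_rewrite cs_scaler.
rewrite [RHS]csC; apply: eq_cs => x a'; rewrite [RHS]csC; apply: eq_cs => y b.
rewrite -(cs_vec (x ** y) (F := fun e => (a (e ** z) : k) *: B a' b c));
  last by lin.
by apply: eq_cs => e d; rewrite !scalerA mulrC.
Qed.

Lemma copRE U (a : A) (B : A -> A -> A -> U) : lin3 B ->
  ctr3 (fun x y z => a (x ** (y ** z))) B = copR a B.
Proof.
move=> L; rewrite /ctr3 /copR /cop; apply: eq_cs => x c.
do 2 setoid_rewrite cs_scaler.
rewrite [RHS]csC; apply: eq_cs => y a'; rewrite [RHS]csC; apply: eq_cs => z b.
rewrite -(cs_vec (y ** z) (F := fun e => (a (x ** e) : k) *: B c a' b));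
  last by lin.
by apply: eq_cs => e d; rewrite !scalerA mulrC.
Qed.

(** This is [mulC_assoc] paired with [a]. *)
Lemma ctr_phi_cop U (a : A) (B : A -> A -> A -> U) : lin3 B ->
  copL a (fun x y z => ctr phi (fun x' y' z' =>
     B (x \cv x') (y \cv y') (z \cv z')))
  = ctr phi (fun x y z => copR a (fun x' y' z' =>
     B (x \cv x') (y \cv y') (z \cv z'))).
Proof.
move=> L.
rewrite -copLE; last by mlin.
under [RHS]eq_ctr => x y z do (rewrite -copRE; last by mlin).
rewrite -[LHS](ctr3_conv (t' := fun x y z => phi (x \ox y \ox z))) //; try by mlin.
rewrite -[RHS](ctr3_conv (t := fun x y z => phi (x \ox y \ox z))) //; try by mlin.
apply: eq_ctr3 => x y z.
have := congr1 a (mulC_assoc x y z).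
rewrite !tsum_hom /conv3 => e.
transitivity (\tsum_(x1, x2 <- Delta x) a
  (\tsum_(d1, d2 <- Delta y) \tsum_(e1, e2 <- Delta z)
    (phi (x2 \ox d2 \ox e2) : k) *: (x1 ** d1 ** e1))).
  apply: eq_tsum => x1 x2; rewrite tsum_hom; apply: eq_tsum => y1 y2.
  by rewrite tsum_hom; apply: eq_tsum => z1 z2; rewrite linearZ; apply: mulrC.
rewrite e; apply: eq_tsum => x1 x2; rewrite tsum_hom; apply: eq_tsum => y1 y2.
by rewrite tsum_hom; apply: eq_tsum => z1 z2; rewrite linearZ.
Qed.

End Kernels.

Ltac lin_iterated :=
  lazymatch goal with
  | |- lin (fun u => copL _ _) =>
      first [(apply: lin_copL => ? ? ?) | apply: lin_copLa]
  | |- lin (fun u => copR _ _) =>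
      first [(apply: lin_copR => ? ? ?) | apply: lin_copRa]
  end.
Ltac lin_base ::= first [lin_convol | lin_contract | lin_iterated | lin_hyp].

Ltac peel :=
  repeat first [ (apply: eq_ctr => ? ? ?) | (apply: eq_copL => ? ? ?)
    | (apply: eq_copR => ? ? ?) | (apply: eq_cop => ? ?)].

Section PhiInverse.
Variables (k : fieldType) (H : coquasiHopf k).
Local Notation A := ('Hom(H, k^o)).
Local Notation "x ** y" := (Defs.mulC H (x \ox y)) (at level 40, left associativity).
Local Notation phi := (reass H).
Local Notation phiV := (reassV H).
Implicit Types U V W : vectType k.

Let HP : is_coalgebra H := cqb_coalgP H.

Local Ltac leaf :=
  peel; rewrite ?(convolA HP) ?(convol1 HP) ?(convolr1 HP) //.

(** Conjugating by [phi] on both sides turns [ctr_phi_cop] into the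
    corresponding identity for [phiV]. *)
Lemma ctr_phiV_cop U (a : A) (B : A -> A -> A -> U) : lin3 B ->
  ctr phiV (fun x y z => copL a (fun x' y' z' =>
     B (x \cv x') (y \cv y') (z \cv z')))
  = copR a (fun x y z => ctr phiV (fun x' y' z' =>
     B (x \cv x') (y \cv y') (z \cv z'))).
Proof.
move=> L.
transitivity (ctr phiV (fun x y z => copL a (fun x' y' z' =>
  ctr phi (fun u v w => ctr phiV (fun u' v' w' =>
     B (x \cv x' \cv (u \cv u')) (y \cv y' \cv (v \cv v')) (z \cv z' \cv (w \cv w'))))))).
  apply: eq_ctr => x y z; apply: eq_copL => x' y' z'.
  rewrite (ctr_phiK (B := fun u v w =>
    B (x \cv x' \cv u) (y \cv y' \cv v) (z \cv z' \cv w))); last by mlin.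
  by leaf.
transitivity (ctr phiV (fun x y z => copL a (fun x' y' z' =>
  ctr phi (fun u v w => ctr phiV (fun u' v' w' =>
     B (x \cv (x' \cv u) \cv u') (y \cv (y' \cv v) \cv v') (z \cv (z' \cv w) \cv w')))))).
  by leaf.
transitivity (ctr phiV (fun x y z => ctr phi (fun u v w => copR a (fun x' y' z' =>
  ctr phiV (fun u' v' w' =>
    B (x \cv (u \cv x') \cv u') (y \cv (v \cv y') \cv v') (z \cv (w \cv z') \cv w')))))).
  apply: eq_ctr => x y z.
  rewrite (ctr_phi_cop a (B := fun p q r => ctr phiV (fun u' v' w' =>
    B (x \cv p \cv u') (y \cv q \cv v') (z \cv r \cv w')))) //.
  by mlin.
transitivity (ctr phiV (fun x y z => ctr phi (fun u v w => copR a (fun x' y' z' =>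
  ctr phiV (fun u' v' w' =>
    B (x \cv u \cv (x' \cv u')) (y \cv v \cv (y' \cv v')) (z \cv w \cv (z' \cv w'))))))).
  by leaf.
rewrite (ctr_phiVK (B := fun p q r => copR a (fun x' y' z' =>
  ctr phiV (fun u' v' w' => B (p \cv (x' \cv u')) (q \cv (y' \cv v')) (r \cv (z' \cv w'))))));
  last by mlin.
by leaf.
Qed.

End PhiInverse.

(** * The pentagon *)

Section PentagonKernels.
Variables (k : fieldType) (H : coquasiHopf k).
Local Notation A := ('Hom(H, k^o)).
Local Notation "x ** y" := (Defs.mulC H (x \ox y)) (at level 40, left associativity).
Local Notation one := (unitC H 1).
Local Notation phi := (reass H).
Local Notation eps := (counit H).
Local Notation Delta := (comul H).
Local Notation H3 := (H *t H *t H).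
Implicit Types (U V W : vectType k) (T : 'Hom(H3, k^o)).

Let HP : is_coalgebra H := cqb_coalgP H.

(** An element of the third tensor power of the dual with one leg comultiplied;
    the capital marks the leg. *)
Definition ctr_Dll U T (B : A -> A -> A -> A -> U) : U :=
  ctr T (fun u z w => cop u (fun x y => B x y z w)).
Definition ctr_lDl U T (B : A -> A -> A -> A -> U) : U :=
  ctr T (fun x u w => cop u (fun y z => B x y z w)).
Definition ctr_llD U T (B : A -> A -> A -> A -> U) : U :=
  ctr T (fun x y u => cop u (fun z w => B x y z w)).

Lemma eq_Dll U T (B B' : A -> A -> A -> A -> U) :
  (forall x y z w, B x y z w = B' x y z w) -> ctr_Dll T B = ctr_Dll T B'.
Proof. by move=> e; rewrite /ctr_Dll; peel; rewrite e. Qed.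

Lemma eq_lDl U T (B B' : A -> A -> A -> A -> U) :
  (forall x y z w, B x y z w = B' x y z w) -> ctr_lDl T B = ctr_lDl T B'.
Proof. by move=> e; rewrite /ctr_lDl; peel; rewrite e. Qed.

Lemma eq_llD U T (B B' : A -> A -> A -> A -> U) :
  (forall x y z w, B x y z w = B' x y z w) -> ctr_llD T B = ctr_llD T B'.
Proof. by move=> e; rewrite /ctr_llD; peel; rewrite e. Qed.

Lemma lin_Dll V U T (B : V -> A -> A -> A -> A -> U) :
  (forall x y z w, lin (fun v => B v x y z w)) -> lin (fun v => ctr_Dll T (B v)).
Proof. by move=> l; rewrite /ctr_Dll; lin; apply: l. Qed.

Lemma lin_lDl V U T (B : V -> A -> A -> A -> A -> U) :
  (forall x y z w, lin (fun v => B v x y z w)) -> lin (fun v => ctr_lDl T (B v)).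
Proof. by move=> l; rewrite /ctr_lDl; lin; apply: l. Qed.

Lemma lin_llD V U T (B : V -> A -> A -> A -> A -> U) :
  (forall x y z w, lin (fun v => B v x y z w)) -> lin (fun v => ctr_llD T (B v)).
Proof. by move=> l; rewrite /ctr_llD; lin; apply: l. Qed.

Lemma cs_mul U (t : H -> k^o) (B : A -> A -> U) : lin t -> lin2 B ->
  cs (fun x a => cs (fun y b => (t (x ** y) : k) *: B a b)) =
  cs (fun (u : H) d => (t u : k) *: cop d B).
Proof.
move=> lt L; rewrite /cop.
do 2 setoid_rewrite cs_scaler.
rewrite [RHS]csC; apply: eq_cs => x a; rewrite [RHS]csC; apply: eq_cs => y b.
rewrite -(cs_vec (x ** y) (F := fun e => (t e : k) *: B a b)); last by lin.
by apply: eq_cs => e d; rewrite !scalerA mulrC.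
Qed.

Lemma ctr4_Dll U T (B : A -> A -> A -> A -> U) : lin4 B ->
  ctr4 (fun x y z w => T ((x ** y) \ox z \ox w)) B = ctr_Dll T B.
Proof.
move=> L; rewrite /ctr4 /ctr_Dll /ctr.
rewrite cs_rot [RHS]csC; apply: eq_cs => z c.
rewrite cs_rot [RHS]csC; apply: eq_cs => w d.
by apply: (cs_mul (t := fun u => T (u \ox z \ox w)) (B := fun a b => B a b c d));
  mlin.
Qed.

Lemma ctr4_lDl U T (B : A -> A -> A -> A -> U) : lin4 B ->
  ctr4 (fun x y z w => T (x \ox (y ** z) \ox w)) B = ctr_lDl T B.
Proof.
move=> L; rewrite /ctr4 /ctr_lDl /ctr; apply: eq_cs => x a.
rewrite cs_rot [RHS]csC; apply: eq_cs => w d.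
by apply: (cs_mul (t := fun u => T (x \ox u \ox w)) (B := fun b c => B a b c d));
  mlin.
Qed.

Lemma ctr4_llD U T (B : A -> A -> A -> A -> U) : lin4 B ->
  ctr4 (fun x y z w => T (x \ox y \ox (z ** w))) B = ctr_llD T B.
Proof.
move=> L; rewrite /ctr4 /ctr_llD /ctr; do 2 apply: eq_cs => ? ?.
by apply: (cs_mul (t := fun u => T (_ \ox u)) (B := fun c d => B _ _ c d)); mlin.
Qed.

Lemma ctr4_lll1 U T (B : A -> A -> A -> A -> U) : lin4 B ->
  ctr4 (fun x y z w => T (x \ox y \ox z) * eps w : k^o) B =
  ctr T (fun x y z => B x y z eps).
Proof.
move=> L; rewrite /ctr4 /ctr; do 3 apply: eq_cs => ? ?.
rewrite -[X in _ = _ *: X](cs_fun _ (F := fun d => B _ _ _ d)); last by lin.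
by rewrite cs_scaler; apply: eq_cs => ? ?; rewrite scalerA.
Qed.

Lemma ctr4_1lll U T (B : A -> A -> A -> A -> U) : lin4 B ->
  ctr4 (fun x y z w => eps x * T (y \ox z \ox w) : k^o) B =
  ctr T (fun y z w => B eps y z w).
Proof.
move=> L; rewrite -[RHS](cs_fun _ (F := fun d => ctr T (fun y z w => B d y z w)));
  last by lin.
rewrite /ctr4 /ctr; apply: eq_cs => ? ?.
by do 3 (rewrite cs_scaler; apply: eq_cs => ? ?); rewrite scalerA.
Qed.

Lemma counitlk (F : H -> k^o) x :
  lin F -> \tsum_(y, z <- Delta x) (eps y * F z : k^o) = F x.
Proof. exact: counitl. Qed.

Lemma counitrk (F : H -> k^o) x :
  lin F -> \tsum_(y, z <- Delta x) (F y * eps z : k^o) = F x.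
Proof.
move=> lF; rewrite -(counitr HP _ lF); apply: eq_tsum => y z; exact: mulrC.
Qed.

(** Inserting counits writes both sides of [reass_cocycle] as convolution
    products of functions of four variables. *)
Lemma pentagon_kernel (c d e f : H) :
  conv4 (fun x y z w => phi ((x ** y) \ox z \ox w))
        (fun x y z w => phi (x \ox y \ox (z ** w))) c d e f =
  conv4 (fun x y z w => phi (x \ox y \ox z) * eps w : k^o)
    (conv4 (fun x y z w => phi (x \ox (y ** z) \ox w))
           (fun x y z w => eps x * phi (y \ox z \ox w) : k^o)) c d e f.
Proof.
rewrite /conv4 (reass_cocycle c d e f); apply: eq_tsum => c1 c'.
apply: eq_tsum => d1 d'; rewrite tsumC; apply: eq_tsum => e1 e'.
transitivity (phi (c1 \ox d1 \ox e1) *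
  \tsum_(d2, d3 <- Delta d') \tsum_(e2, e3 <- Delta e') \tsum_(f1, f2 <- Delta f)
    (phi (c' \ox (d2 ** e2) \ox f1) * phi (d3 \ox e3 \ox f2) : k^o)).
  rewrite tsum_mulr; apply: eq_tsum => d2 d3.
  rewrite tsum_mulr; apply: eq_tsum => e2 e3.
  by rewrite tsum_mulr; apply: eq_tsum => f1 f2; rewrite mulrA.
transitivity (\tsum_(f1, f2 <- Delta f) (eps f1 * 
  (phi (c1 \ox d1 \ox e1) *
  \tsum_(d2, d3 <- Delta d') \tsum_(e2, e3 <- Delta e') \tsum_(f1, f2 <- Delta f2)
    (phi (c' \ox (d2 ** e2) \ox f1) * phi (d3 \ox e3 \ox f2) : k^o)) : k^o)).
  rewrite (counitlk (F := fun f => phi (c1 \ox d1 \ox e1) *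
  \tsum_(d2, d3 <- Delta d') \tsum_(e2, e3 <- Delta e') \tsum_(f1, f2 <- Delta f)
    (phi (c' \ox (d2 ** e2) \ox f1) * phi (d3 \ox e3 \ox f2) : k^o) : k^o)) //.
  by lin.
apply: eq_tsum => f1 f'; rewrite mulrA [eps f1 * _]mulrC; congr (_ * _).
rewrite -(counitrk c' (F := fun c' => \tsum_(d2, d3 <- Delta d')
  \tsum_(e2, e3 <- Delta e') \tsum_(f1, f2 <- Delta f')
    (phi (c' \ox (d2 ** e2) \ox f1) * phi (d3 \ox e3 \ox f2) : k^o) : k^o));
  last by lin.
apply: eq_tsum => c2 c3; rewrite tsum_mull; apply: eq_tsum => d2 d3.
rewrite tsum_mull; apply: eq_tsum => e2 e3.
by rewrite tsum_mull; apply: eq_tsum => f2 f3; ring.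
Qed.

End PentagonKernels.

Ltac lin_four :=
  lazymatch goal with
  | |- lin (fun u => ctr_Dll _ _) => apply: lin_Dll => ? ? ? ?
  | |- lin (fun u => ctr_lDl _ _) => apply: lin_lDl => ? ? ? ?
  | |- lin (fun u => ctr_llD _ _) => apply: lin_llD => ? ? ? ?
  end.
Ltac lin_base ::=
  first [lin_convol | lin_contract | lin_iterated | lin_four | lin_hyp].

Ltac peel ::=
  repeat first [ (apply: eq_ctr => ? ? ?) | (apply: eq_copL => ? ? ?)
    | (apply: eq_copR => ? ? ?) | (apply: eq_cop => ? ?)
    | (apply: eq_Dll => ? ? ? ?) | (apply: eq_lDl => ? ? ? ?)
    | (apply: eq_llD => ? ? ? ?) ].

Section PentagonIdentity.
Variables (k : fieldType) (H : coquasiHopf k).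
Local Notation A := ('Hom(H, k^o)).
Local Notation "x ** y" := (Defs.mulC H (x \ox y)) (at level 40, left associativity).
Local Notation one := (unitC H 1).
Local Notation phi := (reass H).
Local Notation eps := (counit H).
Local Notation H3 := (H *t H *t H).
Implicit Types (U V W : vectType k) (T : 'Hom(H3, k^o)).

Let HP : is_coalgebra H := cqb_coalgP H.
Local Ltac leaf :=
  peel; rewrite ?(convolA HP) ?(convol1 HP) ?(convolr1 HP) //.

Lemma pentagon U (B : A -> A -> A -> A -> U) : lin4 B ->
  ctr_Dll phi (fun x y z w => ctr_llD phi (fun x' y' z' w' =>
    B (x \cv x') (y \cv y') (z \cv z') (w \cv w'))) =
  ctr phi (fun x y z => ctr_lDl phi (fun x' y' z' w' =>
    ctr phi (fun y'' z'' w'' =>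
      B (x \cv x') (y \cv y' \cv y'') (z \cv z' \cv z'') (w' \cv w'')))).
Proof.
move=> L; have := eq_ctr4 B (@pentagon_kernel _ H).
rewrite ctr4_conv //; try by mlin.
rewrite ctr4_Dll; last by rewrite /ctr4; mlin.
rewrite [X in X = _](_ : _ = ctr_Dll phi (fun x y z w => ctr_llD phi (fun x' y' z' w' =>
    B (x \cv x') (y \cv y') (z \cv z') (w \cv w')))); last first.
  by apply: eq_Dll => x y z w; rewrite ctr4_llD //; mlin.
move=> ->; rewrite ctr4_conv //; try by rewrite /conv4; mlin.
rewrite ctr4_lll1; last by rewrite /ctr4; mlin.
apply: eq_ctr => x y z; rewrite ctr4_conv; try by mlin.
rewrite ctr4_lDl; last by rewrite /ctr4; mlin.
apply: eq_lDl => x' y' z' w'; rewrite ctr4_1lll; last by mlin.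
by leaf.
Qed.

Lemma cop_ctrC U (a : A) T (F : A -> A -> A -> A -> A -> U) :
  cop a (fun x y => ctr T (F x y)) =
  ctr T (fun u v w => cop a (fun x y => F x y u v w)).
Proof.
rewrite /cop /ctr; repeat setoid_rewrite cs_scaler.
do 3 (rewrite cs_rot; apply: eq_cs => ? ?).
by do 2 apply: eq_cs => ? ?; rewrite !scalerA mulrC.
Qed.

Lemma ctr_ctrC U T T' (F : A -> A -> A -> A -> A -> A -> U) :
  ctr T (fun x y z => ctr T' (F x y z)) =
  ctr T' (fun u v w => ctr T (fun x y z => F x y z u v w)).
Proof.
rewrite /ctr; repeat setoid_rewrite cs_scaler.
do 3 (rewrite cs_rot4; apply: eq_cs => ? ?).
by do 3 apply: eq_cs => ? ?; rewrite !scalerA mulrC.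
Qed.

(** The coproduct is a morphism of algebras, so inverse elements stay inverse
    after comultiplying a leg. *)
Section Inverse.
Variables T T' : 'Hom(H3, k^o).
Hypothesis TK : forall U (B : A -> A -> A -> U), lin3 B ->
  ctr T (fun x y z => ctr T' (fun x' y' z' =>
    B (x \cv x') (y \cv y') (z \cv z'))) = B eps eps eps.

Lemma Dll_inv U (B : A -> A -> A -> A -> U) : lin4 B ->
  ctr_Dll T (fun x y z w => ctr_Dll T' (fun x' y' z' w' =>
    B (x \cv x') (y \cv y') (z \cv z') (w \cv w'))) = B eps eps eps eps.
Proof.
move=> L; rewrite -(cop1 (B := fun x y => B x y eps eps)); last by mlin.
rewrite -(TK (B := fun u z w => cop u (fun x y => B x y z w))); last by mlin.
apply: eq_ctr => u z w; rewrite cop_ctrC; apply: eq_ctr => u' z' w'.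
by rewrite copM //; mlin.
Qed.

Lemma lDl_inv U (B : A -> A -> A -> A -> U) : lin4 B ->
  ctr_lDl T (fun x y z w => ctr_lDl T' (fun x' y' z' w' =>
    B (x \cv x') (y \cv y') (z \cv z') (w \cv w'))) = B eps eps eps eps.
Proof.
move=> L; rewrite -(cop1 (B := fun x y => B eps x y eps)); last by mlin.
rewrite -(TK (B := fun z u w => cop u (fun x y => B z x y w))); last by mlin.
apply: eq_ctr => z u w; rewrite cop_ctrC; apply: eq_ctr => z' u' w'.
by rewrite copM //; mlin.
Qed.

Lemma llD_inv U (B : A -> A -> A -> A -> U) : lin4 B ->
  ctr_llD T (fun x y z w => ctr_llD T' (fun x' y' z' w' =>
    B (x \cv x') (y \cv y') (z \cv z') (w \cv w'))) = B eps eps eps eps.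
Proof.
move=> L; rewrite -(cop1 (B := fun x y => B eps eps x y)); last by mlin.
rewrite -(TK (B := fun z w u => cop u (fun x y => B z w x y))); last by mlin.
apply: eq_ctr => z w u; rewrite cop_ctrC; apply: eq_ctr => z' w' u'.
by rewrite copM //; mlin.
Qed.

End Inverse.

End PentagonIdentity.

Section PentagonInverse.
Variables (k : fieldType) (H : coquasiHopf k).
Local Notation A := ('Hom(H, k^o)).
Local Notation "x ** y" := (Defs.mulC H (x \ox y)) (at level 40, left associativity).
Local Notation phi := (reass H).
Local Notation phiV := (reassV H).
Local Notation eps := (counit H).
Local Notation H3 := (H *t H *t H).
Implicit Types (U V W : vectType k) (T : 'Hom(H3, k^o)).

Let HP : is_coalgebra H := cqb_coalgP H.
Local Ltac leaf :=
  peel; rewrite ?(convolA HP) ?(convol1 HP) ?(convolr1 HP) //.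

(** Inverting both sides of [pentagon]: prefix with the inverse of its right
    hand side, which then cancels against it. *)
Lemma pentagonV U (B : A -> A -> A -> A -> U) : lin4 B ->
  ctr_llD phiV (fun x y z w => ctr_Dll phiV (fun x' y' z' w' =>
    B (x \cv x') (y \cv y') (z \cv z') (w \cv w'))) =
  ctr phiV (fun y z w => ctr_lDl phiV (fun x y' z' w' =>
    ctr phiV (fun x' y'' z'' =>
      B (x \cv x') (y \cv y' \cv y'') (z \cv z' \cv z'') (w \cv w')))).
Proof.
move=> L.
(* [C] is the left hand side with a further factor on the left; it stays opaque
   until it cancels. *)
pose C0 x0 y0 z0 w0 := ctr_llD phiV (fun x y z w => ctr_Dll phiV (fun x' y' z' w' =>
    B (x0 \cv (x \cv x')) (y0 \cv (y \cv y')) (z0 \cv (z \cv z')) (w0 \cv (w \cv w')))).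
have lC0 : lin4 C0 by rewrite /C0; mlin.
have [C CE lC] : exists2 C, (forall x y z w, C x y z w = C0 x y z w) & lin4 C.
  by exists C0.
rewrite /C0 in CE; clear C0 lC0.
transitivity (C eps eps eps eps); first by rewrite CE; leaf.
(* Multiply by the right hand side of the statement times that of [pentagon],
   which are inverse to each other. *)
transitivity (ctr phiV (fun y z w => ctr_lDl phiV (fun x y' z' w' =>
   ctr phiV (fun x' y'' z'' => ctr phi (fun x1 y1 z1 => ctr_lDl phi (fun x2 y2 z2 w2 =>
   ctr phi (fun y3 z3 w3 =>
     C (x \cv x' \cv x1 \cv x2) (y \cv y' \cv y'' \cv y1 \cv y2 \cv y3)
       (z \cv z' \cv z'' \cv z1 \cv z2 \cv z3) (w \cv w' \cv w2 \cv w3)))))))).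
  symmetry.
  transitivity (ctr phiV (fun y z w => ctr_lDl phiV (fun x y' z' w' =>
    ctr_lDl phi (fun x2 y2 z2 w2 => ctr phi (fun y3 z3 w3 =>
     C (x \cv x2) (y \cv y' \cv y2 \cv y3)
       (z \cv z' \cv z2 \cv z3) (w \cv w' \cv w2 \cv w3)))))).
    apply: eq_ctr => y z w; apply: eq_lDl => x y' z' w'.
    transitivity (ctr phiV (fun x' y'' z'' => ctr phi (fun x1 y1 z1 =>
      ctr_lDl phi (fun x2 y2 z2 w2 => ctr phi (fun y3 z3 w3 =>
       C (x \cv (x' \cv x1) \cv x2) (y \cv y' \cv (y'' \cv y1) \cv y2 \cv y3)
       (z \cv z' \cv (z'' \cv z1) \cv z2 \cv z3) (w \cv w' \cv w2 \cv w3)))))).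
      by leaf.
    rewrite (ctr_phiVK (B := fun p q r => ctr_lDl phi (fun x2 y2 z2 w2 =>
      ctr phi (fun y3 z3 w3 => C (x \cv p \cv x2) (y \cv y' \cv q \cv y2 \cv y3)
       (z \cv z' \cv r \cv z2 \cv z3) (w \cv w' \cv w2 \cv w3))))); last by mlin.
    by leaf.
  transitivity (ctr phiV (fun y z w => ctr phi (fun y3 z3 w3 =>
     C eps (y \cv y3) (z \cv z3) (w \cv w3)))).
    apply: eq_ctr => y z w.
    transitivity (ctr_lDl phiV (fun x y' z' w' =>
      ctr_lDl phi (fun x2 y2 z2 w2 => ctr phi (fun y3 z3 w3 =>
       C (x \cv x2) (y \cv (y' \cv y2) \cv y3)
       (z \cv (z' \cv z2) \cv z3) (w \cv (w' \cv w2) \cv w3))))).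
      by leaf.
    rewrite (lDl_inv (@ctr_phiVK _ H) (B := fun p q r t => ctr phi (fun y3 z3 w3 =>
      C p (y \cv q \cv y3) (z \cv r \cv z3) (w \cv t \cv w3)))); last by mlin.
    by leaf.
  by rewrite (ctr_phiVK (B := C eps)) //; mlin.
(* Exchange the right hand side of [pentagon] for its left hand side. *)
transitivity (ctr phiV (fun y z w => ctr_lDl phiV (fun x y' z' w' =>
   ctr phiV (fun x' y'' z'' => 
  ctr_Dll phi (fun x1 y1 z1 w1 => ctr_llD phi (fun x2 y2 z2 w2 =>
     C (x \cv x' \cv (x1 \cv x2)) (y \cv y' \cv y'' \cv (y1 \cv y2))
       (z \cv z' \cv z'' \cv (z1 \cv z2)) (w \cv w' \cv (w1 \cv w2)))))))).
  apply: eq_ctr => y z w; apply: eq_lDl => x y' z' w'.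
  apply: eq_ctr => x' y'' z''.
  rewrite (pentagon (B := fun p q r t => C (x \cv x' \cv p) (y \cv y' \cv y'' \cv q)
    (z \cv z' \cv z'' \cv r) (w \cv w' \cv t))); last by mlin.
  by leaf.
(* The left hand side of [pentagon] is now followed by its inverse, which is
   hidden in [C]. *)
apply: eq_ctr => y z w; apply: eq_lDl => x y' z' w'.
apply: eq_ctr => x' y'' z''.
transitivity (ctr_Dll phi (fun x1 y1 z1 w1 => ctr_llD phi (fun x2 y2 z2 w2 =>
  ctr_llD phiV (fun x3 y3 z3 w3 => ctr_Dll phiV (fun x4 y4 z4 w4 =>
    B (x \cv x' \cv x1 \cv (x2 \cv x3) \cv x4)
      (y \cv y' \cv y'' \cv y1 \cv (y2 \cv y3) \cv y4)
      (z \cv z' \cv z'' \cv z1 \cv (z2 \cv z3) \cv z4)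
      (w \cv w' \cv w1 \cv (w2 \cv w3) \cv w4)))))).
  by peel; rewrite CE; leaf.
transitivity (ctr_Dll phi (fun x1 y1 z1 w1 => ctr_Dll phiV (fun x4 y4 z4 w4 =>
    B (x \cv x' \cv (x1 \cv x4))
      (y \cv y' \cv y'' \cv (y1 \cv y4))
      (z \cv z' \cv z'' \cv (z1 \cv z4))
      (w \cv w' \cv (w1 \cv w4))))).
  apply: eq_Dll => x1 y1 z1 w1.
  rewrite (llD_inv (@ctr_phiK _ H) (B := fun p q r t => ctr_Dll phiV (fun x4 y4 z4 w4 =>
    B (x \cv x' \cv x1 \cv p \cv x4) (y \cv y' \cv y'' \cv y1 \cv q \cv y4)
      (z \cv z' \cv z'' \cv z1 \cv r \cv z4) (w \cv w' \cv w1 \cv t \cv w4))));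
    last by mlin.
  by leaf.
rewrite (Dll_inv (@ctr_phiK _ H) (B := fun p q r t =>
    B (x \cv x' \cv p) (y \cv y' \cv y'' \cv q)
      (z \cv z' \cv z'' \cv r) (w \cv w' \cv t))); last by mlin.
by leaf.
Qed.

End PentagonInverse.

(** * Contractions of the pentagon *)

Section Normalisation.
Variables (k : fieldType) (H : coquasiHopf k).
Local Notation A := ('Hom(H, k^o)).
Local Notation "x ** y" := (Defs.mulC H (x \ox y)) (at level 40, left associativity).
Local Notation one := (unitC H 1).
Local Notation phi := (reass H).
Local Notation phiV := (reassV H).
Local Notation eps := (counit H).
Local Notation H3 := (H *t H *t H).
Implicit Types (U V W : vectType k) (T : 'Hom(H3, k^o)).

Let HP : is_coalgebra H := cqb_coalgP H.
Local Ltac leaf :=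
  peel; rewrite ?(convolA HP) ?(convol1 HP) ?(convolr1 HP) //.

Lemma cop_copC U (a b : A) (F : A -> A -> A -> A -> U) :
  cop a (fun x y => cop b (F x y)) =
  cop b (fun u v => cop a (fun x y => F x y u v)).
Proof.
rewrite /cop; repeat setoid_rewrite cs_scaler.
do 2 (rewrite cs_rot; apply: eq_cs => ? ?).
by do 2 apply: eq_cs => ? ?; rewrite !scalerA mulrC.
Qed.

(** This is [reass_normal] in the dual. *)
Lemma phi_counit_mid U (F : A -> A -> U) : lin2 F ->
  ctr phi (fun x u y => (u one : k) *: F x y) = F eps eps.
Proof.
move=> L; rewrite -(cs_fun eps (F := fun a => F a eps)); last by lin.
apply: eq_cs => x a; rewrite csC -(cs_fun eps (F := F a)); last by lin.
rewrite cs_scaler; apply: eq_cs => y b; rewrite scalerA.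
rewrite -reass_normal -(cs_vec one (F := fun e => (phi (x \ox e \ox y) : k) *: F a b));
  last by lin.
by apply: eq_cs => e d; rewrite !scalerA mulrC.
Qed.

Lemma ctr_Z U T (c : k) (F : A -> A -> A -> U) :
  ctr T (fun x y z => c *: F x y z) = c *: ctr T F.
Proof. by rewrite (ctr_lin _ _ (lin_scaler c (@lin_id _ U))). Qed.

Lemma cop_Z U (a : A) (c : k) (F : A -> A -> U) :
  cop a (fun x y => c *: F x y) = c *: cop a F.
Proof. by rewrite (cop_lin _ _ (lin_scaler c (@lin_id _ U))). Qed.

(** Evaluating the second leg of the pentagon at the unit leaves a copy of [phi]
    on both sides; cancelling it gives the normalisation in the first leg.
    Evaluating the third leg gives [phi_counit_right] in the same way. *)
Lemma phi_counit_left U (F : A -> A -> U) : lin2 F ->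
  ctr phi (fun u x y => (u one : k) *: F x y) = F eps eps.
Proof.
move=> L.
have key U' (G : A -> A -> A -> U') : lin3 G ->
  ctr phi G = ctr phi (fun x z w => ctr phi (fun y'' z'' w'' =>
     (y'' one : k) *: G x (z \cv z'') (w \cv w''))).
  move=> LG.
  have LB : lin4 (fun x (y : A) z w => (y one : k) *: G x z w) by mlin.
  have := pentagon LB => /=.
  rewrite [X in X = _ -> _](_ : _ = ctr phi G); last first.
    transitivity (ctr_Dll phi (fun x y z w => (y one : k) *: G x z w)); last first.
      by apply: eq_ctr => u z w; rewrite (cop_counitr u (F := fun x => G x z w)) //; lin.
    apply: eq_Dll => x y z w.
    transitivity (ctr phi (fun x' y' v => (y' one : k) *: cop v (fun z' w' =>
       (y one : k) *: G (x \cv x') (z \cv z') (w \cv w')))).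
      by apply: eq_ctr => x' y' v; rewrite -cop_Z; peel; rewrite convol_one scalerA mulrC.
    rewrite (phi_counit_mid (F := fun x' v => cop v (fun z' w' =>
       (y one : k) *: G (x \cv x') (z \cv z') (w \cv w')))); last by mlin.
    by rewrite cop1; [rewrite !convolr1 | mlin].
  move=> ->.
  transitivity (ctr phi (fun x y z => (y one : k) *: ctr_lDl phi (fun x' y' z' w' =>
    ctr phi (fun y'' z'' w'' => (y' one : k) *: ((y'' one : k) *:
      G (x \cv x') (z \cv z' \cv z'') (w' \cv w'')))))).
    apply: eq_ctr => x y z; rewrite /ctr_lDl -ctr_Z; apply: eq_ctr => x' u w'.
    rewrite -cop_Z; apply: eq_cop => y' z'; rewrite -ctr_Z; peel.
    by rewrite !convol_one !scalerA.
  rewrite (phi_counit_mid (F := fun x z => ctr_lDl phi (fun x' y' z' w' =>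
    ctr phi (fun y'' z'' w'' => (y' one : k) *: ((y'' one : k) *:
      G (x \cv x') (z \cv z' \cv z'') (w' \cv w'')))))); last by mlin.
  apply: eq_ctr => x' u w'.
  under eq_cop => y' z' do rewrite ctr_Z.
  by rewrite cop_counitl; [leaf | lin].
have := ctr_phiVK (B := fun (x : A) z w => (x one : k) *: F z w).
move=> /(_ ltac:(mlin)); rewrite counit_one scale1r => <-.
transitivity (ctr phiV (fun x0 z0 w0 => ctr phi (fun x z w => ctr phi
  (fun y'' z'' w'' => (y'' one : k) *: ((x0 \cv x) one *:
     F (z0 \cv (z \cv z'')) (w0 \cv (w \cv w''))))))); last first.
  apply: eq_ctr => x0 z0 w0; symmetry.
  by apply: (key _ (fun x z w => (x0 \cv x) one *: F (z0 \cv z) (w0 \cv w))); mlin.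
transitivity (ctr phiV (fun x0 z0 w0 => ctr phi (fun x z w => (x0 \cv x) one *:
 ctr phi  (fun y'' z'' w'' => (y'' one : k) *: (
     F (z0 \cv z \cv z'') (w0 \cv w \cv w'')))))); last first.
  do 2 apply: eq_ctr => ? ? ?; rewrite -ctr_Z; peel.
  by rewrite !convolA // !scalerA mulrC.
rewrite (ctr_phiVK (B := fun x z w => (x one : k) *: ctr phi (fun y'' z'' w'' =>
  (y'' one : k) *: F (z \cv z'') (w \cv w'')))); last by mlin.
by rewrite counit_one scale1r; leaf.
Qed.

Lemma phi_counit_right U (F : A -> A -> U) : lin2 F ->
  ctr phi (fun x y u => (u one : k) *: F x y) = F eps eps.
Proof.
move=> L.
have key U' (G : A -> A -> A -> U') : lin3 G ->
  ctr phi G = ctr phi (fun x y z => (z one : k) *: ctr phi (fun x' y' w' =>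
     G (x \cv x') (y \cv y') w')).
  move=> LG.
  have LB : lin4 (fun x y (z : A) w => (z one : k) *: G x y w) by mlin.
  have := pentagon LB => /=.
  rewrite [X in X = _ -> _](_ : _ = ctr phi G); last first.
    transitivity (ctr phi (fun u z w => (z one : k) *: cop u (fun x y =>
      ctr_llD phi (fun x' y' z' w' => (z' one : k) *:
         G (x \cv x') (y \cv y') (w \cv w'))))).
      apply: eq_ctr => u z w; rewrite -cop_Z; apply: eq_cop => x y.
      by rewrite /ctr_llD -ctr_Z; peel; rewrite -cop_Z; peel; rewrite convol_one scalerA.
    rewrite (phi_counit_mid (F := fun u w => cop u (fun x y =>
      ctr_llD phi (fun x' y' z' w' => (z' one : k) *:
         G (x \cv x') (y \cv y') (w \cv w'))))); last by mlin.
    rewrite cop1; last by mlin.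
    apply: eq_ctr => x' y' v; rewrite cop_counitl; last by lin.
    by rewrite !convol1.
  move=> ->; apply: eq_ctr => x y z.
  transitivity ((z one : k) *: ctr_lDl phi (fun x' y' z' w' => (z' one : k) *:
     ctr phi (fun y'' z'' w'' => (z'' one : k) *:
       G (x \cv x') (y \cv y' \cv y'') (w' \cv w'')))).
    rewrite /ctr_lDl -ctr_Z; apply: eq_ctr => x' u w'.
    rewrite -cop_Z; apply: eq_cop => y' z'; rewrite -!ctr_Z; peel.
    by rewrite !convol_one !scalerA.
  congr (_ *: _); apply: eq_ctr => x' u w'.
  rewrite (cop_counitr u (F := fun y' => ctr phi (fun y'' z'' w'' => (z'' one : k) *:
       G (x \cv x') (y \cv y' \cv y'') (w' \cv w'')))); last by lin.
  rewrite (phi_counit_mid (F := fun y'' w'' => G (x \cv x') (y \cv u \cv y'') (w' \cv w'')));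
    last by mlin.
  by rewrite !convolr1.
have := key _ (fun x y w => ctr phiV (fun x' y' w' => (w \cv w') one *: F (x \cv x') (y \cv y'))).
rewrite (ctr_phiK (B := fun x y w => (w one : k) *: F x y)); last by mlin.
rewrite counit_one scale1r => -> //; last by mlin.
apply: eq_ctr => x y z; congr (_ *: _).
transitivity (ctr phi (fun x' y' w' => ctr phiV (fun x'0 y'0 w'0 =>
   (w' \cv w'0) one *: F (x \cv (x' \cv x'0)) (y \cv (y' \cv y'0))))); last by leaf.
rewrite (ctr_phiK (B := fun x' y' w' => (w' one : k) *: F (x \cv x') (y \cv y')));
  last by mlin.
by rewrite counit_one scale1r !convolr1.
Qed.

Lemma phiV_counit_left U (F : A -> A -> U) : lin2 F ->
  ctr phiV (fun u x y => (u one : k) *: F x y) = F eps eps.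
Proof.
move=> L; have := ctr_phiK (B := fun u x y => (u one : k) *: F x y).
move=> /(_ ltac:(mlin)); rewrite counit_one scale1r => <-.
transitivity (ctr phi (fun u x y => (u one : k) *: ctr phiV (fun u' x' y' =>
  (u' one : k) *: F (x \cv x') (y \cv y')))).
  rewrite (phi_counit_left (F := fun x y => ctr phiV (fun u' x' y' =>
  (u' one : k) *: F (x \cv x') (y \cv y')))); last by mlin.
  by leaf.
by apply: eq_ctr => u x y; rewrite -ctr_Z; peel; rewrite convol_one scalerA.
Qed.

Lemma phiV_counit_mid U (F : A -> A -> U) : lin2 F ->
  ctr phiV (fun x u y => (u one : k) *: F x y) = F eps eps.
Proof.
move=> L; have := ctr_phiK (B := fun x u y => (u one : k) *: F x y).
move=> /(_ ltac:(mlin)); rewrite counit_one scale1r => <-.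
transitivity (ctr phi (fun x u y => (u one : k) *: ctr phiV (fun x' u' y' =>
  (u' one : k) *: F (x \cv x') (y \cv y')))).
  rewrite (phi_counit_mid (F := fun x y => ctr phiV (fun x' u' y' =>
  (u' one : k) *: F (x \cv x') (y \cv y')))); last by mlin.
  by leaf.
by apply: eq_ctr => u x y; rewrite -ctr_Z; peel; rewrite convol_one scalerA.
Qed.

Lemma phiV_counit_right U (F : A -> A -> U) : lin2 F ->
  ctr phiV (fun x y u => (u one : k) *: F x y) = F eps eps.
Proof.
move=> L; have := ctr_phiK (B := fun x y u => (u one : k) *: F x y).
move=> /(_ ltac:(mlin)); rewrite counit_one scale1r => <-.
transitivity (ctr phi (fun x y u => (u one : k) *: ctr phiV (fun x' y' u' =>
  (u' one : k) *: F (x \cv x') (y \cv y')))).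
  rewrite (phi_counit_right (F := fun x y => ctr phiV (fun x' y' u' =>
  (u' one : k) *: F (x \cv x') (y \cv y')))); last by mlin.
  by leaf.
by apply: eq_ctr => u x y; rewrite -ctr_Z; peel; rewrite convol_one scalerA.
Qed.

End Normalisation.

Section Contract.
Variables (k : fieldType) (H : coquasiHopf k).
Local Notation A := ('Hom(H, k^o)).
Local Notation one := (unitC H 1).
Local Notation phi := (reass H).
Local Notation phiV := (reassV H).
Local Notation eps := (counit H).
Local Notation H3 := (H *t H *t H).
Implicit Types (U V W : vectType k) (T : 'Hom(H3, k^o)).

Let HP : is_coalgebra H := cqb_coalgP H.
Local Ltac leaf :=
  peel; rewrite ?(convolA HP) ?(convol1 HP) ?(convolr1 HP) //.

(** If neighbouring legs of [B] absorb coproducts, then contracting the pentagon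
    with [B] trivialises every comultiplied associator, so that only [phi (x) 1]
    and [1 (x) phi] survive, the latter moved to the other side as its inverse.
    Each triangle identity below is an instance, with [B] built from [alpha],
    [beta] and the antipode. *)
Lemma pentagon_contract U (B : A -> A -> A -> A -> U) : lin4 B ->
  (forall a x y z w,
     cop a (fun i j => B (i \cv x) (j \cv y) z w) = (a one : k) *: B x y z w) ->
  (forall a x y z w,
     cop a (fun i j => B x (y \cv i) (z \cv j) w) = (a one : k) *: B x y z w) ->
  (forall a x y z w,
     cop a (fun i j => B x y (i \cv z) (j \cv w)) = (a one : k) *: B x y z w) ->
  ctr phiV (fun x y z => B eps x y z) = ctr phi (fun x y z => B x y z eps).
Proof.
move=> L h12 h23 h34.
transitivity (ctr_Dll phi (fun x y z w => ctr_llD phi (fun x' y' z' w' =>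
  ctr phiV (fun y1 z1 w1 => B (x \cv x') (y \cv y' \cv y1) (z \cv z' \cv z1)
     (w \cv w' \cv w1))))); last first.
  rewrite (pentagon (B := fun p q r t => ctr phiV (fun y1 z1 w1 =>
    B p (q \cv y1) (r \cv z1) (t \cv w1)))); last by mlin.
  apply: eq_ctr => x y z.
  transitivity (B (x \cv eps) y z eps); last by rewrite convolr1.
  rewrite -(phi_counit_mid (F := fun x' w' => B (x \cv x') y z w')); last by mlin.
  apply: eq_ctr => x' u w'; rewrite -h23; apply: eq_cop => y' z'.
  transitivity (ctr phi (fun y'' z'' w'' => ctr phiV (fun y1 z1 w1 =>
    B (x \cv x') (y \cv y' \cv (y'' \cv y1)) (z \cv z' \cv (z'' \cv z1))
      (w' \cv (w'' \cv w1))))); first by leaf.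
  rewrite (ctr_phiK (B := fun p q r => B (x \cv x') (y \cv y' \cv p) (z \cv z' \cv q)
    (w' \cv r))); last by mlin.
  by leaf.
pose Y x y z w := ctr_llD phi (fun x' y' z' w' => ctr phiV (fun y1 z1 w1 =>
    B (x \cv x') (y \cv y' \cv y1) (z \cv z' \cv z1) (w \cv w' \cv w1))).
transitivity (ctr phi (fun u z w => (u one : k) *: Y eps eps z w)); last first.
  rewrite /Y; apply: eq_ctr => u z w; rewrite /ctr_llD -ctr_Z cop_ctrC.
  apply: eq_ctr => x' y' v; rewrite -cop_Z cop_copC; apply: eq_cop => z' w'.
  rewrite -ctr_Z cop_ctrC; apply: eq_ctr => y1 z1 w1.
  by rewrite -h12; leaf.
rewrite (phi_counit_left (F := Y eps eps)); last by rewrite /Y; mlin.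
rewrite /Y /ctr_llD.
transitivity (ctr phiV (fun y1 z1 w1 => B eps (eps \cv y1) z1 w1)).
  by leaf.
rewrite -(phi_counit_right (F := fun x y => ctr phiV (fun y1 z1 w1 => B x (y \cv y1) z1 w1)));
  last by mlin.
apply: eq_ctr => x' y' v; rewrite cop_ctrC -ctr_Z; apply: eq_ctr => y1 z1 w1.
by rewrite -h34; leaf.
Qed.

Lemma pentagonV_contract U (B : A -> A -> A -> A -> U) : lin4 B ->
  (forall a x y z w,
     cop a (fun i j => B (x \cv i) (y \cv j) z w) = (a one : k) *: B x y z w) ->
  (forall a x y z w,
     cop a (fun i j => B x (i \cv y) (j \cv z) w) = (a one : k) *: B x y z w) ->
  (forall a x y z w,
     cop a (fun i j => B x y (z \cv i) (w \cv j)) = (a one : k) *: B x y z w) ->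
  ctr phi (fun x y z => B eps x y z) = ctr phiV (fun x y z => B x y z eps).
Proof.
move=> L h12 h23 h34.
transitivity (ctr phi (fun y0 z0 w0 => ctr_llD phiV (fun x y z w =>
  ctr_Dll phiV (fun x' y' z' w' => B (x \cv x') (y0 \cv (y \cv y'))
     (z0 \cv (z \cv z')) (w0 \cv (w \cv w')))))).
  apply: eq_ctr => y0 z0 w0.
  transitivity (B eps (y0 \cv eps) z0 w0); first by rewrite convolr1.
  rewrite -(phiV_counit_right (F := fun x y => B x (y0 \cv y) z0 w0)); last by mlin.
  apply: eq_ctr => x y v; rewrite -h34; apply: eq_cop => z w.
  transitivity (B (x \cv eps) (y0 \cv y) (z0 \cv z \cv eps) (w0 \cv w)).
    by rewrite !convolr1.
  transitivity (B (x \cv eps) (y0 \cv y) (z0 \cv z \cv eps) (w0 \cv w \cv eps)).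
    by rewrite !convolr1.
  rewrite -(phiV_counit_left (F := fun z' w' => B (x \cv eps) (y0 \cv y) (z0 \cv z \cv z')
     (w0 \cv w \cv w'))); last by mlin.
  by apply: eq_ctr => u z' w'; rewrite -h12; leaf.
transitivity (ctr phi (fun y0 z0 w0 =>  ctr phiV (fun y z w =>
  ctr_lDl phiV (fun x y' z' w' => ctr phiV (fun x' y'' z'' =>
      B (x \cv x') (y0 \cv y \cv (y' \cv y'')) (z0 \cv z \cv (z' \cv z''))
        (w0 \cv w \cv w')))))).
  apply: eq_ctr => y0 z0 w0.
  rewrite (pentagonV (B := fun p q r t => B p (y0 \cv q) (z0 \cv r) (w0 \cv t)));
    last by mlin.
  by leaf.
rewrite (ctr_phiK (B := fun p q r => ctr_lDl phiV (fun x y' z' w' =>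
   ctr phiV (fun x' y'' z'' => B (x \cv x') (p \cv (y' \cv y''))
    (q \cv (z' \cv z'')) (r \cv w'))))); last by mlin.
transitivity (ctr phiV (fun x u w => (u one : k) *: ctr phiV (fun x' y'' z'' =>
   B (x \cv x') y'' z'' w))).
  apply: eq_ctr => x u w; rewrite cop_ctrC -ctr_Z; apply: eq_ctr => x' y'' z''.
  by rewrite -h23; leaf.
rewrite (phiV_counit_mid (F := fun x w => ctr phiV (fun x' y'' z'' =>
   B (x \cv x') y'' z'' w))); last by mlin.
by leaf.
Qed.
End Contract.

(** * Quasi-Hopf structures on the dual *)

Section Drinfeld.
Variables (k : fieldType) (H : coquasiHopf k).
Local Notation A := ('Hom(H, k^o)).
Local Notation one := (unitC H 1).
Local Notation eps := (counit H).
Local Notation H3 := (H *t H *t H).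
Implicit Types (U V W : vectType k).

(** A quasi-Hopf structure on the dual of [H], for the coproduct [cop] and counit
    the evaluation at 1, with antipode [s], [al], [be] and with associator [T] of
    inverse [T'].  It holds the consequences of the axioms that the next
    arguments use, in a form that also fits the opposite algebra
    ([drinfeld_op]): an argument on right coactions then applies to left ones. *)
Record drinfeld (mul : A -> A -> A) (s : A -> A) (al be : A)
    (T T' : 'Hom(H3, k^o)) : Prop := Drinfeld {
  dr_lin2 : lin2 mul;
  dr_mulA : forall a b c, mul a (mul b c) = mul (mul a b) c;
  dr_mul1 : forall a, mul eps a = a;
  dr_mulr1 : forall a, mul a eps = a;
  dr_slin : lin s;
  dr_sM : forall a b, s (mul a b) = mul (s b) (s a);
  dr_s1 : s eps = eps;
  dr_alpha : forall a,
    cop a (fun x y => mul (mul (s x) al) y) = (a one : k) *: al;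
  dr_beta : forall a,
    cop a (fun x y => mul (mul x be) (s y)) = (a one : k) *: be;
  dr_zigzag :
    ctr T (fun x y z => mul (mul (mul (mul (s x) al) y) be) (s z)) = eps;
  dr_zigzagV :
    ctr T' (fun x y z => mul (mul (mul (mul x be) (s y)) al) z) = eps;
  dr_conj : forall U a (B : A -> A -> A -> U), lin3 B ->
    copL a (fun x y z => ctr T (fun x' y' z' =>
       B (mul x x') (mul y y') (mul z z')))
    = ctr T (fun x y z => copR a (fun x' y' z' =>
       B (mul x x') (mul y y') (mul z z')));
  dr_conjV : forall U a (B : A -> A -> A -> U), lin3 B ->
    ctr T' (fun x y z => copL a (fun x' y' z' =>
       B (mul x x') (mul y y') (mul z z')))
    = copR a (fun x y z => ctr T' (fun x' y' z' =>
       B (mul x x') (mul y y') (mul z z')));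
  dr_contract : forall U (B : A -> A -> A -> A -> U), lin4 B ->
    (forall a x y z w,
     cop a (fun i j => B (mul i x) (mul j y) z w) = (a one : k) *: B x y z w) ->
    (forall a x y z w,
     cop a (fun i j => B x (mul y i) (mul z j) w) = (a one : k) *: B x y z w) ->
    (forall a x y z w,
     cop a (fun i j => B x y (mul i z) (mul j w)) = (a one : k) *: B x y z w) ->
    ctr T' (fun x y z => B eps x y z) = ctr T (fun x y z => B x y z eps)
}.

Variables (mul : A -> A -> A) (s : A -> A) (al be : A) (T T' : 'Hom(H3, k^o)).
Hypothesis D : drinfeld mul s al be T T'.

Let L : lin2 mul := dr_lin2 D.
Let sl : lin s := dr_slin D.

Lemma dr_alphaK U (F : A -> U) a : lin F ->
  cop a (fun x y => F (mul (mul (s x) al) y)) = (a one : k) *: F al.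
Proof. by move=> lF; rewrite -cop_lin // (dr_alpha D) linZ. Qed.

Lemma dr_betaK U (F : A -> U) a : lin F ->
  cop a (fun x y => F (mul (mul x be) (s y))) = (a one : k) *: F be.
Proof. by move=> lF; rewrite -cop_lin // (dr_beta D) linZ. Qed.

(** One side of the adjunction between tensoring with [H] and with its dual.  A
    map [g] from a module into the dual that satisfies [g_inv] is a colinear form
    on the tensor product of the module with [H]; [sharp] is the corresponding
    map into the dual, and [sharp_flat] says that it induces [g] through the
    evaluation. *)
Section Sharp.
Variables (X : vectType k) (act : A -> X -> X) (g : X -> A).
Hypothesis actL : lin2 act.
Hypothesis actM : forall a b t, act (mul a b) t = act a (act b t).
Hypothesis act1 : forall t, act eps t = t.
Hypothesis gL : lin g.
Hypothesis g_inv : forall a t,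
  cop a (fun x y => mul (g (act x t)) y) = (a one : k) *: g t.

Definition sharp t : A :=
  ctr T (fun x y z => mul (mul (mul (g (act x t)) y) be) (s z)).

Lemma g_invK V (F : A -> V) a t : lin F ->
  cop a (fun x y => F (mul (g (act x t)) y)) = (a one : k) *: F (g t).
Proof. by move=> lF; rewrite -cop_lin // g_inv linZ. Qed.

Lemma sharp_lin : lin sharp.
Proof. by rewrite /sharp; lin. Qed.

(** Writing [act a] with a counit and splitting off [be] by [dr_beta] creates an
    iterated coproduct of [a]; [dr_conj] moves it to the other side of [T], where
    [g_inv] absorbs two of its factors. *)
Lemma sharp_act a t : sharp (act a t) = mul (sharp t) (s a).
Proof.
transitivity (ctr T (fun x y z => copR a (fun x' y' z' =>
   mul (mul (mul (g (act (mul x x') t)) (mul y y')) be) (s (mul z z'))))).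
  apply: eq_ctr => x y z; rewrite -actM.
  rewrite -(cop_counitr a (F := fun x' =>
    mul (mul (mul (g (act (mul x x') t)) y) be) (s z))); last by lin.
  apply: eq_cop => x' u; rewrite -(dr_betaK (F := fun v =>
    mul (mul (mul (g (act (mul x x') t)) y) v) (s z))); last by lin.
  by apply: eq_cop => y' z'; rewrite (dr_sM D) !(dr_mulA D).
rewrite -(dr_conj D a (B := fun x y z => mul (mul (mul (g (act x t)) y) be) (s z)));
  last by mlin.
transitivity (cop a (fun u z => (u one : k) *: ctr T (fun x' y' z' =>
  mul (mul (mul (g (act x' t)) y') be) (s (mul z z'))))).
  apply: eq_cop => u z; rewrite cop_ctrC -ctr_Z; apply: eq_ctr => x' y' z'.
  rewrite -(g_invK (F := fun v => mul (mul (mul v y') be) (s (mul z z'))));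
    last by lin.
  by apply: eq_cop => x y; rewrite actM !(dr_mulA D).
rewrite (cop_counitl a (F := fun z => ctr T (fun x' y' z' =>
  mul (mul (mul (g (act x' t)) y') be) (s (mul z z'))))); last by lin.
rewrite /sharp (ctr_lin _ _ (f := fun v => mul v (s a))); last by lin.
by apply: eq_ctr => x y z; rewrite (dr_sM D) (dr_mulA D).
Qed.

Lemma sharp_flat t : mul (sharp t) al = g t.
Proof.
transitivity (ctr T (fun x y z =>
  mul (mul (mul (mul (mul (g (act x t)) y) be) (s z)) al) eps)).
  rewrite /sharp (ctr_lin _ _ (f := fun v => mul v al)); last by lin.
  by apply: eq_ctr => x y z; rewrite (dr_mulr1 D).
rewrite -(dr_contract D (B := fun x y z w =>
  mul (mul (mul (mul (mul (g (act x t)) y) be) (s z)) al) w)).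
- transitivity (mul (g t) eps); last by rewrite (dr_mulr1 D).
  rewrite -[X in _ = mul _ X](dr_zigzagV D) (ctr_lin _ _ (f := fun v => mul (g t) v)); last by lin.
  by apply: eq_ctr => x y z; rewrite act1 !(dr_mulA D).
- by mlin.
- move=> a x y z w.
  rewrite -(g_invK (F := fun v => mul (mul (mul (mul (mul v y) be) (s z)) al) w)); last by lin.
  by apply: eq_cop => i j; rewrite actM !(dr_mulA D).
- move=> a x y z w.
  rewrite -(dr_betaK (F := fun v => mul (mul (mul (mul (mul (g (act x t)) y) v) (s z)) al) w)); last by lin.
  by apply: eq_cop => i j; rewrite (dr_sM D) !(dr_mulA D).
- move=> a x y z w.
  rewrite -(dr_alphaK (F := fun v => mul (mul (mul (mul (mul (g (act x t)) y) be) (s z)) v) w)); last by lin.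
  by apply: eq_cop => i j; rewrite (dr_sM D) !(dr_mulA D).
Qed.

End Sharp.

(** The transposed antipode is an epimorphism of algebras.  If [f s = g s] then
    the comparison element [theta] intertwines [g] with [f], hence commutes
    with the image of [g s]; the pentagon gives [f al theta = g al], and together
    with the zigzag identity this forces [theta = 1]. *)
Section Mono.
Variables (U : vectType k) (op : U -> U -> U) (u1 : U) (f g : A -> U).
Hypothesis opL : lin2 op.
Hypothesis opA : forall a b c, op a (op b c) = op (op a b) c.
Hypothesis op1 : forall a, op u1 a = a.
Hypothesis opr1 : forall a, op a u1 = a.
Hypotheses (fL : lin f) (gL : lin g).
Hypotheses (fM : forall a b, f (mul a b) = op (f a) (f b)) (f1 : f eps = u1).
Hypotheses (gM : forall a b, g (mul a b) = op (g a) (g b)) (g1 : g eps = u1).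
Hypothesis fs : forall a, f (s a) = g (s a).

Let theta : U :=
  ctr T' (fun x y z => op (op (f (mul x be)) (f (s y))) (g (mul al z))).

Lemma theta_intertwines a : op theta (g a) = op (f a) theta.
Proof.
have := dr_conjV D a (B := fun x y z => op (op (f (mul x be)) (f (s y))) (g (mul al z))).
move=> /(_ ltac:(mlin)) e.
transitivity (ctr T' (fun x y z => copL a (fun x' y' z' =>
  op (op (f (mul (mul x x') be)) (f (s (mul y y')))) (g (mul al (mul z z')))))).
  rewrite /theta (ctr_lin _ _ (f := fun v => op v (g a))); last by lin.
  apply: eq_ctr => x y z.
  transitivity (op (op (f (mul x be)) (f (s y))) (g (mul al (mul z a)))).
    by rewrite -opA -gM (dr_mulA D).
  rewrite -(cop_counitl a (F := fun z' =>
     op (op (f (mul x be)) (f (s y))) (g (mul al (mul z z'))))); last by lin.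
  apply: eq_cop => u z'.
  rewrite -(dr_betaK (F := fun v => op (op (f (mul x v)) (f (s y))) (g (mul al (mul z z'))))); last by lin.
  by apply: eq_cop => x' y'; rewrite (dr_sM D) -!fM !(dr_mulA D).
rewrite {}e.
transitivity (cop a (fun x v => (v one : k) *: ctr T' (fun x' y' z' =>
  op (op (f (mul (mul x x') be)) (f (s y'))) (g (mul al z'))))).
  apply: eq_cop => x v; rewrite cop_ctrC -ctr_Z; apply: eq_ctr => x' y' z'.
  rewrite -(dr_alphaK (F := fun v => op (op (f (mul (mul x x') be)) (f (s y'))) (g (mul v z')))); last by lin.
  by apply: eq_cop => y z; rewrite (dr_sM D) !fM !gM !opA -!fs.
rewrite (cop_counitr a (F := fun x => ctr T' (fun x' y' z' =>
  op (op (f (mul (mul x x') be)) (f (s y'))) (g (mul al z'))))); last by lin.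
rewrite /theta (ctr_lin _ _ (f := fun v => op (f a) v)); last by lin.
by apply: eq_ctr => x y z; rewrite !fM !opA.
Qed.

Lemma theta_alpha : op (f al) theta = g al.
Proof.
transitivity (ctr T' (fun x y z => op (op (f (mul (mul (mul (s eps) al) x) be)) (f (s y)))
   (g (mul al z)))).
  rewrite /theta (ctr_lin _ _ (f := fun v => op (f al) v)); last by lin.
  by apply: eq_ctr => x y z; rewrite (dr_s1 D) (dr_mul1 D) !fM !opA.
rewrite (dr_contract D (B := fun x y z w =>
   op (op (f (mul (mul (mul (s x) al) y) be)) (f (s z))) (g (mul al w)))).
- transitivity (op (f eps) (g al)); last by rewrite f1 op1.
  rewrite -[X in _ = op (f X) _](dr_zigzag D) (ctr_lin _ _ (f := fun v => op (f v) (g al))); last by lin.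
  by apply: eq_ctr => x y z; rewrite -!fM (dr_mulr1 D).
- by mlin.
- move=> a x y z w.
  rewrite -(dr_alphaK (F := fun v => op (op (f (mul (mul (mul (s x) v) y) be)) (f (s z)))
    (g (mul al w)))); last by lin.
  by apply: eq_cop => i j; rewrite (dr_sM D) !(dr_mulA D).
- move=> a x y z w.
  rewrite -(dr_betaK (F := fun v => op (op (f (mul (mul (mul (s x) al) y) v)) (f (s z)))
    (g (mul al w)))); last by lin.
  by apply: eq_cop => i j; rewrite (dr_sM D) -!fM !(dr_mulA D).
- move=> a x y z w.
  rewrite -(dr_alphaK (F := fun v => op (op (f (mul (mul (mul (s x) al) y) be)) (f (s z)))
    (g (mul v w)))); last by lin.
  by apply: eq_cop => i j; rewrite (dr_sM D) !fM !gM !opA -!fs.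
Qed.

Lemma theta1 : theta = u1.
Proof.
have e1 : op theta (g al) = g al by rewrite theta_intertwines theta_alpha.
transitivity (op theta (g eps)); first by rewrite g1 opr1.
rewrite -g1 -(dr_zigzag D).
rewrite (ctr_lin _ _ (f := fun v => op theta (g v))); last by lin.
rewrite (ctr_lin _ _ (f := g)) //; apply: eq_ctr => x y z.
rewrite !gM !opA theta_intertwines fs -[op (op (g (s x)) theta) (g al)]opA e1.
by [].
Qed.

Lemma antipode_epi a : f a = g a.
Proof. by have := theta_intertwines a; rewrite theta1 op1 opr1. Qed.

End Mono.
End Drinfeld.

(** * Bijectivity of the antipode *)

(** The images of the iterates decrease, so their dimensions stabilise. *)
Lemma iter_image (k : fieldType) (V : vectType k) (S : 'End(V)) :
  exists j, forall x, exists z, iter j S x = iter j.+1 S z.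
Proof.
pose P n : 'End(V) := iter n (comp_lfun S) \1%VF.
have PE n x : P n x = iter n S x.
  by elim: n => [|n IH]; rewrite /= ?id_lfunE // comp_lfunE IH.
have sub n : (limg (P n.+1) <= limg (P n))%VS.
  apply/subvP=> y /memv_imgP[x _ ->]; rewrite PE iterSr -PE.
  exact: memv_img (memvf _).
have [j jP] : exists j, limg (P j) = limg (P j.+1).
  suff: forall d i, (\dim (limg (P i)) <= d)%N -> exists j, limg (P j) = limg (P j.+1).
    by move=> /(_ _ 0%N (leqnn _)).
  elim=> [|d IH] i le_d.
    exists i; apply/eqP; rewrite eqEsubv sub andbT.
    by move: le_d; rewrite leqn0 dimv_eq0 => /eqP ->; apply: sub0v.
  have [e|ne] := eqVneq (\dim (limg (P i.+1))) (\dim (limg (P i))).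
    by exists i; apply/esym/eqP; rewrite eqEdim sub e leqnn.
  apply: (IH i.+1); rewrite -ltnS; apply: leq_trans le_d.
  by rewrite ltn_neqAle ne dimvS.
exists j => x; have: P j x \in limg (P j.+1) by rewrite -jP memv_img ?memvf.
by case/memv_imgP=> z _; rewrite !PE => ->; exists z.
Qed.

(** Fitting's lemma: a high power [T] of [S] is invertible on its image, and [R]
    inverts it there.  The exponent is chosen even, since even powers of an
    antihomomorphism are multiplicative, and positive. *)
Lemma iter_stable (k : fieldType) (V : vectType k) (S : 'End(V)) :
  exists N, exists R : 'End(V),
    [/\ forall x, exists z, iter N.+1.*2 S x = iter N.+1.*2 S (iter N.+1.*2 S z)
      & forall x, R (iter N.+1.*2 S (iter N.+1.*2 S x)) = iter N.+1.*2 S x].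
Proof.
have [j jP] := iter_image S; exists j; set N := j.+1.*2.
have up n x : exists z, iter j S x = iter (n + j) S z.
  elim: n x => [|n IH] x; first by exists x.
  have [z ->] := IH x; have [w ew] := jP z; exists w.
  by rewrite addSn -addnS !iterD ew.
have le_j : (j <= N)%N by rewrite /N -addnn leqW // ?addSn ?ltnS ?leq_addr // leqW // leq_addr.
have sN x : exists z, iter N S x = iter N S (iter N S z).
  have [z ez] := up (N + N - j)%N (iter (N - j) S x); exists z.
  rewrite -iterD -[in LHS](subnKC le_j) iterD ez subnK //.
  exact: leq_trans le_j (leq_addr _ _).
pose P n : 'End(V) := iter n (comp_lfun S) \1%VF.
have PE n x : P n x = iter n S x.
  by elim: n => [|n IH]; rewrite /= ?id_lfunE // comp_lfunE IH.
exists (P N \o (P N \o P N)^-1)%VF; split=> // x.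
have kerE : lker (P N) = lker (P N \o P N)%VF.
  apply/eqP; rewrite eqEdim; apply/andP; split.
    by apply/subvP=> y; rewrite !memv_ker comp_lfunE => /eqP ->; rewrite linear0.
  have sub : (limg (P N) <= limg (P N \o P N)%VF)%VS.
    apply/subvP=> y /memv_imgP[z _ ->]; have [w ew] := sN z.
    by rewrite PE ew -!PE -comp_lfunE memv_img ?memvf.
  have := limg_ker_dim (P N) fullv; have := limg_ker_dim (P N \o P N)%VF fullv.
  rewrite !capfv => e1 e2; move: (dimvS sub).
  by rewrite -(leq_add2l (\dim (lker (P N \o P N)%VF))) e1 -e2 leq_add2r.
set y := iter N S (iter N S x).
have : (P N \o P N)^-1%VF y - x \in lker (P N).
  rewrite kerE memv_ker linearB /= subr_eq0.
  have -> : y = (P N \o P N)%VF x by rewrite comp_lfunE !PE.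
  by rewrite -[X in X == _]comp_lfunE -[X in X == _]comp_lfunE inv_lfun_def.
rewrite memv_ker linearB subr_eq0 /= => /eqP e.
by rewrite comp_lfunE e; apply: (PE N x).
Qed.

Section Bijective.
Variables (k : fieldType) (H : coquasiHopf k).
Local Notation A := ('Hom(H, k^o)).
Local Notation phi := (reass H).
Local Notation phiV := (reassV H).
Local Notation eps := (counit H).
Local Notation S := (antip H).
Local Notation alpha := (antip_alpha H).
Local Notation beta := (antip_beta H).
Local Notation s := (fun a : A => (a \o S)%VF).

Let HP : is_coalgebra H := cqb_coalgP H.

Lemma drinfeld_dual : drinfeld (@convol k H) s alpha beta phi phiV.
Proof.
split.
- by mlin.
- exact: convolA.
- exact: convol1.
- exact: convolr1.
- by lin.
- exact: sM.
- exact: s1.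
- exact: cop_alpha_fun.
- exact: cop_beta_fun.
- exact: ctr_phi_fun.
- exact: ctr_phiV_fun.
- exact: ctr_phi_cop.
- exact: ctr_phiV_cop.
- exact: pentagon_contract.
Qed.

Let spow n (a : A) : A := iter n s a.

Lemma spowE n a x : spow n a x = a (iter n S x).
Proof.
elim: n a x => [//|n IH] a x.
by rewrite /spow iterSr -/(spow n _) IH comp_lfunE -iterS.
Qed.

(** The product that the [n]-th power of the transposed antipode preserves: the
    opposite one when [n] is odd. *)
Let cvop (odd : bool) (a b : A) : A := if odd then b \cv a else a \cv b.

Lemma spowM n a b : spow n (a \cv b) = cvop (odd n) (spow n a) (spow n b).
Proof.
elim: n => [//|n IH]; rewrite /spow !iterS -!/(spow n _) IH /cvop oddS.
by case: (odd n); rewrite sM.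
Qed.

Lemma spow1 n : spow n eps = eps.
Proof. by elim: n => [//|n IH]; rewrite /spow iterS -/(spow n _) IH; apply: s1. Qed.

Lemma spow_lin n : lin (spow n).
Proof.
elim: n => [|n IH]; first exact: lin_id.
by rewrite /spow; apply: (lin_comp_lfunl S IH).
Qed.

Lemma fun_separate (V : vectType k) (x y : V) :
  (forall a : 'Hom(V, k^o), a x = a y) -> x = y.
Proof.
move=> e; rewrite -(cs_vec x (@lin_id _ V)) -(cs_vec y (@lin_id _ V)).
by apply: eq_cs => v d; rewrite e.
Qed.

(** The idempotent [e] projecting the dual onto the stable part of the powers
    of [s] is an algebra map with [e s^N = s^N]; cancelling the epimorphism [s]
    [N] times leaves [e = 1]. *)
Lemma antip_inj : injective S.
Proof.
have [n [R [sN RK]]] := iter_stable S; set N := n.+1.*2 in sN RK.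
pose T := iter N S.
have oN : odd N = false by rewrite /N odd_double.
pose e (a : A) : A := spow N (a \o R)%VF.
have eE a x : e a x = a (R (T x)) by rewrite spowE comp_lfunE.
have eN a : e (spow N a) = spow N a.
  apply/lfunP=> x; rewrite eE !spowE; have [z ez] := sN x.
  by rewrite /T {1}ez RK -ez.
have eM a b : e (a \cv b) = e a \cv e b.
  have <- : spow N ((a \o R)%VF \cv (b \o R)%VF) = e a \cv e b.
    by rewrite spowM /cvop oN.
  apply/lfunP=> x; have [z ez] := sN x.
  rewrite eE spowE /T ez RK -!spowE !spowM /cvop oN.
  have key c : spow N (spow N (c \o R)%VF) = spow N c.
    by apply/lfunP=> y; rewrite !spowE comp_lfunE RK.
  by rewrite spowM /cvop oN !key.
have e1 : e eps = eps.
  apply/lfunP=> x; have [z ez] := sN x.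
  rewrite eE /T ez RK -[LHS]spowE spow1 -[in RHS](spow1 N) spowE.
  by rewrite ez -!spowE !spow1.
have eL : lin e by apply: (@lin_comp _ _ _ _ (spow N)); [apply: spow_lin | lin].
have cancel_s m : (m <= N)%N -> forall a, spow m a = e (spow m a).
  move=> le_m; rewrite -(subKn le_m); elim: (N - m)%N (leq_subr m N) => [|i IH] le_i a.
    by rewrite subn0 eN.
  have {}IH := IH (ltnW le_i); set j := (N - i.+1)%N.
  have ej : (N - i = j.+1)%N by rewrite /j -subSn.
  apply: (antipode_epi drinfeld_dual (op := cvop (odd j)) (u1 := eps)
    (f := spow j) (g := fun a => e (spow j a))).
  - by rewrite /cvop; case: odd; mlin.
  - by rewrite /cvop; case: odd => a' b' c'; rewrite convolA.
  - by rewrite /cvop; case: odd => a'; rewrite ?convol1 ?convolr1.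
  - by rewrite /cvop; case: odd => a'; rewrite ?convol1 ?convolr1.
  - exact: spow_lin.
  - by apply: (lin_comp eL); apply: spow_lin.
  - exact: spowM.
  - exact: spow1.
  - by move=> a' b'; rewrite spowM /cvop; case: odd; rewrite eM.
  - by rewrite spow1.
  - by move=> a'; have := IH a'; rewrite ej /spow iterSr.
have eid a : e a = a by apply: esym; apply: (cancel_s 0%N).
apply/(@lker0P _ _ _ S)/eqP/eqP; rewrite -subv0.
apply/subvP=> x; rewrite memv_ker memv0 => /eqP Sx0; apply/eqP.
apply: fun_separate => a; rewrite -{1}[a]eid eE.
have -> : T x = 0; last by rewrite !linear0.
by rewrite /T /N doubleS iterSr Sx0; elim: (n.*2.+1) => [//|i /= ->]; rewrite linear0.
Qed.

End Bijective.

Section Opposite.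
Variables (k : fieldType) (H : coquasiHopf k).
Local Notation A := ('Hom(H, k^o)).
Local Notation phi := (reass H).
Local Notation phiV := (reassV H).
Local Notation eps := (counit H).
Local Notation S := (antip H).
Local Notation Sbar := (S^-1)%VF.
Local Notation alpha := (antip_alpha H).
Local Notation beta := (antip_beta H).
Local Notation s := (fun a : A => (a \o S)%VF).
Local Notation sb := (fun a : A => (a \o Sbar)%VF).

Let HP : is_coalgebra H := cqb_coalgP H.

Lemma antipK : cancel S Sbar.
Proof.
by apply: lker0_lfunK; apply/lker0P; apply: antip_inj.
Qed.

Lemma antipVK : cancel Sbar S.
Proof.
by apply: lker0_lfunVK; apply/lker0P; apply: antip_inj.
Qed.

Lemma sbK a : sb (s a) = a.
Proof. by apply/lfunP=> x; rewrite !comp_lfunE antipVK. Qed.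

Lemma sK a : s (sb a) = a.
Proof. by apply/lfunP=> x; rewrite !comp_lfunE antipK. Qed.

Lemma sbM a b : sb (a \cv b) = sb b \cv sb a.
Proof. by rewrite -{1}[a]sK -{1}[b]sK -sM sbK. Qed.

Lemma sb1 : sb eps = eps.
Proof. by rewrite -{1}(s1 H) sbK. Qed.

(** Exchanging left and right: the opposite dual, with the inverse antipode and
    the inverse associator. *)
Lemma drinfeld_op :
  drinfeld (fun a b : A => b \cv a) sb (sb beta) (sb alpha) phiV phi.
Proof.
split.
- by mlin.
- by move=> a b c; rewrite convolA.
- exact: convolr1.
- exact: convol1.
- by lin.
- by move=> a b; rewrite sbM.
- exact: sb1.
- move=> a; rewrite -(@linZ _ _ _ sb); last by lin.
  rewrite -cop_beta_fun (cop_lin (f := sb)); last by lin.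
  by apply: eq_cop => x y; rewrite !sbM sbK.
- move=> a; rewrite -(@linZ _ _ _ sb); last by lin.
  rewrite -cop_alpha_fun (cop_lin (f := sb)); last by lin.
  by apply: eq_cop => x y; rewrite !sbM sbK.
- rewrite -sb1 -ctr_phiV_fun (ctr_lin (f := sb)); last by lin.
  by apply: eq_ctr => x y z; rewrite !sbM sbK.
- rewrite -[RHS]sb1 -ctr_phi_fun (ctr_lin (f := sb)); last by lin.
  by apply: eq_ctr => x y z; rewrite !sbM !sbK.
- move=> U a B L.
  rewrite /copL; under eq_cop => u z do rewrite cop_ctrC; rewrite cop_ctrC.
  rewrite [LHS]ctr_phiV_cop // /copR.
  by under eq_cop => x u do rewrite cop_ctrC; rewrite cop_ctrC.
- move=> U a B L; rewrite /copL /copR.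
  under [RHS]eq_cop => x u do rewrite cop_ctrC; rewrite [RHS]cop_ctrC.
  rewrite -[RHS]ctr_phi_cop // /copL.
  by under [RHS]eq_cop => x u do rewrite cop_ctrC; rewrite [RHS]cop_ctrC.
- by move=> U B L *; apply: pentagonV_contract.
Qed.
End Opposite.

(** * Comodules as modules over the dual *)

Section Actions.
Variables (k : fieldType) (H : coquasiHopf k).
Local Notation A := ('Hom(H, k^o)).
Let HP : is_coalgebra H := cqb_coalgP H.
Implicit Types U X Y : vectType k.

(** The actions of the dual that correspond to coactions.  A coaction is
    determined by its action ([hitr_coact], [hitl_coact]). *)
Definition hitr X (rho : 'Hom(X, X *t H)) (a : A) (x : X) : X :=
  \tsum_(x0, h <- rho x) (a h : k) *: x0.

Definition hitl X (lam : 'Hom(X, H *t X)) (a : A) (x : X) : X :=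
  \tsum_(h, x0 <- lam x) (a h : k) *: x0.

Lemma hitr_tsum X (rho : 'Hom(X, X *t H)) U (B : X -> H -> U) x : lin2 B ->
  tsum (rho x) B = cs (fun e d => B (hitr rho d x) e).
Proof. by case=> l1 l2; apply: tsum_slice. Qed.

Lemma hitl_tsum X (lam : 'Hom(X, H *t X)) U (B : H -> X -> U) x : lin2 B ->
  tsum (lam x) B = cs (fun e d => B e (hitl lam d x)).
Proof. by case=> l1 l2; apply: tsum_slicel. Qed.

Lemma hitr_coact X (rho : 'Hom(X, X *t H)) x :
  rho x = cs (fun e d => hitr rho d x \ox e).
Proof. by rewrite -(hitr_tsum _ (B := @tmk _ _ _)) ?tsum_id //; mlin. Qed.

Lemma hitl_coact X (lam : 'Hom(X, H *t X)) x :
  lam x = cs (fun e d => e \ox hitl lam d x).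
Proof. by rewrite -(hitl_tsum _ (B := @tmk _ _ _)) ?tsum_id //; mlin. Qed.

Lemma lin_hitr U X (rho : 'Hom(X, X *t H)) (a : A) (f : U -> X) :
  lin f -> lin (fun u => hitr rho a (f u)).
Proof. by move=> lf; rewrite /hitr; lin. Qed.

Lemma lin_hitra U X (rho : 'Hom(X, X *t H)) (x : X) (f : U -> A) :
  lin f -> lin (fun u => hitr rho (f u) x).
Proof. by move=> lf; rewrite /hitr; lin. Qed.

Lemma lin_hitl U X (rho : 'Hom(X, H *t X)) (a : A) (f : U -> X) :
  lin f -> lin (fun u => hitl rho a (f u)).
Proof. by move=> lf; rewrite /hitl; lin. Qed.

Lemma lin_hitla U X (rho : 'Hom(X, H *t X)) (x : X) (f : U -> A) :
  lin f -> lin (fun u => hitl rho (f u) x).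
Proof. by move=> lf; rewrite /hitl; lin. Qed.

End Actions.

Ltac lin_hit :=
  lazymatch goal with
  | |- lin (fun u => hitr _ _ _) => first [apply: lin_hitr | apply: lin_hitra]
  | |- lin (fun u => hitl _ _ _) => first [apply: lin_hitl | apply: lin_hitla]
  end.
Ltac lin_base ::=
  first [lin_convol | lin_contract | lin_iterated | lin_four | lin_hit | lin_hyp].

Section Dictionary.
Variables (k : fieldType) (H : coquasiHopf k).
Local Notation eps := (counit H).
Local Notation Delta := (comul H).
Let HP : is_coalgebra H := cqb_coalgP H.
Implicit Types U X Y : vectType k.

Lemma hitr_hom X Y (rX : 'Hom(X, X *t H)) (rY : 'Hom(Y, Y *t H)) (f : 'Hom(X, Y)) :
  (forall x, rY (f x) = \tsum_(x0, h <- rX x) f x0 \ox h) <->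
  (forall a x, hitr rY a (f x) = f (hitr rX a x)).
Proof.
split=> [e a x | e x].
  rewrite /hitr e tsum_tsum tsum_hom; apply: eq_tsum => y h.
  by rewrite tsumE ?linearZ //; lin.
rewrite hitr_coact hitr_tsum; last by mlin.
by apply: eq_cs => y d; rewrite e.
Qed.

Lemma hitl_hom X Y (rX : 'Hom(X, H *t X)) (rY : 'Hom(Y, H *t Y)) (f : 'Hom(X, Y)) :
  (forall x, rY (f x) = \tsum_(h, x0 <- rX x) h \ox f x0) <->
  (forall a x, hitl rY a (f x) = f (hitl rX a x)).
Proof.
split=> [e a x | e x].
  rewrite /hitl e tsum_tsum tsum_hom; apply: eq_tsum => y h.
  by rewrite tsumE ?linearZ //; lin.
rewrite hitl_coact hitl_tsum; last by mlin.
by apply: eq_cs => y d; rewrite e.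
Qed.

(** Pairing the coaction axioms with functionals gives the module axioms;
    conversely the axioms are recovered by summing over dual bases. *)
Lemma right_coactionP X (rho : 'Hom(X, X *t H)) :
  right_coaction rho <->
  (forall a b x, hitr rho (a \cv b) x = hitr rho a (hitr rho b x)) /\
  (forall x, hitr rho eps x = x).
Proof.
split=> -[e1 e2]; split=> //.
  move=> a b x.
  pose G (t : X *t (H *t H)) := \tsum_(y, s <- t) \tsum_(h, g <- s)
    ((a h * b g : k) *: y).
  have lG : lin G by rewrite /G; lin.
  have GE y h g : G (y \ox (h \ox g)) = (a h * b g : k) *: y.
    by rewrite /G !tsumE //; lin.
  have := congr1 G (e1 x); rewrite !(lin_tsum _ _ lG).
  under eq_tsum => y z do rewrite (lin_tsum _ _ lG).
  under [X in _ = X -> _]eq_tsum => y z do rewrite (lin_tsum _ _ lG).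
  setoid_rewrite GE => e.
  transitivity (\tsum_(x0, h <- rho x) \tsum_(h1, h2 <- Delta h)
     ((a h1 * b h2 : k) *: x0)).
    by apply: eq_tsum => x0 h; rewrite convolE tsum_scalel.
  rewrite -e [X in hitr rho a X]/hitr (lin_tsum _ _ (f := hitr rho a)); last by lin.
  apply: eq_tsum => y h; rewrite (linZ (f := hitr rho a)); last by lin.
  by rewrite /hitr tsum_scaler; apply: eq_tsum => ? ?; rewrite scalerA mulrC.
move=> x; rewrite hitr_tsum; last by mlin.
under eq_cs => h d do (rewrite hitr_tsum; last by mlin).
rewrite hitr_tsum; last by mlin.
have := cs_comul (F := fun h1 h2 d => hitr rho d x \ox (h1 \ox h2)) => ->; try by lin.
rewrite csC; apply: eq_cs => h a; apply: eq_cs => g b.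
by rewrite e1.
Qed.

Lemma left_coactionP X (rho : 'Hom(X, H *t X)) :
  left_coaction rho <->
  (forall a b x, hitl rho (a \cv b) x = hitl rho b (hitl rho a x)) /\
  (forall x, hitl rho eps x = x).
Proof.
split=> -[e1 e2]; split=> //.
  move=> a b x.
  pose G (t : H *t (H *t X)) := \tsum_(h, s <- t) \tsum_(g, y <- s)
    ((a h * b g : k) *: y).
  have lG : lin G by rewrite /G; lin.
  have GE y h g : G (h \ox (g \ox y)) = (a h * b g : k) *: y.
    by rewrite /G !tsumE //; lin.
  have := congr1 G (e1 x); rewrite !(lin_tsum _ _ lG).
  under eq_tsum => y z do rewrite (lin_tsum _ _ lG).
  under [X in _ = X -> _]eq_tsum => y z do rewrite (lin_tsum _ _ lG).
  setoid_rewrite GE => e.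
  transitivity (\tsum_(h, x0 <- rho x) \tsum_(h1, h2 <- Delta h)
     ((a h1 * b h2 : k) *: x0)).
    by apply: eq_tsum => x0 h; rewrite convolE tsum_scalel.
  rewrite -e [X in hitl rho b X]/hitl (lin_tsum _ _ (f := hitl rho b)); last by lin.
  apply: eq_tsum => y h; rewrite (linZ (f := hitl rho b)); last by lin.
  by rewrite /hitl tsum_scaler; apply: eq_tsum => ? ?; rewrite scalerA.
move=> x; rewrite hitl_tsum; last by mlin.
under eq_cs => h d do (rewrite hitl_tsum; last by mlin).
rewrite hitl_tsum; last by mlin.
have := cs_comul (F := fun h1 h2 d => h1 \ox (h2 \ox hitl rho d x)) => ->; try by lin.
by apply: eq_cs => h a; apply: eq_cs => g b; rewrite e1.
Qed.

Lemma bicoactionP X (lam : 'Hom(X, H *t X)) (rho : 'Hom(X, X *t H)) :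
  (forall m, \tsum_(h, m' <- lam m) \tsum_(m0, g <- rho m') h \ox (m0 \ox g)
      = \tsum_(m', g <- rho m) \tsum_(h, m0 <- lam m') h \ox (m0 \ox g)) <->
  (forall a b m, hitr rho a (hitl lam b m) = hitl lam b (hitr rho a m)).
Proof.
split=> e.
  move=> a b m.
  pose G (t : H *t (X *t H)) := \tsum_(h, s <- t) \tsum_(y, g <- s)
    ((b h * a g : k) *: y).
  have lG : lin G by rewrite /G; lin.
  have GE y h g : G (h \ox (y \ox g)) = (b h * a g : k) *: y.
    by rewrite /G !tsumE //; lin.
  have := congr1 G (e m); rewrite !(lin_tsum _ _ lG).
  under eq_tsum => y z do rewrite (lin_tsum _ _ lG).
  under [X in _ = X -> _]eq_tsum => y z do rewrite (lin_tsum _ _ lG).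
  setoid_rewrite GE => {}e.
  rewrite [X in hitr rho a X]/hitl (lin_tsum _ _ (f := hitr rho a)); last by lin.
  rewrite [X in hitl lam b X]/hitr (lin_tsum _ _ (f := hitl lam b)); last by lin.
  transitivity (\tsum_(h, m' <- lam m) \tsum_(m0, g <- rho m') (b h * a g : k) *: m0).
    apply: eq_tsum => h m'; rewrite (linZ (f := hitr rho a)); last by lin.
    by rewrite /hitr tsum_scaler; apply: eq_tsum => ? ?; rewrite scalerA.
  rewrite e; apply: eq_tsum => m' g; rewrite (linZ (f := hitl lam b)); last by lin.
  by rewrite /hitl tsum_scaler; apply: eq_tsum => ? ?; rewrite scalerA mulrC.
move=> m; rewrite hitl_tsum; last by mlin.
under eq_cs => h d do (rewrite hitr_tsum; last by mlin).
rewrite hitr_tsum; last by mlin.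
under [RHS]eq_cs => h d do (rewrite hitl_tsum; last by mlin).
by rewrite csC; apply: eq_cs => h a; apply: eq_cs => g b; rewrite e.
Qed.

End Dictionary.

Notation hit M := (hitr (rco M)).
Notation tih M := (hitl (lco M)).

Section Bicomodules.
Variables (k : fieldType) (H : coquasiHopf k).
Local Notation phi := (reass H).
Local Notation phiV := (reassV H).
Local Notation eps := (counit H).
Let HP : is_coalgebra H := cqb_coalgP H.
Implicit Types (L M N R : bicomodData H) (U V W : vectType k).
Implicit Types T : 'Hom(H *t H *t H, k^o).

Lemma is_bicomodP M : is_bicomod M <->
  [/\ (forall a b m, hit M (a \cv b) m = hit M a (hit M b m)) /\
        (forall m, hit M eps m = m),
      (forall a b m, tih M (a \cv b) m = tih M b (tih M a m)) /\
        (forall m, tih M eps m = m)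
    & forall a b m, hit M a (tih M b m) = tih M b (hit M a m)].
Proof.
by split=> -[e1 e2 e3]; split;
  (exact/left_coactionP || exact/right_coactionP || exact/bicoactionP).
Qed.

Lemma bicomod_homP M N (f : 'Hom(M, N)) : bicomod_hom f <->
  (forall a m, tih N a (f m) = f (tih M a m)) /\
  (forall a m, hit N a (f m) = f (hit M a m)).
Proof.
by split=> -[e1 e2]; split; (exact/hitl_hom || exact/hitr_hom).
Qed.

Lemma btens_hit M N a (m : M) (n : N) :
  hit (btens M N) a (m \ox n) = cop a (fun x y => hit M x m \ox hit N y n).
Proof.
rewrite /hitr /btens /= tliftE tsumE; try by lin.
rewrite tsum_tsum hitr_tsum; last by mlin.
apply: eq_cs => e d; rewrite tsum_tsum hitr_tsum; last by mlin.
by apply: eq_cs => e' d'; rewrite tsumE //; lin.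
Qed.

Lemma btens_tih M N a (m : M) (n : N) :
  tih (btens M N) a (m \ox n) = cop a (fun x y => tih M x m \ox tih N y n).
Proof.
rewrite /hitl /btens /= tliftE tsumE; try by lin.
rewrite tsum_tsum hitl_tsum; last by mlin.
apply: eq_cs => e d; rewrite tsum_tsum hitl_tsum; last by mlin.
by apply: eq_cs => e' d'; rewrite tsumE //; lin.
Qed.

Lemma btens_bicomod M N : is_bicomod M -> is_bicomod N -> is_bicomod (btens M N).
Proof.
move=> /is_bicomodP[[M1 M2] [M3 M4] M5] /is_bicomodP[[N1 N2] [N3 N4] N5].
apply/is_bicomodP; split; first split.
- move=> a b; apply: tens_ext => [||m n]; try by lin.
  rewrite btens_hit copM; last by mlin.
  rewrite btens_hit (cop_lin (f := hit (btens M N) a)); last by lin.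
  under [RHS]eq_cop => x y do rewrite btens_hit.
  by rewrite cop_copC; peel; rewrite M1 N1.
- apply: tens_ext => [||m n]; try by lin.
  by rewrite btens_hit cop1; [rewrite M2 N2 | mlin].
- split.
  + move=> a b; apply: tens_ext => [||m n]; try by lin.
    rewrite btens_tih copM; last by mlin.
    rewrite btens_tih (cop_lin (f := tih (btens M N) b)); last by lin.
    by peel; rewrite btens_tih; peel; rewrite M3 N3.
  + apply: tens_ext => [||m n]; try by lin.
    by rewrite btens_tih cop1; [rewrite M4 N4 | mlin].
- move=> a b; apply: tens_ext => [||m n]; try by lin.
  rewrite btens_tih (cop_lin (f := hit (btens M N) a)); last by lin.
  rewrite btens_hit (cop_lin (f := tih (btens M N) b)); last by lin.
  under eq_cop => x y do rewrite btens_hit.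
  under [RHS]eq_cop => x y do rewrite btens_tih.
  by rewrite cop_copC; peel; rewrite M5 N5.
Qed.

Lemma Phi_tmk L M N (l : L) (m : M) (n : N) :
  Phi L M N (l \ox m \ox n) =
  ctr phi (fun p1 p2 p3 => ctr phiV (fun q1 q2 q3 =>
    hit L q1 (tih L p1 l) \ox (hit M q2 (tih M p2 m) \ox hit N q3 (tih N p3 n)))).
Proof.
rewrite /Phi tliftE tsumE; try by lin.
rewrite tsumE; try by lin.
rewrite hitl_tsum; last by mlin.
rewrite /ctr; do 3 setoid_rewrite cs_scaler.
apply: eq_cs => x p1; rewrite hitr_tsum; last by mlin.
rewrite [RHS]cs_rot; apply: eq_cs => x' q1.
rewrite hitl_tsum; last by mlin.
apply: eq_cs => y p2; rewrite hitr_tsum; last by mlin.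
rewrite [RHS]csC; apply: eq_cs => y' q2.
rewrite hitl_tsum; last by mlin.
apply: eq_cs => z p3; rewrite hitr_tsum; last by mlin.
by apply: eq_cs => z' q3; rewrite scalerA.
Qed.

Lemma PhiV_tmk L M N (l : L) (m : M) (n : N) :
  PhiV L M N (l \ox (m \ox n)) =
  ctr phiV (fun p1 p2 p3 => ctr phi (fun q1 q2 q3 =>
    hit L q1 (tih L p1 l) \ox hit M q2 (tih M p2 m) \ox hit N q3 (tih N p3 n))).
Proof.
rewrite /PhiV tliftE tsumE; try by lin.
rewrite tsumE; try by lin.
rewrite hitl_tsum; last by mlin.
rewrite /ctr; do 3 setoid_rewrite cs_scaler.
apply: eq_cs => x p1; rewrite hitr_tsum; last by mlin.
rewrite [RHS]cs_rot; apply: eq_cs => x' q1.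
rewrite hitl_tsum; last by mlin.
apply: eq_cs => y p2; rewrite hitr_tsum; last by mlin.
rewrite [RHS]csC; apply: eq_cs => y' q2.
rewrite hitl_tsum; last by mlin.
apply: eq_cs => z p3; rewrite hitr_tsum; last by mlin.
by apply: eq_cs => z' q3; rewrite scalerA.
Qed.

Lemma tens_ext3 (X Y Z U : vectType k) (F G : X *t Y *t Z -> U) :
  lin F -> lin G -> (forall x y z, F (x \ox y \ox z) = G (x \ox y \ox z)) -> F =1 G.
Proof.
move=> lF lG e; apply: tens_ext => // t z; move: t.
by apply: (tens_ext (F := fun t => F (t \ox z)) (G := fun t => G (t \ox z))) => [||x y];
  [lin | lin | apply: e].
Qed.

(** The left coaction sees only [phi], the right one only [phi^-1], so colinearity
    is the quasi-coassociativity of the coproduct of the dual on each side. *)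
Lemma Phi_hom L M N : is_bicomod L -> is_bicomod M -> is_bicomod N ->
  bicomod_hom (M := btens (btens L M) N) (N := btens L (btens M N)) (Phi L M N).
Proof.
move=> /is_bicomodP[[L1 _] [L3 _] L5] /is_bicomodP[[M1 _] [M3 _] M5].
move=> /is_bicomodP[[N1 _] [N3 _] N5].
apply/bicomod_homP; split=> a.
- apply: tens_ext3 => [||l m n]; try by lin.
  rewrite Phi_tmk (ctr_lin (f := tih (btens L (btens M N)) a)); last by lin.
  transitivity (ctr phi (fun p1 p2 p3 => copR a (fun x y z => ctr phiV (fun q1 q2 q3 =>
     hit L q1 (tih L (p1 \cv x) l) \ox (hit M q2 (tih M (p2 \cv y) m) \ox
       hit N q3 (tih N (p3 \cv z) n)))))).
    apply: eq_ctr => p1 p2 p3; rewrite (ctr_lin (f := tih (btens L (btens M N)) a)); last by lin.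
    rewrite /copR; under [RHS]eq_cop => x u do rewrite cop_ctrC.
    rewrite [RHS]cop_ctrC; apply: eq_ctr => q1 q2 q3; rewrite btens_tih.
    apply: eq_cop => x u; rewrite btens_tih (cop_lin (f := fun v => _ \ox v)); last by lin.
    by apply: eq_cop => y z; rewrite -L5 -M5 -N5 L3 M3 N3.
  rewrite -(ctr_phi_cop a (B := fun p1 p2 p3 => ctr phiV (fun q1 q2 q3 =>
     hit L q1 (tih L p1 l) \ox (hit M q2 (tih M p2 m) \ox hit N q3 (tih N p3 n)))));
    last by mlin.
  rewrite btens_tih (cop_lin (f := Phi L M N)); last by lin.
  apply: eq_cop => u z; rewrite btens_tih.
  rewrite (cop_lin (f := fun v => Phi L M N (v \ox _))); last by lin.
  apply: eq_cop => x y; rewrite Phi_tmk; peel.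
  by rewrite L3 M3 N3.
- apply: tens_ext3 => [||l m n]; try by lin.
  rewrite btens_hit (cop_lin (f := Phi L M N)); last by lin.
  transitivity (ctr phi (fun p1 p2 p3 => ctr phiV (fun q1 q2 q3 => copL a (fun x y z =>
     hit L (q1 \cv x) (tih L p1 l) \ox (hit M (q2 \cv y) (tih M p2 m) \ox
       hit N (q3 \cv z) (tih N p3 n)))))); last first.
    rewrite /copL; under [LHS]eq_ctr => p1 p2 p3 do rewrite -cop_ctrC.
    rewrite -cop_ctrC; apply: eq_cop => u z; rewrite btens_hit.
    rewrite (cop_lin (f := fun v => Phi L M N (v \ox _))); last by lin.
    under [LHS]eq_ctr => p1 p2 p3 do rewrite -cop_ctrC.
    rewrite -cop_ctrC; apply: eq_cop => x y; rewrite Phi_tmk; peel.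
    by rewrite L1 M1 N1 L5 M5 N5.
  rewrite Phi_tmk (ctr_lin (f := hit (btens L (btens M N)) a)); last by lin.
  apply: eq_ctr => p1 p2 p3.
  rewrite (ctr_phiV_cop a (B := fun q1 q2 q3 => hit L q1 (tih L p1 l) \ox
     (hit M q2 (tih M p2 m) \ox hit N q3 (tih N p3 n)))); last by mlin.
  rewrite (ctr_lin (f := hit (btens L (btens M N)) a)); last by lin.
  rewrite /copR; under [RHS]eq_cop => x u do rewrite cop_ctrC.
  rewrite [RHS]cop_ctrC; apply: eq_ctr => q1 q2 q3; rewrite btens_hit.
  apply: eq_cop => x u; rewrite btens_hit (cop_lin (f := fun v => _ \ox v)); last by lin.
  by apply: eq_cop => y z; rewrite L1 M1 N1.
Qed.

End Bicomodules.

(** * Naturality and pentagon of the associativity constraint *)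

Section Associator.
Variables (k : fieldType) (H : coquasiHopf k).
Local Notation A := ('Hom(H, k^o)).
Local Notation phi := (reass H).
Local Notation phiV := (reassV H).
Let HP : is_coalgebra H := cqb_coalgP H.
Implicit Types (L M N R : bicomodData H) (U V W : vectType k).
Implicit Types T : 'Hom(H *t H *t H, k^o).

Lemma ctr_lDlC U T T' (F : A -> A -> A -> A -> A -> A -> A -> U) :
  ctr T (fun x y z => ctr_lDl T' (F x y z)) =
  ctr_lDl T' (fun x' y' z' w' => ctr T (fun x y z => F x y z x' y' z' w')).
Proof.
by rewrite /ctr_lDl ctr_ctrC; apply: eq_ctr => x' u w'; rewrite cop_ctrC.
Qed.

Lemma Dll_llDC U T T' (F : A -> A -> A -> A -> A -> A -> A -> A -> U) :
  ctr_Dll T (fun x y z w => ctr_llD T' (F x y z w)) =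
  ctr_llD T' (fun x' y' z' w' => ctr_Dll T (fun x y z w => F x y z w x' y' z' w')).
Proof.
rewrite /ctr_Dll /ctr_llD.
under eq_ctr => u z w do rewrite cop_ctrC.
rewrite ctr_ctrC; apply: eq_ctr => x' y' v; rewrite cop_ctrC.
by apply: eq_ctr => u z w; rewrite cop_copC.
Qed.

Lemma tmap_tmk V W V' W' (f : 'Hom(V, V')) (g : 'Hom(W, W')) v w :
  tmap f g (v \ox w) = f v \ox g w.
Proof. by rewrite /tmap tliftE tsumE //; lin. Qed.

Lemma tmap_hom M N M' N' (f : 'Hom(M, M')) (g : 'Hom(N, N')) :
  bicomod_hom f -> bicomod_hom g ->
  bicomod_hom (M := btens M N) (N := btens M' N') (tmap f g).
Proof.
move=> /bicomod_homP[f1 f2] /bicomod_homP[g1 g2].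
apply/bicomod_homP; split=> a; apply: tens_ext => [||m n]; try by lin.
- rewrite tmap_tmk !btens_tih (cop_lin (f := tmap f g)); last by lin.
  by peel; rewrite tmap_tmk f1 g1.
- rewrite tmap_tmk !btens_hit (cop_lin (f := tmap f g)); last by lin.
  by peel; rewrite tmap_tmk f2 g2.
Qed.

Lemma id_bicomod_hom M : bicomod_hom (M := M) (N := M) \1%VF.
Proof. by apply/bicomod_homP; split=> a m; rewrite !id_lfunE. Qed.

Lemma Phi_natural L M N L' M' N' (f : 'Hom(L, L')) (g : 'Hom(M, M'))
    (h : 'Hom(N, N')) : bicomod_hom f -> bicomod_hom g -> bicomod_hom h ->
  forall t, Phi L' M' N' (tmap (tmap f g) h t) = tmap f (tmap g h) (Phi L M N t).
Proof.
move=> /bicomod_homP[f1 f2] /bicomod_homP[g1 g2] /bicomod_homP[h1 h2].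
apply: tens_ext3 => [||l m n]; try by lin.
rewrite !tmap_tmk !Phi_tmk (ctr_lin (f := tmap f (tmap g h))); last by lin.
apply: eq_ctr => p1 p2 p3; rewrite (ctr_lin (f := tmap f (tmap g h))); last by lin.
by apply: eq_ctr => q1 q2 q3; rewrite !tmap_tmk f1 g1 h1 f2 g2 h2.
Qed.

(** Both sides are contractions of two independent families of factors: those
    acting from the left coactions agree by [pentagon] for [phi], and those
    acting from the right coactions by [pentagonV] for [phi^-1]. *)
Lemma Phi_pentagon L M N R l m n r :
  is_bicomod L -> is_bicomod M -> is_bicomod N -> is_bicomod R ->
  Phi L M (btens N R) (Phi (btens L M) N R (l \ox m \ox n \ox r)) =
  tmap \1 (Phi M N R) (Phi L (btens M N) R (Phi L M N (l \ox m \ox n) \ox r)).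
Proof.
move=> /is_bicomodP[[L1 _] [L3 _] L5] /is_bicomodP[[M1 _] [M3 _] M5].
move=> /is_bicomodP[[N1 _] [N3 _] N5] /is_bicomodP[[R1 _] [R3 _] R5].
(* [hL a b] is [l] acted on by [a] through the left coaction and by [b] through
   the right one; all terms are contractions of these four families. *)
pose hL a b := hit L b (tih L a l); pose hM a b := hit M b (tih M a m).
pose hN a b := hit N b (tih N a n); pose hR a b := hit R b (tih R a r).
have hLE a b c d : hit L d (tih L c (hL a b)) = hL (a \cv c) (d \cv b).
  by rewrite /hL L1 L3 -L5.
have hME a b c d : hit M d (tih M c (hM a b)) = hM (a \cv c) (d \cv b).
  by rewrite /hM M1 M3 -M5.
have hNE a b c d : hit N d (tih N c (hN a b)) = hN (a \cv c) (d \cv b).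
  by rewrite /hN N1 N3 -N5.
have hRE a b c d : hit R d (tih R c (hR a b)) = hR (a \cv c) (d \cv b).
  by rewrite /hR R1 R3 -R5.
have [lL lM lN lR] : [/\ lin2 hL, lin2 hM, lin2 hN & lin2 hR].
  by rewrite /hL /hM /hN /hR; split; mlin.
have eLM x1 x2 y1 y2 u u' : hit (btens L M) u' (tih (btens L M) u (hL x1 x2 \ox hM y1 y2))
   = cop u (fun x y => cop u' (fun x' y' =>
       hL (x1 \cv x) (x' \cv x2) \ox hM (y1 \cv y) (y' \cv y2))).
  rewrite btens_tih (cop_lin (f := hit (btens L M) u')); last by lin.
  by apply: eq_cop => x y; rewrite btens_hit; peel; rewrite hLE hME.
have eMN x1 x2 y1 y2 u u' : hit (btens M N) u' (tih (btens M N) u (hM x1 x2 \ox hN y1 y2))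
   = cop u (fun x y => cop u' (fun x' y' =>
       hM (x1 \cv x) (x' \cv x2) \ox hN (y1 \cv y) (y' \cv y2))).
  rewrite btens_tih (cop_lin (f := hit (btens M N) u')); last by lin.
  by apply: eq_cop => x y; rewrite btens_hit; peel; rewrite hME hNE.
have eNR x1 x2 y1 y2 u u' : hit (btens N R) u' (tih (btens N R) u (hN x1 x2 \ox hR y1 y2))
   = cop u (fun x y => cop u' (fun x' y' =>
       hN (x1 \cv x) (x' \cv x2) \ox hR (y1 \cv y) (y' \cv y2))).
  rewrite btens_tih (cop_lin (f := hit (btens N R) u')); last by lin.
  by apply: eq_cop => x y; rewrite btens_hit; peel; rewrite hNE hRE.
have E1 : Phi (btens L M) N R (l \ox m \ox n \ox r) =
    ctr_Dll phi (fun x y z w => ctr_Dll phiV (fun x' y' z' w' =>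
      (hL x x' \ox hM y y') \ox (hN z z' \ox hR w w'))).
  rewrite Phi_tmk; apply: eq_ctr => u z w; rewrite /ctr_Dll cop_ctrC.
  apply: eq_ctr => u' z' w'; rewrite btens_tih.
  rewrite (cop_lin (f := fun v => hit (btens L M) u' v \ox _)); last by lin.
  apply: eq_cop => x y; rewrite btens_hit.
  by rewrite (cop_lin (f := fun v => v \ox _)) //; lin.
have F1 : Phi L M N (l \ox m \ox n) =
    ctr phi (fun x y z => ctr phiV (fun x' y' z' =>
      hL x x' \ox (hM y y' \ox hN z z'))) by rewrite Phi_tmk.
have rE a b : hit R b (tih R a r) = hR a b by [].
clearbody hL hM hN hR.
have E2 x x' y y' z z' w w' :
    Phi L M (btens N R) (hL x x' \ox hM y y' \ox (hN z z' \ox hR w w')) =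
    ctr_llD phi (fun x1 y1 z1 w1 => ctr_llD phiV (fun x2 y2 z2 w2 =>
      hL (x \cv x1) (x2 \cv x') \ox (hM (y \cv y1) (y2 \cv y') \ox
       (hN (z \cv z1) (z2 \cv z') \ox hR (w \cv w1) (w2 \cv w'))))).
  rewrite Phi_tmk; apply: eq_ctr => x1 y1 u; rewrite /ctr_llD cop_ctrC.
  apply: eq_ctr => x2 y2 u'; rewrite eNR hLE hME.
  rewrite (cop_lin (f := fun v => _ \ox (_ \ox v))); last by lin.
  by apply: eq_cop => z1 w1; rewrite (cop_lin (f := fun v => _ \ox (_ \ox v))) //; lin.
have F2 x x' y y' z z' :
    Phi L (btens M N) R (hL x x' \ox (hM y y' \ox hN z z') \ox r) =
    ctr_lDl phi (fun x1 y1 z1 w1 => ctr_lDl phiV (fun x2 y2 z2 w2 =>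
      hL (x \cv x1) (x2 \cv x') \ox ((hM (y \cv y1) (y2 \cv y') \ox
       hN (z \cv z1) (z2 \cv z')) \ox hR w1 w2))).
  rewrite Phi_tmk; apply: eq_ctr => x1 u w1; rewrite /ctr_lDl cop_ctrC.
  apply: eq_ctr => x2 u' w2; rewrite eMN hLE rE.
  rewrite (cop_lin (f := fun v => _ \ox (v \ox _))); last by lin.
  by apply: eq_cop => y1 z1; rewrite (cop_lin (f := fun v => _ \ox (v \ox _))) //; lin.
have F3 y y' z z' w w' : Phi M N R (hM y y' \ox hN z z' \ox hR w w') =
    ctr phi (fun y1 z1 w1 => ctr phiV (fun y2 z2 w2 =>
      hM (y \cv y1) (y2 \cv y') \ox (hN (z \cv z1) (z2 \cv z') \ox
        hR (w \cv w1) (w2 \cv w')))).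
  by rewrite Phi_tmk; do 2 apply: eq_ctr => ? ? ?; rewrite hME hNE hRE.
transitivity (ctr_Dll phi (fun x y z w => ctr_llD phi (fun x1 y1 z1 w1 =>
   ctr_llD phiV (fun x2 y2 z2 w2 => ctr_Dll phiV (fun x' y' z' w' =>
      hL (x \cv x1) (x2 \cv x') \ox (hM (y \cv y1) (y2 \cv y') \ox
       (hN (z \cv z1) (z2 \cv z') \ox hR (w \cv w1) (w2 \cv w')))))))).
  rewrite E1 /ctr_Dll (ctr_lin (f := Phi L M (btens N R))); last by lin.
  apply: eq_ctr => u z w; rewrite (cop_lin (f := Phi L M (btens N R))); last by lin.
  apply: eq_cop => x y; rewrite -/(ctr_Dll _ _).
  under [RHS]eq_llD => x1 y1 z1 w1 do rewrite -Dll_llDC.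
  rewrite -[RHS]Dll_llDC /ctr_Dll (ctr_lin (f := Phi L M (btens N R))); last by lin.
  apply: eq_ctr => u' z' w'; rewrite (cop_lin (f := Phi L M (btens N R))); last by lin.
  by apply: eq_cop => x' y'; rewrite E2.
transitivity (ctr phi (fun x y z => ctr_lDl phi (fun x1 y1 z1 w1 =>
   ctr phi (fun y2 z2 w2 => ctr phiV (fun y' z' w' => ctr_lDl phiV (fun x'1 y'1 z'1 w'1 =>
   ctr phiV (fun x'2 y'2 z'2 => 
      hL (x \cv x1) (x'1 \cv x'2) \ox (hM (y \cv y1 \cv y2) (y' \cv y'1 \cv y'2) \ox
       (hN (z \cv z1 \cv z2) (z' \cv z'1 \cv z'2) \ox hR (w1 \cv w2) (w' \cv w'1)))))))))).
  rewrite -(pentagon (B := fun p q r t => ctr phiV (fun y' z' w' =>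
    ctr_lDl phiV (fun x'1 y'1 z'1 w'1 => ctr phiV (fun x'2 y'2 z'2 =>
      hL p (x'1 \cv x'2) \ox (hM q (y' \cv y'1 \cv y'2) \ox
       (hN r (z' \cv z'1 \cv z'2) \ox hR t (w' \cv w'1)))))))); last by mlin.
  apply: eq_Dll => x y z w; apply: eq_llD => x1 y1 z1 w1.
  by rewrite (pentagonV (B := fun p q r t => hL (x \cv x1) p \ox
    (hM (y \cv y1) q \ox (hN (z \cv z1) r \ox hR (w \cv w1) t)))) //; mlin.
rewrite F1 (ctr_lin (f := fun v => tmap \1 (Phi M N R) (Phi L (btens M N) R (v \ox r))));
  last by lin.
apply: eq_ctr => x y z.
transitivity (ctr phiV (fun x'2 y'2 z'2 => ctr_lDl phi (fun x1 y1 z1 w1 =>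
   ctr_lDl phiV (fun x'1 y'1 z'1 w'1 => ctr phi (fun y2 z2 w2 => ctr phiV (fun y' z' w' =>
      hL (x \cv x1) (x'1 \cv x'2) \ox (hM (y \cv y1 \cv y2) (y' \cv (y'1 \cv y'2)) \ox
       (hN (z \cv z1 \cv z2) (z' \cv (z'1 \cv z'2)) \ox hR (w1 \cv w2) (w' \cv w'1)))))))));
  last first.
  rewrite (ctr_lin (f := fun v => tmap \1 (Phi M N R) (Phi L (btens M N) R (v \ox r))));
    last by lin.
  apply: eq_ctr => x'2 y'2 z'2; rewrite F2 /ctr_lDl.
  rewrite (ctr_lin (f := tmap \1 (Phi M N R))); last by lin.
  apply: eq_ctr => x1 u w1; rewrite (cop_lin (f := tmap \1 (Phi M N R))); last by lin.
  apply: eq_cop => y1 z1; rewrite (ctr_lin (f := tmap \1 (Phi M N R))); last by lin.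
  apply: eq_ctr => x'1 u' w'1; rewrite (cop_lin (f := tmap \1 (Phi M N R))); last by lin.
  apply: eq_cop => y'1 z'1; rewrite tmap_tmk id_lfunE F3.
  rewrite (ctr_lin (f := fun v => _ \ox v)); last by lin.
  by apply: eq_ctr => y2 z2 w2; rewrite (ctr_lin (f := fun v => _ \ox v)) //; lin.
rewrite [RHS]ctr_lDlC; apply: eq_lDl => x1 y1 z1 w1.
rewrite [RHS]ctr_lDlC.
under [RHS]eq_lDl => x'1 y'1 z'1 w'1 do rewrite ctr_ctrC.
rewrite -[RHS]ctr_lDlC; apply: eq_ctr => y2 z2 w2.
under [RHS]eq_lDl => x'1 y'1 z'1 w'1 do rewrite ctr_ctrC.
rewrite -[RHS]ctr_lDlC; peel.
by rewrite !convolA.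
Qed.
End Associator.

(** * Free Hopf modules *)

Section Regular.
Variables (k : fieldType) (H : coquasiHopf k).
Local Notation A := ('Hom(H, k^o)).
Local Notation one := (unitC H 1).
Local Notation phi := (reass H).
Local Notation phiV := (reassV H).
Local Notation HH := (regular_bicomod H).
Local Notation p := (Defs.mulC H).
Local Notation "x ** y" := (Defs.mulC H (x \ox y)) (at level 40, left associativity).
Let HP : is_coalgebra H := cqb_coalgP H.

Lemma fun_hit (f a : A) (x : H) : f (hit HH a x) = (f \cv a) x.
Proof.
rewrite convolE /hitr tsum_hom; apply: eq_tsum => x1 x2.
by rewrite linearZ; apply: mulrC.
Qed.

Lemma fun_tih (f a : A) (x : H) : f (tih HH a x) = (a \cv f) x.
Proof.
rewrite convolE /hitl tsum_hom; apply: eq_tsum => x1 x2.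
by rewrite linearZ.
Qed.

Lemma regular_is_bicomod : is_bicomod HH.
Proof.
apply/is_bicomodP; split=> [||a b x]; [split=> [a b|] x | split=> [a b|] x |];
  apply: fun_separate => f.
- by rewrite !fun_hit convolA.
- by rewrite fun_hit convolr1.
- by rewrite !fun_tih convolA.
- by rewrite fun_tih convol1.
- by rewrite fun_hit fun_tih [RHS]fun_tih fun_hit convolA.
Qed.

Lemma mul_hom : bicomod_hom (M := btens HH HH) (N := HH) p.
Proof.
apply/bicomod_homP; split=> a; apply: tens_ext => [||x y]; try by lin.
- rewrite btens_tih (cop_lin (f := p)); last by lin.
  rewrite {1}/hitl comul_mul; last by mlin.
  rewrite (hitl_tsum (comul H)); last by mlin.
  apply: eq_cs => e d; rewrite (hitl_tsum (comul H)); last by mlin.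
  by [].
- rewrite btens_hit (cop_lin (f := p)); last by lin.
  rewrite {1}/hitr comul_mul; last by mlin.
  rewrite (hitr_tsum (comul H)); last by mlin.
  apply: eq_cs => e d; rewrite (hitr_tsum (comul H)); last by mlin.
  by [].
Qed.

Lemma copL_eval (f : A) (x y z : H) :
  copL f (fun a b c => a x * b y * c z : k^o) = f (x ** y ** z).
Proof.
rewrite -copLE; last by mlin.
rewrite -(cs_vec3 x y z (F := fun x y z => f (x ** y ** z))); last by mlin.
by do 3 apply: eq_cs => ? ?; apply: mulrC.
Qed.

Lemma copR_eval (f : A) (x y z : H) :
  copR f (fun a b c => a x * b y * c z : k^o) = f (x ** (y ** z)).
Proof.
rewrite -copRE; last by mlin.
rewrite -(cs_vec3 x y z (F := fun x y z => f (x ** (y ** z)))); last by mlin.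
by do 3 apply: eq_cs => ? ?; apply: mulrC.
Qed.

(** Quasi-associativity moves the [phi] of [Phi] across the product, next to
    [phi^-1], which cancels it. *)
Lemma mul_assoc (x y z : H) :
  x ** y ** z = p (tmap \1 p (Phi HH HH HH (x \ox y \ox z))).
Proof.
apply: fun_separate => f; rewrite Phi_tmk -copL_eval.
rewrite (ctr_lin (f := fun v => f (p (tmap \1 p v)))); last by lin.
transitivity (ctr phi (fun p1 p2 p3 => copR f (fun r1 r2 r3 => ctr phiV (fun q1 q2 q3 =>
    (p1 \cv r1 \cv q1) x * (p2 \cv r2 \cv q2) y * (p3 \cv r3 \cv q3) z : k^o)))).
  rewrite -(ctr_phi_cop f (B := fun a b c => ctr phiV (fun q1 q2 q3 =>
    (a \cv q1) x * (b \cv q2) y * (c \cv q3) z : k^o))); last by mlin.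
  apply: eq_copL => r1 r2 r3.
  transitivity (ctr phi (fun p1 p2 p3 => ctr phiV (fun q1 q2 q3 =>
    (r1 \cv (p1 \cv q1)) x * (r2 \cv (p2 \cv q2)) y * (r3 \cv (p3 \cv q3)) z : k^o)));
    last by peel; rewrite !convolA.
  rewrite (ctr_phiK (B := fun a b c => (r1 \cv a) x * (r2 \cv b) y * (r3 \cv c) z : k^o));
    last by mlin.
  by rewrite !convolr1.
apply: eq_ctr => p1 p2 p3; rewrite /copR.
under eq_cop => a v do rewrite cop_ctrC.
rewrite cop_ctrC (ctr_lin (f := fun v => f (p (tmap \1 p v)))); last by lin.
apply: eq_ctr => q1 q2 q3; rewrite tmap_tmk id_lfunE -copR_eval.
by do 2 apply: eq_cop => ? ?; rewrite !(fun_hit, fun_tih) !convolA.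
Qed.

Lemma tih_one a : tih HH a one = (a one : k) *: one.
Proof. by rewrite /hitl /= comul_one tsumE //; lin. Qed.

Lemma hit_one a : hit HH a one = (a one : k) *: one.
Proof. by rewrite /hitr /= comul_one tsumE //; lin. Qed.

Lemma tmap_comp (V W V' W' V'' W'' : vectType k) (f : 'Hom(V, V')) (g : 'Hom(W, W'))
  (f' : 'Hom(V', V'')) (g' : 'Hom(W', W'')) t :
  tmap f' g' (tmap f g t) = tmap (f' \o f)%VF (g' \o g)%VF t.
Proof.
move: t; apply: tens_ext => [||v w]; try by lin.
by rewrite !tmap_tmk !comp_lfunE.
Qed.

Lemma tmap_id (V W : vectType k) (t : V *t W) : tmap \1 \1 t = t.
Proof.
move: t; apply: tens_ext => [||v w]; try by lin.
by rewrite tmap_tmk !id_lfunE.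
Qed.

Lemma tmap11 (V W : vectType k) : tmap \1 \1 = \1%VF :> 'End(V *t W).
Proof. by apply/lfunP=> t; rewrite tmap_id id_lfunE. Qed.

Lemma comp_bicomod_hom (L M N : bicomodData H) (f : 'Hom(M, N)) (g : 'Hom(L, M)) :
  bicomod_hom f -> bicomod_hom g -> bicomod_hom (M := L) (N := N) (f \o g)%VF.
Proof.
move=> /bicomod_homP[f1 f2] /bicomod_homP[g1 g2].
by apply/bicomod_homP; split=> a t; rewrite !comp_lfunE /= ?f1 ?g1 ?f2 ?g2.
Qed.

End Regular.

Section FreeModules.
Variables (k : fieldType) (H : coquasiHopf k).
Local Notation one := (unitC H 1).
Local Notation phi := (reass H).
Local Notation phiV := (reassV H).
Local Notation eps := (counit H).
Local Notation HH := (regular_bicomod H).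
Local Notation p := (Defs.mulC H).
Local Notation "x ** y" := (Defs.mulC H (x \ox y)) (at level 40, left associativity).
Let HP : is_coalgebra H := cqb_coalgP H.

Section Free.
Variable X : bicomodData H.
Hypothesis XP : is_bicomod X.
Local Notation XH := (btens X HH).

Lemma free_hactE t : hact (free_hopfmod X) t = tmap \1 p (Phi X HH HH t).
Proof. exact: comp_lfunE. Qed.

(** By naturality of [Phi], this is the pentagon for [X, H, H, H] followed by
    [mul_assoc]. *)
Lemma free_act_assoc t : tmap \1 p (Phi X HH HH (tmap \1 p (Phi XH HH HH t))) =
  tmap \1 p (Phi X HH HH (tmap (hact (free_hopfmod X)) \1 t)).
Proof.
have bH := regular_is_bicomod H.
have hI (M : bicomodData H) := id_bicomod_hom M; have hm := mul_hom H.
move: t; apply: tens_ext => [||t z]; try by lin.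
rewrite tmap_tmk id_lfunE free_hactE.
move: t; apply: tens_ext3 => [||w x y]; try by lin.
have := Phi_natural (hI X) (hI HH) hm (Phi XH HH HH (w \ox x \ox y \ox z)).
rewrite tmap11 => ->; rewrite Phi_pentagon //.
have := Phi_natural (hI X) hm (hI HH) (Phi X HH HH (w \ox x \ox y) \ox z).
rewrite tmap_tmk id_lfunE => ->.
rewrite !tmap_comp !comp_lfun1l.
congr (tmap _ _ _).
apply/lfunP=> v; rewrite [LHS]comp_lfunE [RHS]comp_lfunE /comp; move: v.
apply: tens_ext3 => [||a b c]; try by lin.
by rewrite comp_lfunE tmap_tmk id_lfunE mul_assoc.
Qed.

Lemma free_act_one (t : XH) : tmap \1 p (Phi X HH HH (t \ox one)) = t.
Proof.
have /is_bicomodP[[_ X1] [_ X2] _] := XP.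
have /is_bicomodP[[_ H1] [_ H2] _] := regular_is_bicomod H.
move: t; apply: tens_ext => [||w x]; try by lin.
rewrite Phi_tmk (ctr_lin (f := tmap \1 p)); last by lin.
transitivity (ctr phi (fun p1 p2 p3 => (p3 one : k) *: ctr phiV (fun q1 q2 q3 =>
    (q3 one : k) *: (hit X q1 (tih X p1 w) \ox hit HH q2 (tih HH p2 x))))).
  apply: eq_ctr => p1 p2 p3; rewrite -ctr_Z (ctr_lin (f := tmap \1 p)); last by lin.
  apply: eq_ctr => q1 q2 q3; rewrite tmap_tmk id_lfunE tih_one.
  rewrite (linZ (f := fun v => _ \ox (_ ** hit HH q3 v))); last by lin.
  rewrite hit_one (linZ (f := fun v => _ \ox (_ ** v))); last by lin.
  by have [_ ->] := @mulC_unital _ H (hit HH q2 (tih HH p2 x)).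
rewrite (phi_counit_right (F := fun p1 p2 => ctr phiV (fun q1 q2 q3 =>
    (q3 one : k) *: (hit X q1 (tih X p1 w) \ox hit HH q2 (tih HH p2 x)))));
  last by mlin.
rewrite (phiV_counit_right (F := fun q1 q2 =>
  hit X q1 (tih X eps w) \ox hit HH q2 (tih HH eps x))); last by mlin.
by rewrite X1 X2 H1 H2.
Qed.

Lemma free_is_hopfmod : is_hopfmod (free_hopfmod X).
Proof.
have bH := regular_is_bicomod H.
split.
- exact: btens_bicomod.
- apply: (comp_bicomod_hom (M := btens X (btens HH HH))); last exact: Phi_hom.
  by apply: tmap_hom; [apply: id_bicomod_hom | apply: mul_hom].
- move=> t x y; rewrite comp_lfunE /comp [RHS]free_hactE free_act_assoc.
  by rewrite tmap_tmk id_lfunE free_hactE.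
- by move=> t; rewrite free_hactE free_act_one.
Qed.

End Free.
End FreeModules.

(** * The Hopf module structure of the dual *)

Section Dual.
Variables (k : fieldType) (H : coquasiHopf k).
Local Notation A := ('Hom(H, k^o)).
Local Notation one := (unitC H 1).
Local Notation phi := (reass H).
Local Notation phiV := (reassV H).
Local Notation Delta := (comul H).
Local Notation HH := (regular_bicomod H).
Local Notation DH := (dualH H).
Local Notation p := (Defs.mulC H).
Local Notation S := (antip H).
Local Notation Sbar := (S^-1)%VF.
Local Notation alpha := (antip_alpha H).
Local Notation beta := (antip_beta H).
Local Notation s := (fun a : A => (a \o S)%VF).
Local Notation sb := (fun a : A => (a \o Sbar)%VF).
Let HP : is_coalgebra H := cqb_coalgP H.

Lemma cs_ctrC (V U : vectType k) T (F : V -> 'Hom(V, k^o) -> A -> A -> A -> U) :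
  cs (fun e d => ctr (H := H) T (F e d)) = ctr T (fun x y z => cs (fun e d => F e d x y z)).
Proof.
rewrite /ctr csC; do 2 (apply: eq_cs => ? ?; rewrite csC).
by apply: eq_cs => ? ?; rewrite cs_scaler.
Qed.

(** On the dual, the coactions are twisted by the antipode, so the dual algebra
    acts on itself by multiplication through [s] and [sb]. *)
Lemma hit_dual a (f : A) : hit DH a f = f \cv s a.
Proof.
rewrite /hitr /= lin_linfunE; last by lin.
rewrite -[RHS]fun_dualv.
rewrite -[X in tsum X _]/(cs (fun e d => \tsum_(m0, h <- Delta e) (f m0 : k) *: ((d : DH) \ox S h))).
rewrite (cs_lin (f := fun t : DH *t H => \tsum_(x0, h <- t) (a h : k) *: x0)); last by lin.
apply: eq_cs => e d; rewrite tsum_tsum convolE tsum_scalel.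
apply: eq_tsum => x y.
rewrite (linZ (f := fun t : DH *t H => \tsum_(x0, h <- t) (a h : k) *: x0)); last by lin.
by rewrite tsumE; [rewrite scalerA comp_lfunE | lin | lin].
Qed.

Lemma tih_dual a (f : A) : tih DH a f = sb a \cv f.
Proof.
rewrite /hitl /= lin_linfunE; last by lin.
rewrite -[RHS]fun_dualv.
rewrite -[X in tsum X _]/(cs (fun e d => \tsum_(h, m0 <- Delta e) (f m0 : k) *: (Sbar h \ox (d : DH)))).
rewrite (cs_lin (f := fun t : H *t DH => \tsum_(h, x0 <- t) (a h : k) *: x0)); last by lin.
apply: eq_cs => e d; rewrite tsum_tsum convolE tsum_scalel.
apply: eq_tsum => x y.
rewrite (linZ (f := fun t : H *t DH => \tsum_(h, x0 <- t) (a h : k) *: x0)); last by lin.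
by rewrite tsumE; [rewrite scalerA comp_lfunE mulrC | lin | lin].
Qed.

Lemma dual_is_bicomod : is_bicomod DH.
Proof.
apply/is_bicomodP; split=> [||a b x]; [split=> [a b|] x | split=> [a b|] x |].
- by rewrite !hit_dual sM convolA.
- by rewrite hit_dual s1 convolr1.
- by rewrite !tih_dual sbM convolA.
- by rewrite tih_dual sb1 convol1.
- by rewrite !hit_dual !tih_dual convolA.
Qed.

Lemma evl_tmk (f : A) (x : H) :
  evl HH ((f : DH) \ox x) = (sb beta \cv f \cv alpha) x.
Proof.
rewrite /evl tliftE tsumE; try by lin.
by rewrite conv3E; apply: eq_tsum => h1 t; apply: eq_tsum => h2 h3; rewrite comp_lfunE.
Qed.

Lemma evl_hit a (t : DH *t HH) :
  evl HH (hit (btens DH HH) a t) = (a one * evl HH t : k^o).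
Proof.
move: t; apply: tens_ext => [||f x]; try by lin.
rewrite btens_hit (cop_lin (f := evl HH)); last by lin.
transitivity ((a one : k) *: (sb beta \cv f \cv alpha) x); last by rewrite evl_tmk.
rewrite -(dr_alphaK (drinfeld_dual H) (F := fun v : A => (sb beta \cv f \cv v) x)); last by lin.
by apply: eq_cop => u v; rewrite evl_tmk hit_dual fun_hit !convolA.
Qed.

Lemma evl_tih a (t : DH *t HH) :
  evl HH (tih (btens DH HH) a t) = (a one * evl HH t : k^o).
Proof.
move: t; apply: tens_ext => [||f x]; try by lin.
rewrite btens_tih (cop_lin (f := evl HH)); last by lin.
transitivity ((a one : k) *: (sb beta \cv f \cv alpha) x); last by rewrite evl_tmk.
rewrite -(dr_alphaK (drinfeld_op H) (F := fun v : A => (v \cv f \cv alpha) x)); last by lin.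
by apply: eq_cop => u v; rewrite evl_tmk tih_dual fun_tih !convolA.
Qed.

Local Notation DHH := (btens DH HH).

Let DHHb : is_bicomod DHH := btens_bicomod dual_is_bicomod (regular_is_bicomod H).

(** The form [(f (x) x) (x) y |-> ev (f (x) x y)] and its adjoint [act_fun]: the
    action on the dual is the colinear map that corresponds to it. *)
Definition act_form : 'Hom(btens DHH HH, k^o) :=
  (evl HH \o tmap \1 p \o Phi DH HH HH)%VF.

Lemma act_formE t : act_form t = evl HH (tmap \1 p (Phi DH HH HH t)).
Proof. by rewrite /act_form !comp_lfunE. Qed.

Lemma act_form_hit a t : act_form (hit (btens DHH HH) a t) = (a one * act_form t : k^o).
Proof.
have /bicomod_homP[_ e1] := Phi_hom dual_is_bicomod (regular_is_bicomod H) (regular_is_bicomod H).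
have /bicomod_homP[_ e2] := tmap_hom (id_bicomod_hom DH) (mul_hom H).
by rewrite !act_formE -e1 -e2 evl_hit.
Qed.

Lemma act_form_tih a t : act_form (tih (btens DHH HH) a t) = (a one * act_form t : k^o).
Proof.
have /bicomod_homP[e1 _] := Phi_hom dual_is_bicomod (regular_is_bicomod H) (regular_is_bicomod H).
have /bicomod_homP[e2 _] := tmap_hom (id_bicomod_hom DH) (mul_hom H).
by rewrite !act_formE -e1 -e2 evl_tih.
Qed.

Definition act_fun (t : DHH) : A := linfun (fun y : H => act_form (t \ox y)).

Lemma act_funE t y : act_fun t y = act_form (t \ox y).
Proof. by rewrite /act_fun lin_linfunE //; lin. Qed.

Lemma act_fun_lin : lin act_fun.
Proof. by apply: lin_ext => y a u v; rewrite !act_funE tmk_linearl linearP. Qed.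

Lemma act_fun_hit a t :
  cop a (fun x y => act_fun (hit DHH x t) \cv y) = (a one : k) *: act_fun t.
Proof.
apply/lfunP=> h; rewrite (cop_lin (f := fun u : A => u h)); last by lin.
rewrite scale_lfunE act_funE -[RHS]act_form_hit btens_hit.
rewrite (cop_lin (f := act_form)); last by lin.
by apply: eq_cop => x y; rewrite -fun_hit act_funE.
Qed.

Lemma act_fun_tih a t :
  cop a (fun x y => y \cv act_fun (tih DHH x t)) = (a one : k) *: act_fun t.
Proof.
apply/lfunP=> h; rewrite (cop_lin (f := fun u : A => u h)); last by lin.
rewrite scale_lfunE act_funE -[RHS]act_form_tih btens_tih.
rewrite (cop_lin (f := act_form)); last by lin.
by apply: eq_cop => x y; rewrite -fun_tih act_funE.
Qed.

Local Notation cv := (@convol k H).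
Local Notation cvop := (fun a b : A => b \cv a).

(** [act_fun] made colinear for the right coactions only; the left ones are
    treated next, in [dual_actE]. *)
Definition act_r : DHH -> A := sharp cv s beta phi (hit DHH) act_fun.

Lemma act_r_lin : lin act_r.
Proof.
apply: (sharp_lin (drinfeld_dual H)); last exact: act_fun_lin.
by mlin.
Qed.

Lemma coevlE : coevl HH =
  cs (fun (e : HH) d => hit HH beta (tih HH (sb alpha) e) \ox (d : DH)).
Proof.
rewrite /coevl /cs; apply: eq_bigr => i _.
move: (_`_i) (dualv i) => e d.
rewrite (hitl_tsum (comul H)); last by mlin.
rewrite -(cs_fun (sb alpha) (F := fun a => hit HH beta (tih HH a e) \ox (d : DH))); last by lin.
apply: eq_cs => e' d'.
rewrite [X in _ *: (X \ox _)]/hitr.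
rewrite (lin_tsum _ _ (f := fun v : HH => _ *: (v \ox (d : DH)))); last by lin.
apply: eq_tsum => m0 b.
rewrite (linZ (f := fun v : HH => v \ox (d : DH))); last by lin.
by rewrite scalerA comp_lfunE.
Qed.

(** The composition that defines the action unfolds into [sharp] applied twice:
    the right coactions contribute [phi] with [beta], and the left coactions
    [phi^-1] with [alpha] composed with [S^-1]. *)
Lemma dual_actE (t : DHH) :
  dual_act H t = sharp cvop sb (sb alpha) phiV (tih DHH) act_r t.
Proof.
pose Psi : 'Hom(DHH *t (HH *t DH), DH) :=
  (tlift (fun t (g : DH) => evl HH t *: g) \o tmap (tmap \1 p) \1
     \o tmap (Phi DH HH HH) \1 \o PhiV DHH HH DH)%VF.
transitivity (Psi (t \ox coevl HH)).
  rewrite /dual_act [LHS]comp_lfunE; apply: (congr1 Psi).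
  by apply: lin_linfunE; lin.
have PsiE t' (m : HH) (n : DH) : (tlift (fun t (g : DH) => evl HH t *: g)
    \o tmap (tmap \1 p) \1 \o tmap (Phi DH HH HH) \1)%VF (t' \ox m \ox n) =
    (act_fun t' m : k) *: n.
  rewrite !comp_lfunE !tmap_tmk !id_lfunE tliftE tsumE; try by lin.
  by rewrite act_funE /act_form !comp_lfunE.
have fE (f a b c d : A) (e : H) : f (hit HH d (tih HH c (hit HH b (tih HH a e)))) =
    (a \cv c \cv f \cv d \cv b) e.
  by rewrite fun_hit fun_tih fun_hit fun_tih !convolA.
rewrite coevlE (cs_lin (f := fun v => Psi (t \ox v))); last by lin.
transitivity (ctr phiV (fun p1 p2 p3 => ctr phi (fun q1 q2 q3 =>
  cs (fun (e : HH) d => ((sb alpha \cv p2 \cv act_fun (hit DHH q1 (tih DHH p1 t)) \cv q2 \cv beta) e : k)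
     *: (sb p3 \cv d \cv s q3 : DH))))).
  transitivity (cs (fun (e : HH) d => ctr phiV (fun p1 p2 p3 => ctr phi (fun q1 q2 q3 =>
   ((sb alpha \cv p2 \cv act_fun (hit DHH q1 (tih DHH p1 t)) \cv q2 \cv beta) e : k)
     *: (sb p3 \cv d \cv s q3 : DH))))).
    apply: eq_cs => e d; rewrite /Psi [LHS]comp_lfunE /comp PhiV_tmk.
    rewrite (ctr_lin (f := fun v => (_ : 'Hom(_, DH)) v)); last by lin.
    apply: eq_ctr => p1 p2 p3.
    rewrite (ctr_lin (f := fun v => (_ : 'Hom(_, DH)) v)); last by lin.
    apply: eq_ctr => q1 q2 q3; rewrite PsiE fE.
    by rewrite tih_dual hit_dual.
  by rewrite cs_ctrC; apply: eq_ctr => p1 p2 p3; rewrite cs_ctrC.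
apply: eq_ctr => p1 p2 p3.
transitivity (ctr phi (fun q1 q2 q3 =>
  sb p3 \cv (sb alpha \cv p2 \cv act_fun (hit DHH q1 (tih DHH p1 t)) \cv q2 \cv beta) \cv s q3)).
  apply: eq_ctr => q1 q2 q3.
  by rewrite (cs_fun (V := HH) _ (F := fun d : A => sb p3 \cv d \cv s q3)) //; lin.
rewrite /act_r /sharp (ctr_lin (f := fun v => sb p3 \cv (sb alpha \cv (p2 \cv v)))); last by lin.
by apply: eq_ctr => q1 q2 q3; rewrite !convolA.
Qed.

Lemma act_r_tih a t :
  cop a (fun x y => y \cv act_r (tih DHH x t)) = (a one : k) *: act_r t.
Proof.
have /is_bicomodP[_ _ C] := DHHb.
rewrite /act_r /sharp -ctr_Z.
under eq_cop => x y do (rewrite (ctr_lin (f := fun v => y \cv v)); last by lin).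
rewrite cop_ctrC; apply: eq_ctr => q1 q2 q3.
rewrite -[RHS](linZ (f := fun v => v \cv q2 \cv beta \cv s q3)); last by lin.
rewrite -act_fun_tih (cop_lin (f := fun v => v \cv q2 \cv beta \cv s q3)); last by lin.
by apply: eq_cop => x y; rewrite C !convolA.
Qed.

(** The colinearity of the action and its defining property [dual_act_flat] are
    those of the two applications of [sharp]. *)
Lemma dual_act_hit a t : dual_act H (hit DHH a t) = hit DH a (dual_act H t).
Proof.
have /is_bicomodP[[M1 _] _ C] := DHHb.
rewrite !dual_actE hit_dual /sharp (ctr_lin (f := fun v => v \cv s a)); last by lin.
apply: eq_ctr => x y z; rewrite -C /act_r.
rewrite (sharp_act (drinfeld_dual H) (act := hit DHH)).
- by rewrite !convolA.
- by mlin.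
- exact: M1.
- exact: act_fun_lin.
- exact: act_fun_hit.
Qed.

Lemma dual_act_tih a t : dual_act H (tih DHH a t) = tih DH a (dual_act H t).
Proof.
have /is_bicomodP[_ [M1 _] C] := DHHb.
rewrite !dual_actE tih_dual.
rewrite (sharp_act (drinfeld_op H) (act := tih DHH)) //.
- by mlin.
- exact: act_r_lin.
- exact: act_r_tih.
Qed.

Lemma dual_act_flat t : sb beta \cv dual_act H t \cv alpha = act_fun t.
Proof.
have /is_bicomodP[[M1 M2] [M3 M4] C] := DHHb.
rewrite dual_actE.
rewrite (sharp_flat (drinfeld_op H) (act := tih DHH)) //.
- apply: (sharp_flat (drinfeld_dual H) (act := hit DHH)).
  + by mlin.
  + exact: M1.
  + exact: M2.
  + exact: act_fun_lin.
  + exact: act_fun_hit.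
- by mlin.
- exact: act_r_lin.
- exact: act_r_tih.
Qed.

End Dual.

Section DualHopfModule.
Variables (k : fieldType) (H : coquasiHopf k).
Local Notation A := ('Hom(H, k^o)).
Local Notation one := (unitC H 1).
Local Notation phi := (reass H).
Local Notation phiV := (reassV H).
Local Notation eps := (counit H).
Local Notation HH := (regular_bicomod H).
Local Notation DH := (dualH H).
Local Notation DHH := (btens DH HH).
Local Notation p := (Defs.mulC H).
Local Notation "x ** y" := (Defs.mulC H (x \ox y)) (at level 40, left associativity).
Local Notation S := (antip H).
Local Notation Sbar := (S^-1)%VF.
Local Notation alpha := (antip_alpha H).
Local Notation beta := (antip_beta H).
Local Notation s := (fun a : A => (a \o S)%VF).
Local Notation sb := (fun a : A => (a \o Sbar)%VF).
Let HP : is_coalgebra H := cqb_coalgP H.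

(** A morphism into the dual is determined by its pairing with [H]: the zigzag
    identities on the two sides recover it. *)
Lemma dual_hom_ext (X : bicomodData H) (r1 r2 : 'Hom(X, DH)) :
  bicomod_hom r1 -> bicomod_hom r2 ->
  (forall t, sb beta \cv r1 t \cv alpha = sb beta \cv r2 t \cv alpha) ->
  r1 =1 r2.
Proof.
have rec (r : 'Hom(X, DH)) : bicomod_hom r -> forall t, r t =
    ctr phiV (fun x y z => sb z \cv (sb alpha \cv (y \cv
      ctr phi (fun x' y' z' => (sb beta \cv r (hit X x' (tih X x t)) \cv alpha)
         \cv y' \cv beta \cv s z')))).
  move=> /bicomod_homP[e1 e2] t.
  transitivity (ctr phiV (fun x y z => sb z \cv (sb alpha \cv (y \cv (sb beta \cv (sb x \cv r t)))))).
    transitivity (eps \cv r t); first by rewrite convol1.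
    rewrite -sb1 -(ctr_phiV_fun H) (ctr_lin (f := fun v : A => sb v \cv r t)); last by lin.
    by apply: eq_ctr => x y z; rewrite !sbM sbK !convolA.
  apply: eq_ctr => x y z; congr (_ \cv (_ \cv (_ \cv _))).
  transitivity (sb beta \cv (sb x \cv r t) \cv eps); first by rewrite convolr1.
  rewrite -(ctr_phi_fun H).
  rewrite (ctr_lin (f := fun v : A => sb beta \cv (sb x \cv r t) \cv v)); last by lin.
  by apply: eq_ctr => x' y' z'; rewrite -e2 -e1 hit_dual tih_dual !convolA.
move=> h1 h2 e t; rewrite (rec r1 h1) (rec r2 h2).
by apply: eq_ctr => x y z; congr (_ \cv (_ \cv (_ \cv _))); apply: eq_ctr => x' y' z'; rewrite e.
Qed.

Lemma dual_act_hom : bicomod_hom (M := DHH) (N := DH) (dual_act H).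
Proof.
by apply/bicomod_homP; split=> a t; [rewrite dual_act_tih | rewrite dual_act_hit].
Qed.

Lemma evl_dual_act (t : DHH) (y : H) : evl HH (dual_act H t \ox y) = act_form H (t \ox y).
Proof. by rewrite evl_tmk dual_act_flat act_funE. Qed.

(** By [dual_hom_ext] the forms of both sides may be compared instead; that of an
    action is the evaluation after a product, so the claim becomes the
    associativity of the free module on the dual. *)
Lemma dual_act_assoc (t : DHH *t HH) :
  dual_act H (tmap (dual_act H) \1 t) = dual_act H (tmap \1 p (Phi DH HH HH t)).
Proof.
have bD := dual_is_bicomod H; have bH := regular_is_bicomod H.
have hI (M : bicomodData H) := id_bicomod_hom M.
have hA := dual_act_hom; have hm := mul_hom H.
pose r1 : 'Hom(btens DHH HH, DH) := (dual_act H \o tmap (dual_act H) \1)%VF.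
pose r2 : 'Hom(btens DHH HH, DH) := (dual_act H \o (tmap \1 p \o Phi DH HH HH))%VF.
have r1E u : r1 u = dual_act H (tmap (dual_act H) \1 u) by apply: comp_lfunE.
have r2E u : r2 u = dual_act H (tmap \1 p (Phi DH HH HH u)).
  by rewrite [LHS]comp_lfunE /comp [X in dual_act H X]comp_lfunE.
suff: r1 =1 r2 by move=> /(_ t); rewrite r1E r2E.
apply: dual_hom_ext.
- by apply: (comp_bicomod_hom (M := DHH)) => //; apply: tmap_hom.
- apply: (comp_bicomod_hom (M := DHH)) => //.
  apply: (comp_bicomod_hom (M := btens DH (btens HH HH))); last exact: Phi_hom.
  exact: tmap_hom.
move=> {}t; rewrite r1E r2E !dual_act_flat.
apply/lfunP=> z; rewrite !act_funE.
rewrite !act_formE; move: t; apply: tens_ext3 => [||f x y]; try by lin.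
transitivity (evl HH (tmap \1 p (tmap (dual_act H) \1 (Phi DHH HH HH (f \ox x \ox y \ox z))))).
  have := Phi_natural hA (hI HH) (hI HH) (f \ox x \ox y \ox z).
  by rewrite !tmap_tmk !id_lfunE tmap11 => ->.
transitivity (act_form H (tmap \1 p (Phi DHH HH HH (f \ox x \ox y \ox z)))).
  move: (Phi DHH HH HH _); apply: tens_ext => [||u v]; try by lin.
  by rewrite !tmap_tmk !id_lfunE evl_dual_act.
by rewrite act_formE (free_act_assoc bD) tmap_tmk id_lfunE free_hactE.
Qed.

Lemma dual_act_one (f : A) : dual_act H ((f : DH) \ox one) = f.
Proof.
pose r1 : 'Hom(DH, DH) := linfun (fun f : DH => dual_act H (f \ox one)).
have r1E (g : DH) : r1 g = dual_act H (g \ox one) by rewrite lin_linfunE //; lin.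
rewrite -r1E -[RHS](id_lfunE (f : DH)).
apply: (dual_hom_ext (X := DH)); last 1 first.
- move=> g; rewrite r1E id_lfunE dual_act_flat.
  apply/lfunP=> z; rewrite act_funE act_formE Phi_tmk.
  rewrite (ctr_lin (f := fun v => evl HH (tmap \1 p v))); last by lin.
  rewrite -evl_tmk.
  have bD : is_bicomod DH := dual_is_bicomod H; have bH := regular_is_bicomod H.
  have /is_bicomodP[[_ D1] [_ D2] _] := bD; have /is_bicomodP[[_ H1] [_ H2] _] := bH.
  transitivity (ctr phi (fun p1 p2 p3 => (p2 one : k) *: ctr phiV (fun q1 q2 q3 =>
    (q2 one : k) *: (evl HH (hit DH q1 (tih DH p1 g) \ox hit HH q3 (tih HH p3 z)))))).
    apply: eq_ctr => p1 p2 p3; rewrite -ctr_Z (ctr_lin (f := fun v => evl HH (tmap \1 p v))); last by lin.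
    apply: eq_ctr => q1 q2 q3; rewrite tmap_tmk id_lfunE tih_one.
    rewrite (linZ (f := fun v => evl HH (_ \ox (hit HH q2 v ** _)))); last by lin.
    rewrite hit_one (linZ (f := fun v => evl HH (_ \ox (v ** _)))); last by lin.
    by have [-> _] := @mulC_unital _ H (hit HH q3 (tih HH p3 z)).
  rewrite (phi_counit_mid (F := fun p1 p3 => ctr phiV (fun q1 q2 q3 =>
    (q2 one : k) *: (evl HH (hit DH q1 (tih DH p1 g) \ox hit HH q3 (tih HH p3 z)))))); last by mlin.
  rewrite (phiV_counit_mid (F := fun q1 q3 => evl HH (hit DH q1 (tih DH eps g) \ox hit HH q3 (tih HH eps z)))); last by mlin.
  by rewrite D1 D2 H1 H2.
- apply/bicomod_homP; split=> a g; rewrite !r1E.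
    rewrite -dual_act_tih btens_tih; congr (dual_act H _).
    rewrite -(cop_counitr a (F := fun x => tih DH x g \ox one)); last by lin.
    apply: eq_cop => x y; rewrite tih_one.
    by rewrite (linZ (f := fun v => _ \ox v)) //; lin.
  rewrite -dual_act_hit btens_hit; congr (dual_act H _).
  rewrite -(cop_counitr a (F := fun x => hit DH x g \ox one)); last by lin.
  apply: eq_cop => x y; rewrite hit_one.
  by rewrite (linZ (f := fun v => _ \ox v)) //; lin.
- exact: id_bicomod_hom.
Qed.

Lemma dual_is_hopfmod : is_hopfmod (dual_hopfmod H).
Proof.
split; [exact: dual_is_bicomod | exact: dual_act_hom | | exact: dual_act_one].
move=> f x y; rewrite comp_lfunE /=.
by rewrite -dual_act_assoc tmap_tmk id_lfunE.
Qed.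

End DualHopfModule.

(** * Coinvariants of Hopf modules *)

Section HopfModules.
Variables (k : fieldType) (H : coquasiHopf k).
Local Notation A := ('Hom(H, k^o)).
Local Notation one := (unitC H 1).
Local Notation phi := (reass H).
Local Notation phiV := (reassV H).
Local Notation eps := (counit H).
Local Notation HH := (regular_bicomod H).
Local Notation p := (Defs.mulC H).
Local Notation "x ** y" := (Defs.mulC H (x \ox y)) (at level 40, left associativity).
Local Notation S := (antip H).
Local Notation Sbar := (S^-1)%VF.
Local Notation alpha := (antip_alpha H).
Local Notation beta := (antip_beta H).
Local Notation sb := (fun a : A => (a \o Sbar)%VF).
Let HP : is_coalgebra H := cqb_coalgP H.

Implicit Types U : vectType k.

Lemma hit_lfunE (b : A) (e : H) : linfun (hit HH b) e = hit HH b e.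
Proof. by rewrite lin_linfunE //; lin. Qed.

Lemma tih_lfunE (b : A) (e : H) : linfun (tih HH b) e = tih HH b e.
Proof. by rewrite lin_linfunE //; lin. Qed.

Lemma cs_hit U (b : A) (F : H -> A -> U) : lin2 F ->
  cs (fun e d => F (hit HH b e) d) = cs (fun e d => F e (d \cv b)).
Proof.
case=> l1 l2; under eq_cs => e d do rewrite -hit_lfunE.
rewrite (cs_tr (linfun (hit HH b)) l1 l2); apply: eq_cs => e d; congr (F _ _).
by apply/lfunP=> x; rewrite comp_lfunE hit_lfunE fun_hit.
Qed.

Lemma cs_tih U (b : A) (F : H -> A -> U) : lin2 F ->
  cs (fun e d => F (tih HH b e) d) = cs (fun e d => F e (b \cv d)).
Proof.
case=> l1 l2; under eq_cs => e d do rewrite -tih_lfunE.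
rewrite (cs_tr (linfun (tih HH b)) l1 l2); apply: eq_cs => e d; congr (F _ _).
by apply/lfunP=> x; rewrite comp_lfunE tih_lfunE fun_tih.
Qed.

Lemma tih_Sbar (a : A) (x : H) : tih HH a (Sbar x) = Sbar (hit HH (sb a) x).
Proof.
apply: fun_separate => f; rewrite fun_tih -[RHS]comp_lfunE fun_hit -sbM.
by rewrite comp_lfunE.
Qed.

Lemma hit_Sbar (a : A) (x : H) : hit HH a (Sbar x) = Sbar (tih HH (sb a) x).
Proof.
apply: fun_separate => f; rewrite fun_hit -[RHS]comp_lfunE fun_tih -sbM.
by rewrite comp_lfunE.
Qed.

(** This is [antip_betaP] transported by [S^-1]:
    [sum beta(S^-1(h_2)) S^-1(h_3) h_1 = beta(S^-1(h)) 1]. *)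
Lemma cs_Sbar_beta U (F : A -> H -> U) : lin2 F ->
  cs (fun e d => cs (fun e' d' => F (d \cv sb beta \cv d') (Sbar e' ** e)))
  = F (sb beta) one.
Proof.
move=> L.
transitivity (cs (fun f a => cs (fun e d => cs (fun e' d' =>
   (a (Sbar e' ** e) : k) *: F (d \cv sb beta \cv d') f)))).
  rewrite -[RHS]cs_rot; apply: eq_cs => e d; apply: eq_cs => e' d'.
  by rewrite (cs_vec _ (F := F (d \cv sb beta \cv d'))) //; lin.
rewrite -(cs_vec one (F := F (sb beta))); last by lin.
apply: eq_cs => f a.
rewrite -(dr_alphaK (drinfeld_op H) (F := fun v => F v f)); last by lin.
rewrite csC /cop.
rewrite (cs_tr Sbar (F := fun e' d' => cs (fun e d =>
  (a (e' ** e) : k) *: F (d \cv sb beta \cv d') f))); try by lin.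
by apply: eq_cs => e' d'; apply: eq_cs => e d; rewrite convolA.
Qed.

Section Structure.
Variable M : hopfModData H.
Hypothesis MP : is_hopfmod M.

Let M1 a b m : hit M (a \cv b) m = hit M a (hit M b m).
Proof. by have [/is_bicomodP[[-> _] _ _] _ _ _] := MP. Qed.
Let M2 m : hit M eps m = m.
Proof. by have [/is_bicomodP[[_ ->] _ _] _ _ _] := MP. Qed.
Let M3 a b m : tih M (a \cv b) m = tih M b (tih M a m).
Proof. by have [/is_bicomodP[_ [-> _] _] _ _ _] := MP. Qed.
Let M4 m : tih M eps m = m.
Proof. by have [/is_bicomodP[_ [_ ->] _] _ _ _] := MP. Qed.
Let M5 a b m : hit M a (tih M b m) = tih M b (hit M a m).
Proof. by have [/is_bicomodP[_ _ ->] _ _ _] := MP. Qed.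

Lemma hact_tih a m x : tih M a (hact M (m \ox x)) =
  cop a (fun u v => hact M (tih M u m \ox tih HH v x)).
Proof.
have [_ /bicomod_homP[-> _] _ _] := MP; rewrite btens_tih.
by rewrite (cop_lin (f := hact M)) //; lin.
Qed.

Lemma hact_assoc m x y : hact M (hact M (m \ox x) \ox y) =
  ctr phi (fun p1 p2 p3 => ctr phiV (fun q1 q2 q3 =>
    hact M (hit M q1 (tih M p1 m) \ox
      (hit HH q2 (tih HH p2 x) ** hit HH q3 (tih HH p3 y))))).
Proof.
have [_ _ -> _] := MP; rewrite comp_lfunE Phi_tmk.
rewrite (ctr_lin (f := fun v => hact M (tmap \1 p v))); last by lin.
apply: eq_ctr => p1 p2 p3.
rewrite (ctr_lin (f := fun v => hact M (tmap \1 p v))); last by lin.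
by apply: eq_ctr => q1 q2 q3; rewrite tmap_tmk id_lfunE.
Qed.

(** This is [m |-> sum alpha(S^-1(m_(-1))) m_0 . S^-1(m_(-2))]. *)
Definition coinv_proj (m : M) : M :=
  cs (fun (e : H) d => hact M (tih M (d \cv sb alpha) m \ox Sbar e)).

(** The coaction of [coinv_proj m] has the factor
    [alpha(S^-1(m_(-2))) m_(-1) S^-1(m_(-3))], which [antip_alphaP] transported by
    [S^-1] collapses to a multiple of 1. *)
Lemma coinv_projP a m : tih M a (coinv_proj m) = (a one : k) *: coinv_proj m.
Proof.
rewrite /coinv_proj (cs_lin (f := tih M a)); last by lin.
rewrite cs_scaler.
transitivity (cop a (fun u v => cs (fun (e : H) d =>
  hact M (tih M (d \cv sb alpha \cv u) m \ox Sbar (hit HH (sb v) e))))).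
  rewrite /cop; under [RHS]eq_cs => x b do under eq_cs => y c do rewrite cs_scaler.
  rewrite [RHS]cs_rot; apply: eq_cs => e d.
  rewrite hact_tih /cop; apply: eq_cs => x b; apply: eq_cs => y c.
  by rewrite tih_Sbar !M3.
transitivity (cop a (fun u v => cs (fun (e : H) d =>
  hact M (tih M (d \cv (sb v \cv (sb alpha \cv u))) m \ox Sbar e)))).
  apply: eq_cop => u v.
  rewrite (cs_hit (sb v) (F := fun e d =>
    hact M (tih M (d \cv sb alpha \cv u) m \ox Sbar e))); last by mlin.
  by apply: eq_cs => e d; rewrite !convolA.
rewrite (dr_betaK (drinfeld_op H) (F := fun w => cs (fun (e : H) d =>
  hact M (tih M (d \cv w) m \ox Sbar e)))); last by lin.
by rewrite cs_scaler.
Qed.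

(** For a Hopf algebra, [sum E(m_0) . m_(-1) = sum m_0 . (S^-1(m_(-1)) m_(-2)) = m]
    for [E] the map [coinv_proj].  In general, the zigzag axiom creates the
    factors [alpha] and [beta], the axiom for [beta] splits the unit into
    [S^-1(h_3) h_1], and a pair [phi^-1], [phi] is inserted.  The associator of
    the zigzag axiom and the inserted [phi^-1] are those of [hact_assoc]; the
    inserted [phi] remains. *)
Lemma coinv_proj_recover (m : M) :
  m = cs (fun (e : H) d => ctr phi (fun r1 r2 r3 =>
    hact M (coinv_proj (hit M r1 (tih M (d \cv r3 \cv sb beta \cv sb r2) m)) \ox e))).
Proof.
(* The module factor common to all steps: [p1], [p2], [p3] come from the zigzag
   axiom, [x], [y], [z] from the inserted associators. *)
pose n d d' p1 p2 p3 x y z :=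
  hit M x (tih M (p3 \cv d \cv z \cv sb beta \cv sb y \cv d' \cv sb p2 \cv sb alpha \cv p1) m).
transitivity (ctr phi (fun p1 p2 p3 => cs (fun (e : H) d => cs (fun (e' : H) d' =>
  ctr phiV (fun q1 q2 q3 => ctr phi (fun r1 r2 r3 =>
    hact M (n d d' p1 p2 p3 (q1 \cv r1) (q2 \cv r2) (q3 \cv r3) \ox (Sbar e' ** e)))))))).
  transitivity (ctr phi (fun p1 p2 p3 => cs (fun (e : H) d => cs (fun (e' : H) d' =>
    hact M (tih M (p3 \cv (d \cv sb beta \cv d') \cv sb p2 \cv sb alpha \cv p1) m
        \ox (Sbar e' ** e)))))); last first.
    apply: eq_ctr => p1 p2 p3; apply: eq_cs => e d; apply: eq_cs => e' d'.
    rewrite (ctr_phiVK (B := fun x y z =>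
      hact M (n d d' p1 p2 p3 x y z \ox (Sbar e' ** e)))); last by rewrite /n; mlin.
    by rewrite /n M2 sb1 !convolA // !convolr1.
  transitivity (ctr phi (fun p1 p2 p3 =>
    hact M (tih M (p3 \cv sb beta \cv sb p2 \cv sb alpha \cv p1) m \ox one))); last first.
    apply: eq_ctr => p1 p2 p3.
    by rewrite (cs_Sbar_beta (F := fun v h => hact M
     (tih M (p3 \cv v \cv sb p2 \cv sb alpha \cv p1) m \ox h))) //; mlin.
  have [_ _ _ unit] := MP; rewrite -[LHS]unit -[X in X \ox _]M4 -sb1 -(ctr_phi_fun H).
  rewrite (ctr_lin (f := fun v : A => hact M (tih M (sb v) m \ox one))); last by lin.
  by apply: eq_ctr => p1 p2 p3; rewrite !sbM !sbK !convolA.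
transitivity (ctr phi (fun p1 p2 p3 => ctr phiV (fun q1 q2 q3 => ctr phi (fun r1 r2 r3 =>
  cs (fun (e : H) d => cs (fun (e' : H) d' =>
    hact M (n d d' p1 p2 p3 (q1 \cv r1) (q2 \cv r2) (q3 \cv r3) \ox (Sbar e' ** e)))))))).
  apply: eq_ctr => p1 p2 p3.
  under eq_cs => e d do rewrite cs_ctrC.
  rewrite cs_ctrC; apply: eq_ctr => q1 q2 q3.
  under eq_cs => e d do rewrite cs_ctrC.
  by rewrite cs_ctrC.
rewrite [RHS]cs_ctrC.
transitivity (ctr phi (fun r1 r2 r3 => ctr phi (fun p1 p2 p3 => ctr phiV (fun q1 q2 q3 =>
  cs (fun (e : H) d => cs (fun (e' : H) d' =>
    hact M (n d d' p1 p2 p3 (q1 \cv r1) (q2 \cv r2) (q3 \cv r3) \ox (Sbar e' ** e)))))))).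
  rewrite [RHS]ctr_ctrC; apply: eq_ctr => p1 p2 p3; exact: ctr_ctrC.
apply: eq_ctr => r1 r2 r3.
pose n0 d d' := hit M r1 (tih M (d \cv r3 \cv sb beta \cv sb r2 \cv d' \cv sb alpha) m).
transitivity (cs (fun (e : H) d => cs (fun (e' : H) d' =>
   hact M (hact M (n0 d d' \ox Sbar e') \ox e)))); last first.
  apply: eq_cs => e d; rewrite /coinv_proj (cs_lin (f := fun v => hact M (v \ox e))); last by lin.
  by apply: eq_cs => e' d'; rewrite -M5 -M3 /n0 !convolA.
transitivity (ctr phi (fun p1 p2 p3 => ctr phiV (fun q1 q2 q3 =>
  cs (fun (e : H) d => cs (fun (e' : H) d' =>
    hact M (hit M q1 (tih M p1 (n0 d d')) \ox
      (Sbar (tih HH (sb q2) (hit HH (sb p2) e')) ** hit HH q3 (tih HH p3 e)))))))); last first.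
  under [RHS]eq_cs => e d do under eq_cs => e' d' do rewrite hact_assoc.
  under [RHS]eq_cs => e d do rewrite cs_ctrC.
  rewrite [RHS]cs_ctrC; apply: eq_ctr => p1 p2 p3.
  under [RHS]eq_cs => e d do rewrite cs_ctrC.
  rewrite [RHS]cs_ctrC; apply: eq_ctr => q1 q2 q3.
  by apply: eq_cs => e d; apply: eq_cs => e' d'; rewrite tih_Sbar hit_Sbar.
apply: eq_ctr => p1 p2 p3; apply: eq_ctr => q1 q2 q3; symmetry.
rewrite (cs_tih p3 (F := fun e d => cs (fun (e' : H) d' =>
    hact M (hit M q1 (tih M p1 (n0 d d')) \ox
      (Sbar (tih HH (sb q2) (hit HH (sb p2) e')) ** hit HH q3 e)))));
  last by rewrite /n0; mlin.
rewrite (cs_hit q3 (F := fun e d => cs (fun (e' : H) d' =>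
    hact M (hit M q1 (tih M p1 (n0 (p3 \cv d) d')) \ox
      (Sbar (tih HH (sb q2) (hit HH (sb p2) e')) ** e)))));
  last by rewrite /n0; mlin.
apply: eq_cs => e d.
rewrite (cs_hit (sb p2) (F := fun e' d' =>
    hact M (hit M q1 (tih M p1 (n0 (p3 \cv (d \cv q3)) d')) \ox
      (Sbar (tih HH (sb q2) e') ** e))));
  last by rewrite /n0; mlin.
rewrite (cs_tih (sb q2) (F := fun e' d' =>
    hact M (hit M q1 (tih M p1 (n0 (p3 \cv (d \cv q3)) (d' \cv sb p2))) \ox
      (Sbar e' ** e))));
  last by rewrite /n0; mlin.
apply: eq_cs => e' d'.
by rewrite /n0 /n -M5 -M1 -M3 sbM !convolA.
Qed.

End Structure.

(** A morphism commutes with [coinv_proj], so it kills [m] only if it kills the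
    coinvariants from which [m] is recovered. *)
Lemma hopfmod_hom_inj (M N : hopfModData H) (f : 'Hom(M, N)) :
  is_hopfmod M -> hopfmod_hom f ->
  (forall m, (forall a, tih M a m = (a one : k) *: m) -> f m = 0 -> m = 0) ->
  injective f.
Proof.
move=> MP [/bicomod_homP[f1 f2] f3] f0.
have key m : f m = 0 -> coinv_proj m = 0.
  move=> fm0; apply: f0; first by move=> a; apply: coinv_projP.
  rewrite /coinv_proj cs_hom.
  transitivity (cs (fun (_ : H) (_ : A) => 0 : N)).
    apply: eq_cs => e d; rewrite f3 -f1 fm0.
    by apply: (lin0 (f := fun v => hact N (tih N (d \cv sb alpha) v \ox Sbar e))); lin.
  by rewrite /cs big1.
apply/lker0P; rewrite -subv0; apply/subvP=> m; rewrite memv_ker memv0 => /eqP fm0.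
apply/eqP; rewrite (coinv_proj_recover MP m).
transitivity (cs (fun (e : H) (_ : A) => 0 : M)); last by rewrite /cs big1.
apply: eq_cs => e d; transitivity (ctr phi (fun r1 r2 r3 => hact M ((0 : M) \ox e))); last first.
  by apply: (lin0 (f := fun v : M => ctr phi (fun r1 r2 r3 => hact M (v \ox e)))); lin.
apply: eq_ctr => r1 r2 r3; congr (hact M (_ \ox _)); apply: key.
rewrite -f2 -f1 fm0.
by apply: (lin0 (f := fun v => hit N r1 (tih N (d \cv r3 \cv sb beta \cv sb r2) v))); lin.
Qed.

End HopfModules.

(** * Cointegrals and coinvariants of free modules *)

Section Cointegrals.
Variables (k : fieldType) (H : coquasiHopf k).
Local Notation A := ('Hom(H, k^o)).
Local Notation one := (unitC H 1).
Local Notation phi := (reass H).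
Local Notation eps := (counit H).
Local Notation HH := (regular_bicomod H).
Local Notation DH := (dualH H).
Local Notation S := (antip H).
Local Notation Sbar := (S^-1)%VF.
Local Notation alpha := (antip_alpha H).
Local Notation beta := (antip_beta H).
Let HP : is_coalgebra H := cqb_coalgP H.

Lemma one_neq0 : one != 0.
Proof.
apply/eqP=> e; have := counit_one H; rewrite e linear0 => /eqP.
by rewrite eq_sym oner_eq0.
Qed.

(** [antip_phiP] at the unit shows [alpha 1 != 0], and then [antip_alphaP]
    forces [S 1 = 1]. *)
Lemma antip_one : S one = one.
Proof.
have e1 : phi (S one \ox one \ox S one) * alpha one * beta one = 1.
  rewrite -[RHS](counit_one H) -(antip_phiP one).
  by do 4 (rewrite comul_one tsumE; try by lin).
have a1 : alpha one != 0.
  by apply/eqP=> e; move: e1; rewrite e mulr0 mul0r => /eqP; rewrite eq_sym oner_eq0.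
have := antip_alphaP one.
do 2 (rewrite comul_one tsumE; try by lin).
have [_ ->] := @mulC_unital _ H (S one).
by move/(scalerI a1).
Qed.

Lemma Sbar_one : Sbar one = one.
Proof. by rewrite -{1}antip_one antipK. Qed.

(** The left coaction of the dual is composed with [S^-1]; as [S] is bijective and
    fixes 1, the functionals [a] and [a S^-1] are interchangeable. *)
Lemma coinv_cointegral (f : A) :
  (forall a, tih DH a f = (a one : k) *: f) <-> f \in left_cointegrals H.
Proof.
split=> [e | /left_cointegralsP e a].
  apply/left_cointegralsP=> x; apply: fun_separate => b.
  have := e (b \o S)%VF; rewrite tih_dual sbK comp_lfunE antip_one => eb.
  transitivity ((b \cv f) x); last by rewrite eb scale_lfunE linearZ; apply: mulrC.
  by rewrite tsum_hom convolE; apply: eq_tsum => y z; rewrite linearZ; apply: mulrC.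
rewrite tih_dual; apply/lfunP=> x; rewrite scale_lfunE.
transitivity ((a \o Sbar)%VF (f x *: one)); last first.
  have {2}<- : Sbar one = one := Sbar_one.
  rewrite -[a (Sbar _)]comp_lfunE.
  rewrite (linZ (f := (a \o Sbar)%VF)); last by lin.
  exact: mulrC.
rewrite -(e x) tsum_hom convolE; apply: eq_tsum => y z.
by rewrite linearZ; apply: mulrC.
Qed.

Local Notation W := (cointegral_comod H).

Lemma left_cointegrals_hit a (f : A) :
  f \in left_cointegrals H -> hit DH a f \in left_cointegrals H.
Proof.
move/coinv_cointegral => e; apply/coinv_cointegral => b.
have /is_bicomodP[_ _ C] := dual_is_bicomod H.
by rewrite -C e; apply: (linZ (f := hit DH a)); lin.
Qed.

Local Notation vsW := (vsproj (left_cointegrals H)).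

Lemma lin_vsval (U : vectType k) (f : U -> W) : lin f -> lin (fun u => vsval (f u) : DH).
Proof. by move=> lf a u v; rewrite lf linearP. Qed.

Lemma lin_vsproj (U : vectType k) (f : U -> DH) : lin f -> lin (fun u => vsW (f u) : W).
Proof. by move=> lf a u v; rewrite lf linearP. Qed.

Definition coint_val : 'Hom(W, DH) := linfun (fun w : W => vsval w : DH).

Lemma coint_valE (w : W) : coint_val w = vsval w.
Proof. by rewrite lin_linfunE //; apply: (lin_vsval (f := id)). Qed.

Lemma coint_val_inj : injective coint_val.
Proof. by move=> v w; rewrite !coint_valE; apply: val_inj. Qed.

Lemma hit_coint a (w : W) : coint_val (hitr (comod_co W) a w) = hit DH a (coint_val w).
Proof.
rewrite !coint_valE.
have wW : vsval w \in left_cointegrals H by apply: subvsP.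
rewrite -[RHS](vsprojK (left_cointegrals_hit a wW)); congr (vsval _).
rewrite {1}/hitr /= lin_linfunE; last first.
  apply: lin_tsuml; apply: (lin_hom (rco DH)); exact: (lin_vsval (f := id)).
rewrite tsum_tsum [in RHS]/hitr (lin_tsum _ _ (f := vsW)); last first.
  exact: (lin_vsproj (f := id)).
apply: eq_tsum => f h; rewrite tsumE; try by lin.
by rewrite linearZ.
Qed.

Lemma cointegral_comod_is_comod : is_comod W.
Proof.
have /is_bicomodP[[D1 D2] _ _] := dual_is_bicomod H.
apply/right_coactionP; split=> [a b|] w; apply: coint_val_inj.
  by rewrite !hit_coint D1.
by rewrite hit_coint D2.
Qed.

Lemma restricts_coactionP : restricts_coaction H.
Proof.
move=> w; rewrite [RHS]hitr_coact hitr_tsum.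
  by apply: eq_cs => e d; rewrite -!coint_valE hit_coint.
by split=> [h|v]; [apply: lin_tmkl; apply: (lin_vsval (f := id)) | lin].
Qed.

Section TrivialLeft.
Variable V : comodData H.
Hypothesis VP : is_comod V.
Local Notation Y := (trivial_left V).
Local Notation YH := (btens Y HH).

Lemma trivial_left_tih a (v : V) : tih Y a v = (a one : k) *: v.
Proof. by rewrite /hitl lin_linfunE ?tsumE //; lin. Qed.

Lemma trivial_left_is_bicomod : is_bicomod Y.
Proof.
have [R1 R2] := (right_coactionP _).1 VP.
apply/is_bicomodP; split=> [||a b v]; first by split.
  split=> [a b v | v]; rewrite !trivial_left_tih ?counit_one ?scale1r //.
  by rewrite convol_one scalerA mulrC.
by rewrite !trivial_left_tih; apply: (linZ (f := hit Y a)); lin.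
Qed.

(** The coefficient [v] of a coinvariant [v (x) 1]. *)
Definition free_coef (z : YH) : V := \tsum_(v, x <- z) (eps x : k) *: v.

Lemma lin_free_coef : lin free_coef.
Proof. by rewrite /free_coef; lin. Qed.

Lemma free_coefE v x : free_coef (v \ox x) = (eps x : k) *: v.
Proof. by rewrite /free_coef tsumE //; lin. Qed.

(** With a trivial left coaction on [V], only the factor [H] is seen by the left
    coaction of the free module. *)
Lemma free_tih a v x : tih YH a (v \ox x) = v \ox tih HH a x.
Proof.
rewrite btens_tih -[RHS](cop_counitl a (F := fun b => v \ox tih HH b x));
  last by lin.
apply: eq_cop => b c; rewrite trivial_left_tih.
by apply: (linZ (f := fun w => w \ox tih HH c x)); lin.
Qed.

Lemma free_tih_one a v : tih YH a (v \ox one) = (a one : k) *: (v \ox one).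
Proof.
rewrite free_tih tih_one.
by apply: (linZ (f := fun x => v \ox x)); lin.
Qed.

Lemma free_hit_one a (v : V) : hit YH a (v \ox one) = hit Y a v \ox one.
Proof.
rewrite btens_hit -[RHS](cop_counitr a (F := fun b => hit Y b v \ox one));
  last by lin.
apply: eq_cop => b c; rewrite hit_one.
by apply: (linZ (f := fun w => hit Y b v \ox w)); lin.
Qed.

Lemma free_coef_tih (z : YH) : z = cs (fun e d => free_coef (tih YH d z) \ox e).
Proof.
have lF := lin_free_coef; move: z; apply: (tens_ext (F := id)) => [||v x] //.
  apply: lin_cs => e d; apply: lin_tmkl; apply: (lin_comp lF); lin.
rewrite -[LHS](cs_vec x (F := fun x => v \ox x)); last by lin.
apply: eq_cs => e d; rewrite free_tih free_coefE fun_tih convolr1 //.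
by rewrite (linZ (f := fun w => w \ox e)) //; lin.
Qed.

Lemma free_coinv (z : YH) :
  (forall a, tih YH a z = (a one : k) *: z) -> z = free_coef z \ox one.
Proof.
move=> e; rewrite {1}(free_coef_tih z).
rewrite -[RHS](cs_vec one (F := fun x => free_coef z \ox x)); last by lin.
apply: eq_cs => y d; rewrite e (linZ _ _ lin_free_coef).
by rewrite (linZ (f := fun w => w \ox y)) //; lin.
Qed.

End TrivialLeft.
End Cointegrals.

(** * The Frobenius isomorphism *)

Section Frobenius.
Variables (k : fieldType) (H : coquasiHopf k).
Local Notation A := ('Hom(H, k^o)).
Local Notation one := (unitC H 1).
Local Notation phi := (reass H).
Local Notation HH := (regular_bicomod H).
Local Notation DH := (dualH H).
Local Notation p := (Defs.mulC H).
Local Notation S := (antip H).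
Local Notation Sbar := (S^-1)%VF.
Local Notation beta := (antip_beta H).
Local Notation sb := (fun a : A => (a \o Sbar)%VF).
Let HP : is_coalgebra H := cqb_coalgP H.
Local Notation W := (cointegral_comod H).
Local Notation X := (trivial_left W).
Local Notation XH := (btens X HH).
Local Notation FW := (free_hopfmod X).
Local Notation vsW := (vsproj (left_cointegrals H)).

Let WP : is_comod W := cointegral_comod_is_comod H.
Let XP : is_bicomod X := trivial_left_is_bicomod WP.

Lemma frobenius_act (t : XH) :
  frobenius H t = dual_act H (tmap (coint_val H) \1 t).
Proof.
move: t; apply: tens_ext => [||w x]; try by lin.
by rewrite frobeniusE tmap_tmk id_lfunE coint_valE.
Qed.

Lemma coint_val_hom : bicomod_hom (M := X) (N := DH) (coint_val H).
Proof.
apply/bicomod_homP; split=> a w; last by rewrite -hit_coint.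
rewrite trivial_left_tih (linZ (f := coint_val H)); last by lin.
by rewrite coint_valE; apply: (coinv_cointegral _).2; apply: subvsP.
Qed.

(** The Frobenius map is the action of the dual restricted along the inclusion of
    the cointegrals, which is a bicomodule map. *)
Lemma frobenius_hom : hopfmod_hom (M := FW) (N := dual_hopfmod H) (frobenius H).
Proof.
have fE : frobenius H = (dual_act H \o tmap (coint_val H) \1)%VF.
  apply/lfunP=> t; rewrite [RHS]comp_lfunE; exact: frobenius_act.
have bH : bicomod_hom (M := HH) (N := HH) \1%VF := id_bicomod_hom HH.
split.
  rewrite fE; apply: (comp_bicomod_hom (M := btens DH HH)).
    exact: dual_act_hom.
  apply: tmap_hom bH; exact: coint_val_hom.
move=> t x; rewrite !frobenius_act -[hact (dual_hopfmod H)]/(dual_act H).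
rewrite free_hactE.
have -> : tmap (coint_val H) \1 (tmap \1 p (Phi X HH HH (t \ox x))) =
    tmap \1 p (Phi DH HH HH (tmap (tmap (coint_val H) \1) \1 (t \ox x))).
  rewrite (Phi_natural coint_val_hom bH bH) !tmap_comp tmap11.
  by rewrite !comp_lfun1l !comp_lfun1r.
by rewrite -dual_act_assoc !tmap_tmk !id_lfunE.
Qed.

Lemma frobenius_inj : injective (frobenius H).
Proof.
apply: (hopfmod_hom_inj (free_is_hopfmod XP) frobenius_hom) => z.
move/free_coinv=> ->; rewrite frobeniusE dual_act_one => e.
rewrite (_ : free_coef z = 0).
  by apply: (lin0 (f := fun v : W => v \ox one)); lin.
by apply: val_inj.
Qed.

(** By [coinv_proj_recover], with [coinv_proj] landing in the cointegrals. *)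
Lemma frobenius_surj f : exists t, frobenius H t = f.
Proof.
pose r := coinv_proj (M := dual_hopfmod H).
have rW g : r g \in left_cointegrals H.
  by apply/coinv_cointegral => a; apply: coinv_projP (dual_is_hopfmod H) _ _.
rewrite (coinv_proj_recover (dual_is_hopfmod H) f).
exists (cs (fun (e : H) d => ctr phi (fun r1 r2 r3 =>
  vsW (r (hit DH r1 (tih DH (d \cv r3 \cv sb beta \cv sb r2) f))) \ox e))).
rewrite cs_hom; apply: eq_cs => e d.
rewrite (ctr_lin (f := frobenius H)); last by lin.
by apply: eq_ctr => r1 r2 r3; rewrite frobeniusE vsprojK.
Qed.

Lemma inverse_hopfmod_hom (M N : hopfModData H) (f : 'Hom(M, N)) (g : 'Hom(N, M)) :
  hopfmod_hom f -> cancel f g -> cancel g f -> hopfmod_hom g.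
Proof.
move=> [/bicomod_homP[f1 f2] f3] fK gK; split.
  by apply/bicomod_homP; split=> a n; apply: (can_inj fK);
    rewrite gK -?f1 -?f2 gK.
by move=> n x; apply: (can_inj fK); rewrite f3 !gK.
Qed.

Lemma frobenius_iso : hopfmod_iso (frobenius H).
Proof.
split; [exact: free_is_hopfmod XP | exact: dual_is_hopfmod | exact: frobenius_hom |].
have fK : cancel (frobenius H) (frobenius H)^-1%VF.
  by apply: lker0_lfunK; apply/lker0P; apply: frobenius_inj.
have gK : cancel (frobenius H)^-1%VF (frobenius H).
  by move=> f; have [t <-] := frobenius_surj f; rewrite fK.
by exists (frobenius H)^-1%VF; split=> //; apply: inverse_hopfmod_hom frobenius_hom fK gK.
Qed.

Lemma dim_tens (V U : vectType k) : \dim {:V *t U} = (\dim {:V} * \dim {:U})%N.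
Proof. by rewrite dimvf. Qed.

Lemma dim_dual (V : vectType k) : \dim {:'Hom(V, k^o)} = \dim {:V}.
Proof. by rewrite dimvf /dim /= !dimvf muln1. Qed.

Lemma can_dim (V U : vectType k) (f : 'Hom(V, U)) (g : 'Hom(U, V)) :
  cancel f g -> cancel g f -> \dim {:V} = \dim {:U}.
Proof.
move=> fK gK; rewrite -(limg_dim_eq (f := f) (U := fullv)).
  congr (\dim _); apply/vspaceP=> u; rewrite memvf -[u]gK memv_img ?memvf //.
by apply/eqP; rewrite capfv; apply/lker0P; apply: can_inj fK.
Qed.

Lemma dim_cointegrals : \dim {:W} = 1%N.
Proof.
have n0 : (0 < \dim {:H})%N.
  by rewrite lt0n dimv_eq0; apply: contra (one_neq0 H) => /eqP e; rewrite -memv0 -e memvf.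
have [_ _ _ [g [_ fK gK]]] := frobenius_iso.
have := can_dim fK gK; rewrite dim_tens [RHS]dim_dual => /eqP.
by rewrite -[X in _ == X]mul1n eqn_pmul2r // => /eqP.
Qed.

(** An isomorphism of Hopf modules identifies left coinvariants, which are
    [V (x) 1] on one side and the cointegrals on the other. *)
Lemma coinv_comod_isom (V : comodData H)
    (F : 'Hom(free_hopfmod (trivial_left V), dual_hopfmod H)) :
  is_comod V -> \dim {:V} = 1%N -> hopfmod_iso F -> comod_isom V W.
Proof.
move=> VP dV [_ _ [/bicomod_homP[F1 F2] _] [G [_ FK GK]]].
have Fcoinv (v : V) : F (v \ox one) \in left_cointegrals H.
  apply/coinv_cointegral => a; rewrite F1 free_tih_one.
  by apply: (linZ (f := F)); lin.
pose psi : 'Hom(V, W) := linfun (fun v => vsW (F (v \ox one))).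
have psiE v : coint_val H (psi v) = F (v \ox one).
  rewrite coint_valE lin_linfunE ?vsprojK //.
  by apply: lin_vsproj; lin.
have psi_inj : injective psi.
  move=> v w e; have : v \ox one = w \ox one by apply: (can_inj FK); rewrite -!psiE e.
  by move/(congr1 (@free_coef _ _ V)); rewrite !free_coefE counit_one !scale1r.
have psiK : cancel psi psi^-1%VF by apply: lker0_lfunK; apply/lker0P.
have psiVK : cancel psi^-1%VF psi.
  move=> w; apply: limg_lfunVK; rewrite (_ : limg psi = fullv) ?memvf //.
  apply/eqP; rewrite eqEdim subvf limg_dim_eq ?dV ?dim_cointegrals //.
  by apply/eqP; rewrite capfv; apply/lker0P.
have psi_hit a v : hitr (comod_co W) a (psi v) = psi (hitr (comod_co V) a v).
  apply: coint_val_inj; rewrite hit_coint !psiE F2.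
  by congr (F _); apply: free_hit_one.
exists psi, psi^-1%VF; split=> //; apply/hitr_hom => // a w.
by apply: psi_inj; rewrite -psi_hit !psiVK.
Qed.
End Frobenius.

Theorem theorem7 (k : fieldType) (H : coquasiHopf k) :
  (exists W : comodData H,
     [/\ is_comod W, \dim {:W} = 1%N,
         (exists F : 'Hom(free_hopfmod (trivial_left W), dual_hopfmod H),
            hopfmod_iso F)
       & forall W' : comodData H,
           is_comod W' -> \dim {:W'} = 1%N ->
           (exists F : 'Hom(free_hopfmod (trivial_left W'), dual_hopfmod H),
              hopfmod_iso F) ->
           comod_isom W' W])
  /\ [/\ restricts_coaction H, is_comod (cointegral_comod H),
         \dim {:cointegral_comod H} = 1%N
       & hopfmod_iso (frobenius H)].
Proof.
have WP := cointegral_comod_is_comod H; have Wd := dim_cointegrals H.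
have Wi := frobenius_iso H.
split; last by split=> //; apply: restricts_coactionP.
exists (cointegral_comod H); split=> //; first by exists (frobenius H).
by move=> V VP dV [F Fi]; apply: coinv_comod_isom dV Fi.
Qed.
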